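(* Let $\mathcal{S}\subseteq M_d$ and $\mathcal{T}\subseteq M_{d'}$ be irreducibly acting non-commutative graphs. Then $\mathcal{S}$ and $\mathcal{T}$ are $\Delta$-equivalent if and only if $\mathcal{S}$ and $\mathcal{T}$ are TRO-equivalent (in the given inclusions).
   Context: A non-commutative graph is an operator subsystem of $M_d$ for some $d\in\mathbb{N}$, i.e. a selfadjoint linear subspace containing the identity. $\mathcal{S}\subseteq M_d$ acts reducibly if there is a non-trivial subspace $L\subseteq\mathbb{C}^d$ that is reducing for $\mathcal{S}$ and such that the restriction map $s\mapsto s|_L$ on $\mathcal{S}$ is completely isometric; it acts irreducibly if there is no such non-trivial $L$ (non-trivial: different from $\{0\}$ and $\mathbb{C}^d$). $[\,\cdot\,]$ is norm-closed linear span. A TRO is a linear subspace $\mathcal{M}\subseteq\mathcal{B}(H,K)$ with $\mathcal{M}\mathcal{M}^*\mathcal{M}\subseteq\mathcal{M}$; it is non-degenerate if $I_H\in[\mathcal{M}^*\mathcal{M}]$ and $I_K\in[\mathcal{M}\mathcal{M}^*]$. Concrete operator systems $\mathcal{S}\subseteq\mathcal{B}(H)$, $\mathcal{T}\subseteq\mathcal{B}(K)$ are TRO-equivalent if there is a non-degenerate TRO $\mathcal{M}\subseteq\mathcal{B}(H,K)$ with $\mathcal{M}^*\mathcal{T}\mathcal{M}\subseteq\overline{\mathcal{S}}$ and $\mathcal{M}\mathcal{S}\mathcal{M}^*\subseteq\overline{\mathcal{T}}$. Operator systems $\mathcal{S},\mathcal{T}$ are $\Delta$-equivalent if there are Hilbert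 spaces $H,K$ (possibly infinite dimensional) and unital complete order embeddings $\phi:\mathcal{S}\to\mathcal{B}(H)$, $\psi:\mathcal{T}\to\mathcal{B}(K)$ with $\phi(\mathcal{S})$ and $\psi(\mathcal{T})$ TRO-equivalent. *)

(* Defs.v *)
From HB Require Import structures.
From mathcomp Require Import all_boot all_order all_algebra.
From mathcomp Require Import all_classical all_reals all_analysis.
From mathcomp Require Import complex.

Set Implicit Arguments.
Unset Strict Implicit.
Unset Printing Implicit Defensive.

Import Order.TTheory GRing.Theory Num.Def Num.Theory.
Import numFieldNormedType.Exports.

Local Open Scope classical_set_scope.
Local Open Scope ring_scope.
Local Open Scope sesquilinear_scope.

(** Complex Hilbert spaces; [inner] is linear in its first argument and
    conjugate-linear in the second. *)

HB.mixin Record CompleteNormedModule_isHilbert (R : realType) H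
    of CompleteNormedModule R[i] H := {
  inner : {dot H for (@conjC R[i])} ;
  inner_normE : forall x : H, inner x x = `|x| ^+ 2
}.

#[short(type="hilbertType")]
HB.structure Definition Hilbert (R : realType) :=
  {H of CompleteNormedModule R[i] H & CompleteNormedModule_isHilbert R H}.

(** [euclid R d] is the Hilbert space C^d. A type alias is needed because
    ['cV[R[i]]_d] already carries the sup norm. *)

Section EuclideanSpace.
Variables (R : realType) (d : nat).

Definition euclid : Type := 'cV[R[i]]_d.

HB.instance Definition _ := GRing.Lmodule.copy euclid 'cV[R[i]]_d.
HB.instance Definition _ := Vector.copy euclid 'cV[R[i]]_d.

Definition cdot (x y : euclid) : R[i] :=
  \sum_(i < d) (x : 'cV_d) i 0 * ((y : 'cV_d) i 0)^*.

Let cdot_bilinear : bilinear_for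
  (GRing.Scale.Law.clone _ _ *%R _) (GRing.Scale.Law.clone _ _ (conjC \; *%R) _)
  cdot.
Proof.
split => [y a u v|x a u v] /=.
  rewrite /cdot mulr_sumr -big_split; apply: eq_bigr => i _ /=.
  by rewrite !mxE mulrDl mulrA.
rewrite /cdot mulr_sumr -big_split; apply: eq_bigr => i _ /=.
by rewrite !mxE rmorphD rmorphM mulrDr mulrCA.
Qed.

HB.instance Definition _ := bilinear_isBilinear.Build _ _ _ _ _ _ cdot cdot_bilinear.

Let cdot_hermitian (x y : euclid) :
  cdot x y = (-1) ^+ false * conjC (cdot y x).
Proof.
rewrite expr0 mul1r /cdot rmorph_sum; apply: eq_bigr => i _ /=.
by rewrite rmorphM /= conjCK mulrC.
Qed.

HB.instance Definition _ := @isHermitianSesquilinear.Build _ _ _ _ cdot cdot_hermitian.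

Let cdot_gt0 (x : euclid) : x != 0 -> 0 < cdot x x.
Proof.
move=> x0; rewrite lt_neqAle; apply/andP; split; last first.
  by apply: sumr_ge0 => i _; exact: mul_conjC_ge0.
apply: contra x0 => /eqP/esym/eqP; rewrite psumr_eq0; last first.
  by move=> i _; exact: mul_conjC_ge0.
move=> /allP x0; apply/eqP/matrixP => i j; rewrite ord1 mxE.
by have /eqP := x0 i (mem_index_enum i); rewrite /= => /eqP; rewrite mul_conjC_eq0 => /eqP.
Qed.

HB.instance Definition _ := isDotProduct.Build _ _ cdot cdot_gt0.

Definition l2norm (x : euclid) : R[i] := sqrtC (cdot x x).

Let l2normD x y : l2norm (x + y) <= l2norm x + l2norm y.
Proof. by rewrite /l2norm; have [] := triangle_lerif cdot x y. Qed.

Let l2normZ (a : R[i]) x : l2norm (a *: x) = `|a| * l2norm x.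
Proof.
rewrite /l2norm dnormZ sqrtCM ?nnegrE ?exprn_ge0 ?dnorm_ge0//.
by rewrite sqrCK.
Qed.

Let l2norm_eq0 x : l2norm x = 0 -> x = 0.
Proof. by move/eqP; rewrite sqrtC_eq0 dnorm_eq0 => /eqP. Qed.

HB.instance Definition _ := Lmodule_isNormed.Build R[i] euclid
  l2normD l2normZ l2norm_eq0.

Let norm_coord_le (x : euclid) i : `|(x : 'cV_d) i 0| <= `|x|.
Proof.
rewrite -ler_sqr ?nnegrE// [`|x|]/(l2norm x) sqrtCK /cdot (bigD1 i)//= -normCK.
by rewrite lerDl sumr_ge0// => j _; rewrite -normCK exprn_ge0.
Qed.

Let norm_le_sum (x : euclid) : `|x| <= \sum_i `|(x : 'cV_d) i 0|.
Proof.
rewrite -ler_sqr ?nnegrE ?sumr_ge0// [`|x|]/(l2norm x) sqrtCK /cdot.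
apply: (@proj2 (0 <= \sum_i `|(x : 'cV_d) i 0|)).
elim/big_ind2: _ => [|a u b v [u0 au] [v0 bv]|i _]; last 2 first.
- rewrite addr_ge0//; split => //.
  rewrite (le_trans (lerD au bv))// sqrrD [leRHS]addrAC.
  by rewrite lerDl mulrn_wge0// mulr_ge0.
- by rewrite -normCK.
- by rewrite expr0n.
Qed.

Let norm_le_ReIm (z : R[i]) :
  `|z| <= (`|complex.Re z|%:C + `|complex.Im z|%:C)%C.
Proof.
rewrite [z in leLHS]complex.complexE (le_trans (ler_normD _ _))// lerD//.
  by rewrite normc_def/= expr0n addr0 sqrtr_sqr.
by rewrite normrM !normc_def/= !expr0n/= add0r expr1n sqrtr1 mul1r addr0 sqrtr_sqr.
Qed.

Let Im_le_norm (z : R[i]) : (`|complex.Im z|%:C)%C <= `|z|.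
Proof.
by rewrite normc_def lecR -sqrtr_sqr ler_wsqrtr// lerDr sqr_ge0.
Qed.

Let euclid_complete (F : set_system euclid) :
  ProperFilter F -> cauchy F -> cvg F.
Proof.
move=> FF /cauchyP Fc.
have coord_cvg (f : euclid -> R) :
    (forall x y, (`|f x - f y|%:C)%C <= `|x - y|) -> cvg (f @ F).
  move=> fle; apply: cauchy_cvg; apply/cauchyP => e e0.
  have eC0 : 0 < (e%:C)%C :> R[i] by rewrite (ltcR 0).
  have [x Fx] := Fc _ eC0; exists (f x).
  rewrite /= /nbhs/=; apply: (@filterS _ F _ _ _ _ Fx) => y.
  rewrite -!ball_normE/= => xy.
  by have := le_lt_trans (fle x y) xy; rewrite ltcR.
pose re i (x : euclid) := complex.Re ((x : 'cV_d) i 0).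
pose im i (x : euclid) := complex.Im ((x : 'cV_d) i 0).
have re_cvg i : cvg (re i @ F).
  apply: coord_cvg => x y; apply: le_trans (norm_coord_le _ i).
  have -> : re i x - re i y = complex.Re ((x - y : 'cV_d) i 0).
    by rewrite /re !mxE; case: (x i 0) (y i 0) => [? ?] [? ?].
  exact: normc_ge_Re.
have im_cvg i : cvg (im i @ F).
  apply: coord_cvg => x y; apply: le_trans (norm_coord_le _ i).
  have -> : im i x - im i y = complex.Im ((x - y : 'cV_d) i 0).
    by rewrite /im !mxE; case: (x i 0) (y i 0) => [? ?] [? ?].
  exact: Im_le_norm.
apply/cvg_ex.
exists (\col_i (lim (re i @ F) +i* lim (im i @ F))%C : 'cV[R[i]]_d).
apply/cvgrPdist_lt => e e0.
have eE : e = ((complex.Re e)%:C)%C by rewrite RRe_real// gtr0_real.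
have e'0 : 0 < complex.Re e by move: e0; rewrite eE (ltcR 0).
pose k : R := complex.Re e / (d.*2.+1)%:R.
have k0 : 0 < k by rewrite divr_gt0.
near=> x.
have kx : forall i, `|lim (re i @ F) - re i x| < k /\
                    `|lim (im i @ F) - im i x| < k.
  near: x; apply: filter_forall => i; near=> x; split; near: x.
  - by have /cvgrPdist_lt/(_ _ k0) := re_cvg i.
  - by have /cvgrPdist_lt/(_ _ k0) := im_cvg i.
apply: le_lt_trans (norm_le_sum _) _.
apply: (@le_lt_trans _ _ (\sum_(i < d) (k%:C + k%:C))%C).
  apply: ler_sum => i _; apply: le_trans (norm_le_ReIm _) _.
  have [/ltW k1 /ltW k2] := kx i; rewrite !mxE.
  by apply: lerD; rewrite lecR; move: k1 k2; rewrite /re /im; case: (x i 0).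
rewrite eE -raddfD -rmorph_sum ltcR sumr_const card_ord -mulr2n -mulrnA mul2n.
by rewrite -mulr_natr /k mulrAC ltr_pdivrMr// ltr_pM2l// ltr_nat.
Unshelve. all: by end_near. Qed.

HB.instance Definition _ := Uniform_isComplete.Build euclid euclid_complete.

Let cdot_normE (x : euclid) : cdot x x = `|x| ^+ 2.
Proof. by rewrite [`|x|]/(l2norm x) sqrtCK. Qed.

HB.instance Definition _ :=
  CompleteNormedModule_isHilbert.Build R euclid cdot_normE.

End EuclideanSpace.

(** Bounded operators are plain functions satisfying [bounded_op]; [H -> K]
    carries its pointwise module structure. *)

Section Operators.
Variable R : realType.
Implicit Types H K L : hilbertType R.

Definition hnorm H (x : H) : R := complex.Re `|x|.

Definition bounded_op H K (f : H -> K) : Prop := linear f /\ continuous f.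

(* [sup] is only meaningful here for bounded [f]. *)
Definition opnorm H K (f : H -> K) : R :=
  sup [set hnorm (f x) | x in [set x | hnorm x <= 1]].

Definition is_adjoint H K (f : H -> K) (g : K -> H) : Prop :=
  forall x y, inner (f x) y = inner x (g y).

Definition adj_set H K (M : set (H -> K)) : set (K -> H) :=
  [set g | bounded_op g /\ exists2 f, M f & is_adjoint f g].

Definition mul_set H K L (A : set (K -> L)) (B : set (H -> K)) : set (H -> L) :=
  [set f \o g | f in A & g in B].

Definition norm_closure H K (A : set (H -> K)) : set (H -> K) :=
  [set f | bounded_op f /\
     forall e : R, 0 < e -> exists2 g, A g & opnorm (f \- g) < e].

Definition lin_span (V : lmodType R[i]) (A : set V) : set V :=
  [set v | exists n (a : 'I_n -> R[i]) (w : 'I_n -> V),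
     (forall i, A (w i)) /\ v = \sum_(i < n) a i *: w i].

Definition closed_span H K (A : set (H -> K)) : set (H -> K) :=
  norm_closure (lin_span A).

Definition TRO H K (M : set (H -> K)) : Prop :=
  [/\ M `<=` bounded_op (K := K), submod_closed [in M] &
      mul_set (mul_set M (adj_set M)) M `<=` M].

Definition nondegenerate_TRO H K (M : set (H -> K)) : Prop :=
  [/\ TRO M, closed_span (mul_set (adj_set M) M) idfun &
      closed_span (mul_set M (adj_set M)) idfun].

Definition TRO_equivalent H K (S : set (H -> H)) (T : set (K -> K)) : Prop :=
  exists M : set (H -> K),
    [/\ nondegenerate_TRO M,
        mul_set (mul_set (adj_set M) T) M `<=` norm_closure S &
        mul_set (mul_set M S) (adj_set M) `<=` norm_closure T].

(** An element of M_n(B(H)) is a matrix of operators, acting on H^n. *)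

Definition mx_act H K n (F : 'M[H -> K]_n) (x : 'I_n -> H) (i : 'I_n) : K :=
  \sum_j F i j (x j).

Definition mx_positive H n (F : 'M[H -> H]_n) : Prop :=
  forall x : 'I_n -> H, 0 <= \sum_i inner (mx_act F x i) (x i).

Definition hnorm_tuple H n (x : 'I_n -> H) : R :=
  Num.sqrt (\sum_i hnorm (x i) ^+ 2).

(* The norm of the restriction of [F] to E^n, for a subspace E of H. *)
Definition mx_opnorm_on H K (E : set H) n (F : 'M[H -> K]_n) : R :=
  sup [set hnorm_tuple (mx_act F x) |
       x in [set x : 'I_n -> H | (forall i, E (x i)) /\ hnorm_tuple x <= 1]].

(* Only the values of [phi] on S matter. On an operator system S, which is
   spanned by its positive elements, the equivalence makes [phi] injective and
   adjoint-preserving, with completely positive inverse on [phi @` S]. *)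
Definition unital_complete_order_embedding H K
    (S : set (H -> H)) (phi : (H -> H) -> (K -> K)) : Prop :=
  [/\ forall s, S s -> bounded_op (phi s),
      forall (a : R[i]) s t, S s -> S t ->
        phi (a *: s + t) = a *: phi s + phi t,
      phi idfun = idfun &
      forall n (F : 'M[H -> H]_n), (forall i j, S (F i j)) ->
        mx_positive F <-> mx_positive (map_mx phi F)].

Definition Delta_equivalent H0 K0 (S : set (H0 -> H0)) (T : set (K0 -> K0)) :
    Prop :=
  exists (H K : hilbertType R)
         (phi : (H0 -> H0) -> (H -> H)) (psi : (K0 -> K0) -> (K -> K)),
    [/\ unital_complete_order_embedding S phi,
        unital_complete_order_embedding T psi &
        TRO_equivalent (phi @` S) (psi @` T)].

End Operators.

(** Non-commutative graphs; M_d is identified with B(C^d) through [mxop]. *)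

Section NCGraphs.
Variables (R : realType) (d : nat).
Implicit Types (S : {vspace 'M[R[i]]_d}) (L : {vspace euclid R d}).

Definition mxop (A : 'M[R[i]]_d) : euclid R d -> euclid R d :=
  fun x => A *m (x : 'cV_d).

Definition ops S : set (euclid R d -> euclid R d) := mxop @` [set` S].

Definition nc_graph S : Prop :=
  1%:M \in S /\ forall s, s \in S -> s ^t* \in S.

Definition orthocompl L : set (euclid R d) :=
  [set y | forall x, x \in L -> inner x y = 0].

Definition reducing S L : Prop := forall s, s \in S ->
  (forall x, x \in L -> mxop s x \in L) /\
  (forall x, orthocompl L x -> orthocompl L (mxop s x)).

Definition restriction_completely_isometric S L : Prop :=
  forall n (F : 'M['M[R[i]]_d]_n), (forall i j, F i j \in S) ->
    mx_opnorm_on [set` L] (map_mx mxop F) = mx_opnorm_on setT (map_mx mxop F).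

Definition acts_reducibly S : Prop :=
  exists L, [/\ L != 0%VS, L != fullv, reducing S L &
                restriction_completely_isometric S L].

Definition acts_irreducibly S : Prop := ~ acts_reducibly S.

End NCGraphs.

(* Main.v *)
Require Import Defs.
From HB Require Import structures.
From mathcomp Require Import all_boot all_order all_algebra.
From mathcomp Require Import all_classical all_reals all_analysis.
From mathcomp Require Import complex.
From mathcomp Require Import zify ring lra.

(** Let M be a TRO implementing the equivalence of phi(S) and psi(T). Since
    M^* psi(T) M = phi(S) is finite dimensional, so is M, and
    1 = sum_j m'_j^* n'_j = sum_j m_j n_j^* for finite families in M. The pairings
    A and B defined by phi(A(u,t,v)) = u^* psi(t) v and psi(B(u,s,v)) = u phi(s) v^*
    are completely positive, and a finite-dimensional Arveson extension gives
    A(u,t,v) = sum_i mu_i(u)^* t mu_i(v) and B(u,s,v) = sum_l nu_l(u) s nu_l(v)^*.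
    Composing A with B expresses the identity of S as a sum of the form
    sum_k B_k^* s B_k.
    Such a sum can fix S only if every B_k commutes with S: the support of its
    mean ergodic projection reduces S without loss of norm, so it is 1 by
    irreducibility, and the projection is faithful. Hence the mu_i intertwine the
    two pairings. Irreducibility of T makes projections in its commutant central,
    so mu_i's can be combined into a single intertwiner xi of full support. This xi
    represents M as a TRO of matrices, which implements a TRO-equivalence of S
    and T. *)

Set Implicit Arguments.
Unset Strict Implicit.
Unset Printing Implicit Defensive.

Import Order.TTheory GRing.Theory Num.Def Num.Theory.
Import numFieldNormedType.Exports.

Local Open Scope classical_set_scope.
Local Open Scope ring_scope.
Local Open Scope sesquilinear_scope.

(** * Matrices and positivity *)

(** The obstacle is that $\phi$ and $\psi$ respect order only: a product of elements of $\mathcal S$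
    need not lie in $\mathcal S$, and $\phi$ says nothing about it. What descends to matrices is
    limited to linear identities between iterated pairings, obtained by inserting the expansions of
    $1$ and using that $\phi$ and $\psi$ are injective. Multiplicativity returns through rigidity,
    since a matrix commuting with $\mathcal S$ can be moved past a factor from $\mathcal S$. This is
    also why Kraus form is wanted: the individual $\mu_i$, not only the maps they define, are the
    raw material for representing $\mathcal M$, and identities between pairings pass to them by
    comparing sums of squares. Irreducibility enters in one form, [irreducible_proj]: a projection
    $p$ commuting with the system is $1$ as soon as a single Kraus map rebuilds every $s$ from
    $psp$. A single $\mu_i$ may have too small a range, so $\xi$ is taken with support of maximal
    rank: any missing piece could be added orthogonally and would raise the rank. *)

Section ConjugateTranspose.
Variable C : numClosedFieldType.

Lemma adjmxM m n p (A : 'M[C]_(m, n)) (B : 'M[C]_(n, p)) :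
  (A *m B)^t* = B^t* *m A^t*.
Proof. by rewrite trmx_mul map_mxM. Qed.

Lemma adjmxD m n (A B : 'M[C]_(m, n)) : (A + B)^t* = A^t* + B^t*.
Proof. by rewrite linearD /= map_mxD. Qed.

Lemma adjmxN m n (A : 'M[C]_(m, n)) : (- A)^t* = - A^t*.
Proof. by rewrite linearN /= map_mxN. Qed.

Lemma adjmxB m n (A B : 'M[C]_(m, n)) : (A - B)^t* = A^t* - B^t*.
Proof. by rewrite adjmxD adjmxN. Qed.

Lemma adjmxZ m n a (A : 'M[C]_(m, n)) : (a *: A)^t* = a^* *: A^t*.
Proof. by rewrite linearZ /= map_mxZ. Qed.

Lemma adjmx_sum m n I r (P : pred I) (F : I -> 'M[C]_(m, n)) :
  (\sum_(i <- r | P i) F i)^t* = \sum_(i <- r | P i) (F i)^t*.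
Proof. by rewrite linear_sum /= map_mx_sum. Qed.

Lemma adjmx1 n : (1%:M : 'M[C]_n)^t* = 1%:M.
Proof. by rewrite trmx1 map_mx1. Qed.

Lemma adjmx0 m n : (0 : 'M[C]_(m, n))^t* = 0.
Proof. by rewrite trmx0 map_mx0. Qed.

Lemma adjmx_cartesian n (A : 'M[C]_n) :
  A = 2^-1 *: ((A + A^t*) - 'i *: ('i *: (A - A^t*))).
Proof.
apply/matrixP => i j; rewrite !mxE [X in _ - X]mulrA -expr2 sqrCi mulN1r opprK.
by rewrite addrACA subrr addr0 -mulr2n -[A i j *+ 2]mulr_natl mulKf ?pnatr_eq0.
Qed.

Lemma mx_neq0_entry m n (A : 'M[C]_(m, n)) :
  A != 0 -> exists i j, A i j != 0.
Proof.
apply: contraNP => H; apply/eqP/matrixP => i j; rewrite mxE.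
by apply: contrapT => /eqP ij; apply: H; exists i, j.
Qed.

Lemma mulmx_cV_inj m n (A B : 'M[C]_(m, n)) :
  (forall u : 'cV_n, A *m u = B *m u) -> A = B.
Proof.
move=> AB; apply/matrixP => i j; have := AB (delta_mx j 0).
by rewrite -!colE => /matrixP /(_ i 0); rewrite !mxE.
Qed.

(** Conjugate-linear in the first argument, so the order is opposite to that of [inner]. *)
Definition dotc n (u v : 'cV[C]_n) : C := (u^t* *m v) 0 0.

Lemma dotcE n (u v : 'cV[C]_n) : dotc u v = \sum_i (u i 0)^* * v i 0.
Proof. by rewrite /dotc mxE; apply: eq_bigr => i _; rewrite !mxE. Qed.

Lemma dotcDl n (u v w : 'cV[C]_n) : dotc (u + v) w = dotc u w + dotc v w.
Proof. by rewrite /dotc adjmxD mulmxDl mxE. Qed.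

Lemma dotcDr n (u v w : 'cV[C]_n) : dotc w (u + v) = dotc w u + dotc w v.
Proof. by rewrite /dotc mulmxDr mxE. Qed.

Lemma dotcZl n a (u w : 'cV[C]_n) : dotc (a *: u) w = a^* * dotc u w.
Proof. by rewrite /dotc adjmxZ -scalemxAl mxE. Qed.

Lemma dotcZr n a (u w : 'cV[C]_n) : dotc w (a *: u) = a * dotc w u.
Proof. by rewrite /dotc -scalemxAr mxE. Qed.

Lemma dotcNr n (u w : 'cV[C]_n) : dotc w (- u) = - dotc w u.
Proof. by rewrite /dotc mulmxN mxE. Qed.

Lemma dotcNl n (u w : 'cV[C]_n) : dotc (- u) w = - dotc u w.
Proof. by rewrite /dotc adjmxN mulNmx mxE. Qed.

Lemma dotcBl n (u v w : 'cV[C]_n) : dotc (u - v) w = dotc u w - dotc v w.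
Proof. by rewrite dotcDl dotcNl. Qed.

Lemma dotcBr n (u v w : 'cV[C]_n) : dotc w (u - v) = dotc w u - dotc w v.
Proof. by rewrite dotcDr dotcNr. Qed.

Lemma dotc0r n (w : 'cV[C]_n) : dotc w 0 = 0.
Proof. by rewrite /dotc mulmx0 mxE. Qed.

Lemma dotc_sumr n (w : 'cV[C]_n) I r (P : pred I) (F : I -> 'cV[C]_n) :
  dotc w (\sum_(i <- r | P i) F i) = \sum_(i <- r | P i) dotc w (F i).
Proof. by rewrite /dotc mulmx_sumr summxE. Qed.

Lemma dotcC n (u v : 'cV[C]_n) : (dotc u v)^* = dotc v u.
Proof.
rewrite !dotcE rmorph_sum; apply: eq_bigr => i _ /=.
by rewrite rmorphM /= conjCK mulrC.
Qed.

Lemma dotc_adjr m n (u : 'cV[C]_m) (A : 'M[C]_(m, n)) v :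
  dotc u (A *m v) = dotc (A^t* *m u) v.
Proof. by rewrite /dotc adjmxM trmxCK mulmxA. Qed.

Lemma dotc_proj m n (p : 'M[C]_m) (A : 'M[C]_(m, n)) (u : 'cV[C]_n) :
  p^t* = p -> p *m p = p ->
  dotc (p *m (A *m u)) (p *m (A *m u)) = dotc u (A^t* *m p *m A *m u).
Proof.
move=> ph pp; rewrite -!mulmxA [RHS]dotc_adjr trmxCK.
by rewrite -[p in RHS]pp -mulmxA [RHS]dotc_adjr ph.
Qed.

Lemma dotc_ge0 n (u : 'cV[C]_n) : 0 <= dotc u u.
Proof.
by rewrite dotcE; apply: sumr_ge0 => i _; rewrite mulrC mul_conjC_ge0.
Qed.

Lemma dotc_eq0 n (u : 'cV[C]_n) : dotc u u = 0 -> u = 0.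
Proof.
move=> /eqP; rewrite dotcE psumr_eq0 => [/allP u0|i _]; last first.
  by rewrite mulrC mul_conjC_ge0.
apply/matrixP => i j; rewrite ord1 mxE.
have /eqP := u0 i (mem_index_enum i).
by rewrite /= => /eqP; rewrite mulrC mul_conjC_eq0 => /eqP.
Qed.

Lemma dotc_delta n (i j : 'I_n) (X : 'M[C]_n) :
  dotc (delta_mx i 0) (X *m delta_mx j 0) = X i j.
Proof.
rewrite -colE dotcE (bigD1 i) //= big1 => [|k /negPf ki]; rewrite !mxE.
  by rewrite !eqxx conjC1 mul1r addr0.
by rewrite ki conjC0 mul0r.
Qed.

Lemma gram_eq0 m n (X : 'M[C]_(m, n)) : X^t* *m X = 0 -> X = 0.
Proof.
move=> X0; apply: mulmx_cV_inj => u; rewrite mul0mx; apply: dotc_eq0.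
by rewrite dotc_adjr mulmxA X0 mul0mx /dotc adjmx0 mul0mx mxE.
Qed.

(** Polarisation: the values at $u+v$ and $u+iv$ determine the mixed terms. *)
Lemma form_eq0 n (X : 'M[C]_n) : (forall u, dotc u (X *m u) = 0) -> X = 0.
Proof.
move=> X0; apply/matrixP => i j; rewrite mxE -dotc_delta.
move: (delta_mx i 0) (delta_mx j 0) => u v.
have := X0 (u + v); rewrite mulmxDr !dotcDl !dotcDr !X0 add0r addr0 => h1.
have := X0 (u + 'i *: v).
rewrite mulmxDr -scalemxAr !dotcDl !dotcDr !dotcZl !dotcZr !X0 conjCi.
rewrite !mulr0 add0r addr0 mulNr -mulrBr => /eqP.
rewrite mulf_eq0 (negPf (neq0Ci _)) /= subr_eq0 => /eqP h2.
move: h1; rewrite -h2 -mulr2n => /eqP.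
by rewrite mulrn_eq0 /= => /eqP.
Qed.

(** Nonnegativity in a complex field includes reality, from which Hermitian symmetry follows by
    polarisation. *)
Record psd n (X : 'M[C]_n) : Prop :=
  Psd { psd_ge0 :> forall u, 0 <= dotc u (X *m u) }.

Lemma psd_herm n (X : 'M[C]_n) : psd X -> X^t* = X.
Proof.
move=> X0; apply/eqP; rewrite -subr_eq0; apply/eqP/form_eq0 => u.
rewrite mulmxBl dotcBr dotc_adjr trmxCK -dotcC.
by have /ger0_real/CrealP -> := X0 u; rewrite subrr.
Qed.

Lemma psdD n (X Y : 'M[C]_n) : psd X -> psd Y -> psd (X + Y).
Proof. by move=> [X0] [Y0]; split=> u; rewrite mulmxDl dotcDr addr_ge0. Qed.

Lemma psdZ n a (X : 'M[C]_n) : 0 <= a -> psd X -> psd (a *: X).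
Proof. by move=> a0 [X0]; split=> u; rewrite -scalemxAl dotcZr mulr_ge0. Qed.

Lemma psd_sum n I r (P : pred I) (F : I -> 'M[C]_n) :
  (forall i, P i -> psd (F i)) -> psd (\sum_(i <- r | P i) F i).
Proof.
by move=> F0; split=> u; rewrite mulmx_suml dotc_sumr sumr_ge0 // => i /F0 [].
Qed.

Lemma psd_gram m n (A : 'M[C]_(m, n)) : psd (A^t* *m A).
Proof. by split=> u; rewrite -mulmxA dotc_adjr trmxCK dotc_ge0. Qed.

Lemma psd_conj m n (A : 'M[C]_(m, n)) X : psd X -> psd (A^t* *m X *m A).
Proof. by case=> X0; split=> u; rewrite -!mulmxA dotc_adjr trmxCK. Qed.

Lemma psd1 n : psd (1%:M : 'M[C]_n).
Proof. by split=> u; rewrite mul1mx dotc_ge0. Qed.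

Lemma norm_dotc_le n (u v : 'cV[C]_n) i j :
  `|(u i 0)^* * v j 0| <= dotc u u + dotc v v.
Proof.
have le1 (w : 'cV[C]_n) k : `|w k 0| ^+ 2 <= dotc w w.
  rewrite dotcE (bigD1 k) //= normCK mulrC lerDl sumr_ge0 // => l _.
  by rewrite mulrC mul_conjC_ge0.
rewrite normrM norm_conjC; apply: le_trans (lerD (le1 u i) (le1 v j)).
have : 0 <= (`|u i 0| - `|v j 0|) ^+ 2.
  by rewrite real_exprn_even_ge0 // realB.
rewrite sqrrB addrAC subr_ge0; apply: le_trans.
by rewrite mulr2n lerDl mulr_ge0.
Qed.

(** The bound is a sum of squared norms rather than a product of norms: operators with $\sum_k
    B_k^*B_k=1$ preserve such sums, so iterating a Kraus map keeps the same constant. *)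
Lemma form_bounded n (X : 'M[C]_n) : exists2 k, 0 <= k &
  forall u v, `|dotc u (X *m v)| <= k * (dotc u u + dotc v v).
Proof.
exists (\sum_i \sum_j `|X i j|); first by do 2!apply: sumr_ge0 => ? _.
move=> u v; rewrite dotcE mulr_suml; apply: le_trans (ler_norm_sum _ _ _) _.
apply: ler_sum => i _; rewrite mxE mulr_sumr mulr_suml.
apply: le_trans (ler_norm_sum _ _ _) _; apply: ler_sum => j _.
by rewrite mulrCA normrM ler_wpM2l // norm_dotc_le.
Qed.

(** The identity is an order unit; the constant doubles because [form_bounded] is used at $u=v$. *)
Lemma herm_le_scalar n (X : 'M[C]_n) : X^t* = X ->
  exists2 k, 0 <= k & psd (k%:M - X) /\ psd (k%:M + X).
Proof.
move=> Xh; have [k k0 kP] := form_bounded X.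
exists (k *+ 2); first by rewrite mulrn_wge0.
have Xr u : dotc u (X *m u) \is Num.real.
  by apply/CrealP; rewrite dotcC dotc_adjr Xh.
have {}kP u : `|dotc u (X *m u)| <= k *+ 2 * dotc u u.
  by rewrite (le_trans (kP u u)) // -mulr2n mulrnAr mulrnAl.
by split; split=> u; have := kP u; rewrite real_ler_norml // => /andP[h1 h2];
  rewrite ?mulmxBl ?mulmxDl mul_scalar_mx ?dotcBr ?dotcDr dotcZr
    ?subr_ge0 // addrC -lerBlDr sub0r.
Qed.

Lemma spectral_decomp n (A : 'M[C]_n) : A^t* = A ->
  exists P (D : 'rV[C]_n), P *m P^t* = 1%:M /\ P^t* *m P = 1%:M /\
    A = P^t* *m diag_mx D *m P.
Proof.
move=> Ah; have /orthomx_spectralP An : A \is normalmx.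
  by apply/normalmxP; rewrite Ah.
exists (spectralmx A), (spectral_diag A).
have U := spectral_unitarymx A; rewrite -invmx_unitary //.
by rewrite mulmxV ?mulVmx ?unitarymx_unit.
Qed.

Lemma diag_mx_sum n (D : 'rV[C]_n) (P : 'M[C]_n) :
  P^t* *m diag_mx D *m P = \sum_i D 0 i *: (row i P)^t* *m row i P.
Proof.
apply/matrixP => i j; rewrite summxE !mxE; apply: eq_bigr => k _.
by rewrite mul_mx_diag !mxE big_ord1 !mxE [conjC _ * _]mulrC.
Qed.

Lemma spectral_psd_ge0 n (P : 'M[C]_n) (D : 'rV[C]_n) i :
  P *m P^t* = 1%:M -> psd (P^t* *m diag_mx D *m P) -> 0 <= D 0 i.
Proof.
move=> P1 A0; have := A0 ((row i P)^t*).
rewrite -!mulmxA dotc_adjr trmxCK.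
have -> : P *m (row i P)^t* = delta_mx i 0.
  apply/matrixP => j k; rewrite ord1.
  have /matrixP /(_ j i) := P1; rewrite !mxE eqxx andbT => <-.
  by apply: eq_bigr => l _; rewrite !mxE.
by rewrite dotc_delta mxE eqxx mulr1n.
Qed.

Lemma psd_factor n (A : 'M[C]_n) : psd A ->
  exists g : 'I_n -> 'cV[C]_n, A = \sum_i g i *m (g i)^t*.
Proof.
move=> A0; have [P [D [P1 [P2 AE]]]] := spectral_decomp (psd_herm A0).
have Dge i : 0 <= D 0 i by rewrite (spectral_psd_ge0 _ P1) // -AE.
exists (fun i => sqrtC (D 0 i) *: (row i P)^t*).
rewrite AE diag_mx_sum; apply: eq_bigr => i _.
rewrite adjmxZ trmxCK -!scalemxAl -scalemxAr scalerA.
by rewrite conj_Creal ?ger0_real ?sqrtC_ge0 // -expr2 sqrtCK.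
Qed.

End ConjugateTranspose.

(** * Extension of positive functionals *)

Section Extension.
Variable R : realType.
Local Notation C := R[i].

Definition adj_closed n (E : {vspace 'M[C]_n}) := forall x, x \in E -> x^t* \in E.

Definition pos_on n (E : {vspace 'M[C]_n}) (f : 'Hom('M[C]_n, C^o)) :=
  forall x, x \in E -> psd x -> 0 <= f x.

(** By the Cartesian decomposition, a subspace containing all Hermitian matrices is everything.
    Functionals are extended along Hermitian directions. *)
Lemma adj_closedN_herm n (E : {vspace 'M[C]_n}) :
  adj_closed E -> E != fullv -> exists2 v, v^t* = v & v \notin E.
Proof.
move=> Ea Ef; apply: contrapT => H.
have {}H v : v^t* = v -> v \in E.
  by move=> vh; apply: contrapT => /negP vE; apply: H; exists v.
move/negP: Ef; apply; apply/eqP/vspaceP => x; rewrite memvf.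
rewrite (adjmx_cartesian (x : 'M[C]_n)); apply: memvZ; apply: memvB; last apply: memvZ.
  by apply: H; rewrite adjmxD trmxCK addrC.
by apply: H; rewrite adjmxZ adjmxB trmxCK conjCi scaleNr -scalerN opprB.
Qed.

Lemma complex_real_sup (z : C) : z \is Num.real -> z = ((complex.Re z)%:C)%C.
Proof. by move=> zr; rewrite RRe_real. Qed.

Lemma pos_on_real n (E : {vspace 'M[C]_n}) f x :
  1%:M \in E -> pos_on E f -> x \in E -> x^t* = x -> f x \is Num.real.
Proof.
move=> E1 f0 xE xh; have [k k0 [_ h]] := herm_le_scalar xh.
have kE : k%:M \in E by rewrite -scalemx1 memvZ.
have -> : f x = f (k%:M + x) - f k%:M by rewrite linearD /= addrC addKr.
rewrite realB // ger0_real //; apply: f0 => //; first exact: memvD.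
by rewrite -scalemx1; apply/psdZ/psd1.
Qed.

(* One-dimensional step of M. Riesz's extension of positive functionals. *)
Lemma pos_on_step n (E : {vspace 'M[C]_n}) f v :
  1%:M \in E -> adj_closed E -> pos_on E f -> v^t* = v -> v \notin E ->
  exists f' : 'Hom('M[C]_n, C^o), {in E, f' =1 f} /\ pos_on (E + <[v]>)%VS f'.
Proof.
move=> E1 Ea f0 vh vE.
(* The extension takes the value [sup L] at [v]: at least $f(e)$ for every $e\le v$ in [E], and at
   most $f(e')$ for every $e'\ge v$ in [E] by [Lub]. *)
pose L : set R := [set complex.Re (f e) | e in [set e | e \in E /\ psd (v - e)]]%classic.
have psd_sub_herm e : psd (v - e) -> e^t* = e.
  move/psd_herm; rewrite adjmxB vh => /addrI/oppr_inj //.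
have Lub e' : e' \in E -> psd (e' - v) -> ubound L (complex.Re (f e')).
  move=> e'E e'v r [e [eE ev] <-].
  have : 0 <= f (e' - e).
    apply: f0; first exact: memvB.
    by rewrite -[e'](subrK v) -addrA; exact: psdD.
  by rewrite linearB /= subr_ge0 lecE => /andP[].
have [k k0 [kv vk]] := herm_le_scalar vh.
have kE : k%:M \in E by rewrite -scalemx1 memvZ.
have Lsup : has_sup L.
  split; last by exists (complex.Re (f k%:M)); exact: Lub.
  exists (complex.Re (f (- k%:M))); exists (- k%:M) => //; split.
    by rewrite memvN.
  by rewrite opprK addrC.
pose c : C := (sup L)%:C%C.
(* [q] vanishes on [E] but not at [v], so a nonzero entry of [q v] gives a functional vanishing on
   [E]; it is scaled so that the corrected map sends [v] to [c]. *)
pose q (x : 'M[C]_n) := x - projv E x.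
have qP a (x y : 'M[C]_n) : q (a *: x + y) = a *: q x + q y.
  by rewrite /q linearP opprD addrACA scalerBr.
have qE x : x \in E -> q x = 0 by move=> xE; rewrite /q projv_id // subrr.
have qv : q v != 0.
  apply: contra vE; rewrite subr_eq0 => /eqP ->; exact: memv_proj.
have [i [j qij]] := mx_neq0_entry qv.
have lP : linear (fun x => q x i j * ((c - f v) / q v i j) : C^o).
  by move=> a x y; rewrite qP !mxE mulrDl -mulrA.
pose l : {linear 'M[C]_n -> C^o} :=
  HB.pack (fun x => q x i j * ((c - f v) / q v i j) : C^o)
    (GRing.isLinear.Build _ _ _ _ _ lP).
exists (f + linfun l); split=> [x xE|x].
  by rewrite add_lfunE lfunE /= (qE _ xE) mxE mul0r addr0.
move=> /memv_addP[e eE [_ /vlineP[a ->] ->]] xpsd.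
have f'x : (f + linfun l) (e + a *: v) = f e + a * c.
  rewrite add_lfunE lfunE /= linearD linearZ /= {1}/q.
  have -> : e + a *: v - projv E (e + a *: v) = a *: q v.
    by rewrite -/(q _) [e + _]addrC qP (qE _ eE) addr0.
  rewrite mxE mulrACA mulfV // mulr1 /GRing.scale /= -addrA -mulrDr.
  by rewrite [f v + _]addrC subrK.
rewrite f'x.
(* Since [x] is Hermitian, $(\bar a-a)v=e-e^*$ lies in [E], whereas [v] does not. *)
have ar : a \is Num.real.
  apply/CrealP/eqP; rewrite -subr_eq0; apply: contraNT vE => ne0.
  have : (a^* - a) *: v \in E.
    rewrite scalerBl.
    have -> : a^* *: v - a *: v = e - e^t*.
      have := psd_herm xpsd; rewrite adjmxD adjmxZ vh => H.
      by rewrite -[a^* *: v](addKr (e^t*)) H addrA addrK addrC.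
    by rewrite memvB ?Ea.
  by rewrite rpredZeq (negPf ne0).
have eh : e^t* = e.
  have := psd_herm xpsd; rewrite adjmxD adjmxZ vh (CrealP ar).
  exact: addIr.
have er := pos_on_real E1 f0 eE eh.
have fZ b (y : 'M[C]_n) : f (b *: y) = b * f y by rewrite linearZ.
(* Positivity of $e+av$ says that $-e/a$ lies below $v$ if $a>0$ and above it if $a<0$. *)
case: (real_ltgt0P ar) => [a0|a0|a0].
- have a0' : a^-1 \is Num.real by rewrite realV.
  have : L (complex.Re (f (- a^-1 *: e))).
    exists (- a^-1 *: e) => //; split; first exact: memvZ.
    rewrite scaleNr opprK addrC.
    have -> : a^-1 *: e + v = a^-1 *: (e + a *: v).
      by rewrite scalerDr scalerA mulVf ?scale1r // gt_eqF.
    by apply: psdZ => //; rewrite invr_ge0 ltW.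
  move=> /(ub_le_sup (proj2 Lsup)); rewrite -lecR -complex_real_sup; last first.
    by rewrite fZ realM // realN.
  rewrite fZ -/c mulNr -subr_ge0 opprK => h.
  by rewrite -(pmulr_rge0 _ (_ : 0 < a^-1)) ?invr_gt0 // mulrDr mulrA mulVf ?mul1r 1?addrC // gt_eqF.
- have : ubound L (complex.Re (f ((- a)^-1 *: e))).
    apply: Lub; first exact: memvZ.
    have -> : (- a)^-1 *: e - v = (- a)^-1 *: (e + a *: v).
      by rewrite scalerDr scalerA invrN mulNr mulVf ?lt_eqF // scaleN1r.
    by apply: psdZ => //; rewrite invr_ge0 oppr_ge0 ltW.
  move=> /(ge_sup (proj1 Lsup)); rewrite -lecR -complex_real_sup; last first.
    by rewrite fZ realM // realV realN.
  rewrite fZ -/c -subr_ge0 => h.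
  have na0 : 0 < - a by rewrite oppr_gt0.
  rewrite -(pmulr_rge0 _ (_ : 0 < (- a)^-1)) ?invr_gt0 // mulrDr mulrA.
  have -> : (- a)^-1 * a = -1 by rewrite invrN mulNr mulVf ?lt_eqF.
  by rewrite mulN1r.
- by rewrite a0 mul0r addr0; apply: f0 => //; move: xpsd; rewrite a0 scale0r addr0.
Qed.

Lemma vspace_full_dim (V : vectType C) (U : {vspace V}) :
  (\dim {:V} <= \dim U)%N -> U = fullv.
Proof. by move=> h; apply/eqP; rewrite eqEdim subvf. Qed.

Lemma pos_on_extend n (E : {vspace 'M[C]_n}) f :
  1%:M \in E -> adj_closed E -> pos_on E f ->
  exists f' : 'Hom('M[C]_n, C^o), {in E, f' =1 f} /\ pos_on fullv f'.
Proof.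
move: {2}(\dim {:'M[C]_n} - \dim E)%N (leqnn (\dim {:'M[C]_n} - \dim E)) => k.
elim: k => [|k IH] in E f *.
  rewrite leqn0 subn_eq0 => /vspace_full_dim -> _ _ f0.
  by exists f; split.
move=> hk E1 Ea f0; have [Efull|Ef] := eqVneq E fullv.
  by exists f; split=> //; rewrite -Efull.
have [v vh vE] := adj_closedN_herm Ea Ef.
have [f1 [f1E f1pos]] := pos_on_step E1 Ea f0 vh vE.
have Esub : (E <= E + <[v]>)%VS by exact: addvSl.
have [|||f2 [f2E f2pos]] := IH (E + <[v]>)%VS f1 _ _ _ f1pos.
- have : (\dim E < \dim (E + <[v]>))%N.
    rewrite ltn_neqAle dimvS // andbT; apply: contra vE => /eqP h.
    have -> : E = (E + <[v]>)%VS by apply/eqP; rewrite eqEdim Esub h leqnn.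
    by rewrite (subvP (addvSr _ _)) // memv_line.
  have := dimvS (subvf (E + <[v]>)%VS); move: hk; lia.
- exact: (subvP Esub).
- move=> x /memv_addP[e eE [_ /vlineP[a ->] ->]].
  by rewrite adjmxD adjmxZ vh memv_add ?Ea // memvZ // memv_line.
by exists f2; split=> // x xE; rewrite f2E ?f1E // (subvP Esub).
Qed.

(** Once extended to all matrices, a positive functional is $x\mapsto\operatorname{tr}(xK)$ with $K$
    positive, and factoring $K$ splits it into vector functionals. *)
Lemma krein n (E : {vspace 'M[C]_n}) (f : 'M[C]_n -> C) :
  1%:M \in E -> adj_closed E ->
  (forall a x y, x \in E -> y \in E -> f (a *: x + y) = a * f x + f y) ->
  (forall x, x \in E -> psd x -> 0 <= f x) ->
  exists g : 'I_n -> 'cV[C]_n,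
    forall x, x \in E -> f x = \sum_i dotc (g i) (x *m g i).
Proof.
move=> E1 Ea flin fpos.
(* [f] is linear on [E] only; composition with a projection onto [E] makes it globally linear
   without changing it there. *)
have lP : linear (f \o projv E : 'M[C]_n -> C^o).
  by move=> a x y; rewrite /= linearP flin ?memv_proj.
pose F : {linear 'M[C]_n -> C^o} :=
  HB.pack (f \o projv E : 'M[C]_n -> C^o)
    (GRing.isLinear.Build _ _ _ _ _ lP).
have FE x : x \in E -> linfun F x = f x by move=> xE; rewrite lfunE /= projv_id.
have [|f' [f'E f'pos]] := @pos_on_extend n E (linfun F) E1 Ea.
  by move=> x xE x0; rewrite FE ?fpos.
pose h : 'M[C]_n -> C := f'.
have hP a x y : h (a *: x + y) = a * h x + h y by exact: (linearP f').
have hZ a x : h (a *: x) = a * h x by rewrite /h linearZ.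
have hS (I : Type) (s : seq I) (G : I -> 'M[C]_n) :
    h (\sum_(i <- s) G i) = \sum_(i <- s) h (G i).
  apply: (big_morph h) => [x y|]; last exact: (linear0 f').
  exact: (linearD f').
pose K : 'M[C]_n := \matrix_(i, j) h (delta_mx j i).
have hK x : h x = \tr (x *m K).
  rewrite {1}[x]matrix_sum_delta hS /mxtrace; apply: eq_bigr => i _.
  rewrite hS mxE; apply: eq_bigr => j _.
  by rewrite hZ !mxE.
have Kpsd : psd K.
  split=> u; suff -> : dotc u (K *m u) = h (u *m u^t*).
    apply: f'pos; first exact: memvf.
    by rewrite -{1}[u]trmxCK; exact: psd_gram.
  by rewrite hK -mulmxA mxtrace_mulC /mxtrace big_ord1 /dotc mulmxA.
have [g KE] := psd_factor Kpsd.
exists g => x xE; rewrite -FE // -f'E // -/(h x) hK KE mulmx_sumr raddf_sum /=.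
apply: eq_bigr => i _; rewrite mulmxA mxtrace_mulC /mxtrace big_ord1.
by rewrite /dotc mulmxA.
Qed.

End Extension.

(** * Completely positive maps as functionals on block matrices *)

Section Arveson.
Variable R : realType.
Local Notation C := R[i].
Variables (d : nat) (J : finType).

Local Notation n := #|{: J * 'I_d}|.

Let pos (j : J) (a : 'I_d) : 'I_n := enum_rank (j, a).

Lemma sum_pos (V : nmodType) (h : 'I_n -> V) :
  \sum_p h p = \sum_j \sum_a h (pos j a).
Proof.
rewrite (reindex enum_rank) /=; last exact/onW_bij/enum_rank_bij.
by rewrite pair_bigA; apply: eq_bigr => -[].
Qed.

Definition blk (j k : J) (K : 'M[C]_n) : 'M[C]_d := mxsub (pos j) (pos k) K.

Lemma blkE j k K a b : blk j k K a b = K (pos j a) (pos k b).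
Proof. by rewrite mxE. Qed.

Definition emb (j k : J) (x : 'M[C]_d) : 'M[C]_n := \matrix_(p, q)
  if ((enum_val p).1 == j) && ((enum_val q).1 == k)
  then x (enum_val p).2 (enum_val q).2 else 0.

Lemma blk_emb j k j' k' x :
  blk j' k' (emb j k x) = if (j' == j) && (k' == k) then x else 0.
Proof.
apply/matrixP => a b; rewrite blkE mxE /pos !enum_rankK /=.
by case: ifP => //; rewrite mxE.
Qed.

Lemma dotc_blk (U V : 'cV[C]_n) (K : 'M[C]_n) :
  dotc U (K *m V) = \sum_j \sum_k
    dotc (\col_a U (pos j a) 0) (blk j k K *m (\col_a V (pos k a) 0)).
Proof.
rewrite dotcE sum_pos; apply: eq_bigr => j _.
under [RHS]eq_bigr do rewrite dotcE.
rewrite exchange_big; apply: eq_bigr => a _ /=.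
rewrite -mulr_sumr mxE; congr (_ * _); rewrite mxE sum_pos.
by apply: eq_bigr => k _; rewrite mxE; apply: eq_bigr => b _; rewrite blkE mxE.
Qed.

(* Arveson's extension theorem, with the extension in Kraus form: such maps on
   S correspond to positive functionals on the matrix system M_J(S). *)
Lemma arveson (S : {vspace 'M[C]_d}) (g : J -> J -> 'M[C]_d -> C) :
  1%:M \in S -> adj_closed S ->
  (forall j k a x y, x \in S -> y \in S ->
     g j k (a *: x + y) = a * g j k x + g j k y) ->
  (forall F : J -> J -> 'M[C]_d, (forall j k, F j k \in S) ->
     (forall x : J -> 'cV[C]_d,
        0 <= \sum_j \sum_k dotc (x j) (F j k *m x k)) ->
     0 <= \sum_j \sum_k g j k (F j k)) ->
  exists A : 'I_n -> J -> 'cV[C]_d,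
    forall j k s, s \in S -> g j k s = \sum_l dotc (A l j) (s *m A l k).
Proof.
move=> S1 Sa glin gpos.
(* The matrix system $M_J(\mathcal S)$, cut out by the condition that all blocks lie in [S]. *)
pose E : {vspace 'M[C]_n} :=
  (\bigcap_(jk : J * J) (linfun (mxsub (pos jk.1) (pos jk.2)) @^-1: S))%VS.
have EP K : reflect (forall j k, blk j k K \in S) (K \in E).
  apply: (iffP idP) => [KE j k|KE].
    have /subv_bigcapP /(_ (j, k) isT) : (<[K]> <= E)%VS by rewrite -memvE.
    by rewrite -memvE -memv_preim lfunE.
  rewrite memvE; apply/subv_bigcapP => -[j k] _.
  by rewrite -memvE -memv_preim lfunE; exact: KE.
have g0 j k : g j k 0 = 0.
  have := glin j k (-1) 0 0 (mem0v _) (mem0v _).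
  by rewrite scaler0 addr0 mulN1r addNr.
have blk1 j k : blk j k 1%:M = if j == k then 1%:M else 0.
  apply/matrixP => a b; rewrite blkE mxE (inj_eq enum_rank_inj) xpair_eqE.
  by case: eqP; rewrite mxE.
have blka j k (K : 'M[C]_n) : blk j k (K^t*) = (blk k j K)^t*.
  by apply/matrixP => a b; rewrite blkE !mxE.
pose f (K : 'M[C]_n) := \sum_j \sum_k g j k (blk j k K).
have [||||G fG] := @krein _ _ E f.
- by apply/EP => j k; rewrite blk1; case: ifP; rewrite ?S1 ?mem0v.
- by move=> K /EP KE; apply/EP => j k; rewrite blka Sa.
- move=> a x y /EP xE /EP yE; rewrite /f mulr_sumr -big_split.
  apply: eq_bigr => j _ /=; rewrite mulr_sumr -big_split.
  by apply: eq_bigr => k _ /=; rewrite /blk linearP /= glin ?xE ?yE.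
- move=> K /EP KE K0; apply: gpos => // x.
  pose U : 'cV[C]_n := \col_p x (enum_val p).1 (enum_val p).2 0.
  have := K0 U; rewrite dotc_blk; congr (0 <= _).
  have UE j : \col_a U (pos j a) 0 = x j.
    by apply/matrixP => a b; rewrite !mxE /pos enum_rankK ord1.
  by apply: eq_bigr => j _; apply: eq_bigr => k _; rewrite !UE.
exists (fun l j => \col_a G l (pos j a) 0) => j k s sS.
have sum_emb (V : nmodType) (h : J -> J -> 'M[C]_d -> V) :
    (forall j k, h j k 0 = 0) ->
    \sum_j' \sum_k' h j' k' (blk j' k' (emb j k s)) = h j k s.
  move=> h0; rewrite (bigD1 j) //= (bigD1 k) //= blk_emb !eqxx big1 => [|i ik].
    rewrite addr0 big1 ?addr0 // => i ij; rewrite big1 // => l _.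
    by rewrite blk_emb (negPf ij) h0.
  by rewrite blk_emb (negPf ik) andbF h0.
(* A matrix with a single nonzero block isolates one component of the functional. *)
have embE : emb j k s \in E.
  by apply/EP => j' k'; rewrite blk_emb; case: ifP; rewrite ?mem0v.
have := fG _ embE; rewrite /f sum_emb // => ->; apply: eq_bigr => l _.
rewrite dotc_blk (sum_emb _ (fun j k x => dotc _ (x *m _))) // => j' k'.
by rewrite mul0mx dotc0r.
Qed.

End Arveson.

(** * Norms over tuples, compressions, and the use of irreducibility *)

Section HilbertNorm.
Variable R : realType.
Implicit Types H K : hilbertType R.

Lemma normE_hnorm H (x : H) : `|x| = ((hnorm x)%:C)%C.
Proof. by rewrite /hnorm RRe_real // ger0_real. Qed.

Lemma hnorm_ge0 H (x : H) : 0 <= hnorm x.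
Proof. by rewrite -lecR -normE_hnorm; exact: normr_ge0. Qed.

Lemma hnorm_sqr H (x : H) : ((hnorm x ^+ 2)%:C)%C = inner x x.
Proof. by rewrite inner_normE normE_hnorm rmorphXn. Qed.

Lemma hnorm0 H : hnorm (0 : H) = 0.
Proof. by rewrite /hnorm normr0. Qed.

Lemma hnormD H (x y : H) : hnorm (x + y) <= hnorm x + hnorm y.
Proof. by have := ler_normD x y; rewrite !normE_hnorm -rmorphD lecR. Qed.

Lemma hnorm_sum H I r (P : pred I) (F : I -> H) :
  hnorm (\sum_(i <- r | P i) F i) <= \sum_(i <- r | P i) hnorm (F i).
Proof.
elim/big_rec2: _ => [|i y1 y2 _ h]; first by rewrite hnorm0.
by rewrite (le_trans (hnormD _ _)) // lerD2l.
Qed.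

Lemma hnormZ H (a : R[i]) (x : H) : hnorm (a *: x) = complex.Re `|a| * hnorm x.
Proof.
have aE : `|a| = ((complex.Re `|a|)%:C)%C by rewrite RRe_real // ger0_real.
by have := normrZ a x; rewrite !normE_hnorm {1}aE -rmorphM => /complexI.
Qed.


Lemma hnorm_eq0 H (x : H) : hnorm x = 0 -> x = 0.
Proof. by move=> x0; apply/normr0_eq0; rewrite normE_hnorm x0. Qed.

Lemma hnorm_tuple_sqr H n (x : 'I_n -> H) :
  ((hnorm_tuple x ^+ 2)%:C)%C = \sum_i inner (x i) (x i).
Proof.
rewrite /hnorm_tuple sqr_sqrtr ?sumr_ge0 // => [|i _]; last exact: sqr_ge0.
by rewrite rmorph_sum; apply: eq_bigr => i _; rewrite -hnorm_sqr.
Qed.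

Lemma hnorm_tuple_ge0 H n (x : 'I_n -> H) : 0 <= hnorm_tuple x.
Proof. exact: sqrtr_ge0. Qed.

Lemma hnorm_le_tuple H n (x : 'I_n -> H) i : hnorm (x i) <= hnorm_tuple x.
Proof.
rewrite -ler_sqr ?nnegrE ?hnorm_ge0 ?hnorm_tuple_ge0 //.
rewrite /hnorm_tuple sqr_sqrtr ?sumr_ge0 // => [|j _]; last exact: sqr_ge0.
by rewrite (bigD1 i) //= lerDl sumr_ge0 // => j _; exact: sqr_ge0.
Qed.

Lemma hnorm_tuple_le H n (x : 'I_n -> H) k :
  0 <= k -> (forall i, hnorm (x i) <= k) -> hnorm_tuple x <= Num.sqrt n%:R * k.
Proof.
move=> k0 xk; rewrite -ler_sqr ?nnegrE ?hnorm_tuple_ge0 ?mulr_ge0 ?sqrtr_ge0 //.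
rewrite exprMn [Num.sqrt n%:R ^+ 2]sqr_sqrtr ?ler0n // /hnorm_tuple.
rewrite sqr_sqrtr; last by apply: sumr_ge0 => i _; exact: sqr_ge0.
apply: le_trans (_ : \sum_(i < n) k ^+ 2 <= _); last first.
  by rewrite sumr_const card_ord mulr_natl.
by apply: ler_sum => i _; rewrite ler_sqr ?nnegrE ?hnorm_ge0.
Qed.

Lemma hnorm_tupleZ H n (a : R) (x : 'I_n -> H) : 0 <= a ->
  hnorm_tuple (fun i => ((a%:C)%C : R[i]) *: x i) = a * hnorm_tuple x.
Proof.
move=> a0; rewrite /hnorm_tuple.
have aE : complex.Re `|((a%:C)%C : R[i])| = a.
  by rewrite normc_def /= expr0n addr0 sqrtr_sqr ger0_norm.
under eq_bigr do rewrite hnormZ aE exprMn.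
by rewrite -mulr_sumr sqrtrM ?sqr_ge0 // sqrtr_sqr ger0_norm.
Qed.
End HilbertNorm.

Section Euclid.
Variables (R : realType).
Local Notation C := R[i].

Lemma inner_euclid d (x y : euclid R d) : inner x y = dotc y x.
Proof.
rewrite dotcE /inner /= /cdot; apply: eq_bigr => i _; exact: mulrC.
Qed.

Definition mxfun d d' (A : 'M[C]_(d', d)) : euclid R d -> euclid R d' :=
  fun x => A *m (x : 'cV_d).

Lemma mxfun_is_linear d d' (A : 'M[C]_(d', d)) : linear (mxfun A).
Proof. by move=> a x y; rewrite /mxfun mulmxDr -scalemxAr. Qed.

Lemma mxfun_bound d d' (A : 'M[C]_(d', d)) : exists2 k : R, 0 <= k &
  forall x : euclid R d, hnorm (mxfun A x) <= k * hnorm x.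
Proof.
have Ah : (A^t* *m A)^t* = A^t* *m A by rewrite adjmxM trmxCK.
have [k k0 [kA _]] := herm_le_scalar Ah.
have kE : k = ((complex.Re k)%:C)%C by rewrite RRe_real // ger0_real.
have k0' : 0 <= complex.Re k by rewrite -lecR -kE.
exists (Num.sqrt (complex.Re k)); first exact: sqrtr_ge0.
move=> x; rewrite -ler_sqr ?nnegrE ?mulr_ge0 ?hnorm_ge0 ?sqrtr_ge0 //.
rewrite exprMn [_ ^+ 2 in leRHS]sqr_sqrtr //.
have : inner (mxfun A x) (mxfun A x) <= k * inner x x.
  rewrite !inner_euclid; have := kA x.
  by rewrite mulmxBl mul_scalar_mx dotcBr dotcZr subr_ge0 -mulmxA dotc_adjr trmxCK.
by rewrite -!hnorm_sqr {1}kE -rmorphM lecR.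
Qed.

Lemma mx_act_mxop d n (F : 'M['M[C]_d]_n) (x : 'I_n -> euclid R d) i :
  mx_act (map_mx (@mxop R d) F) x i = \sum_j (F i j *m (x j : 'cV_d)).
Proof. by apply: eq_bigr => j _; rewrite mxE. Qed.

Lemma mx_act_mxopZ d n (F : 'M['M[C]_d]_n) (a : C) (x : 'I_n -> euclid R d) :
  mx_act (map_mx (@mxop R d) F) (fun i => a *: x i) =
  (fun i => a *: mx_act (map_mx (@mxop R d) F) x i).
Proof.
apply/funext => i; rewrite !mx_act_mxop scaler_sumr.
by apply: eq_bigr => j _; rewrite -scalemxAr.
Qed.

Lemma mx_act_bound d n (F : 'M['M[C]_d]_n) : exists2 k : R, 0 <= k &
  forall x : 'I_n -> euclid R d,
    hnorm_tuple (mx_act (map_mx (@mxop R d) F) x) <= k * hnorm_tuple x.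
Proof.
have /choice [k kP] : forall ij : 'I_n * 'I_n, exists k : R, 0 <= k /\
    forall x : euclid R d, hnorm (mxop (F ij.1 ij.2) x) <= k * hnorm x.
  by move=> ij; have [k k0 kP] := mxfun_bound (F ij.1 ij.2); exists k.
pose K := \sum_i \sum_j k (i, j).
have k0 i j : 0 <= k (i, j) by have [] := kP (i, j).
have K0 : 0 <= K by do 2!apply: sumr_ge0 => ? _.
exists (Num.sqrt n%:R * K); first by rewrite mulr_ge0 ?sqrtr_ge0.
move=> x; rewrite -mulrA; apply: hnorm_tuple_le.
  by rewrite mulr_ge0 ?hnorm_tuple_ge0.
move=> i; rewrite mx_act_mxop; apply: le_trans (hnorm_sum _ _ _) _.
apply: le_trans (_ : \sum_j k (i, j) * hnorm_tuple x <= _).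
  apply: ler_sum => j _; have [_ /(_ (x j)) /=] := kP (i, j).
  by move/le_trans; apply; rewrite ler_wpM2l // hnorm_le_tuple.
rewrite -mulr_suml ler_wpM2r ?hnorm_tuple_ge0 // /K [leRHS](bigD1 i) //= lerDl.
by do 2!apply: sumr_ge0 => ? _.
Qed.

Lemma mx_opnorm_has_sup d n (F : 'M['M[C]_d]_n) (E : set (euclid R d)) :
  E 0 -> has_sup [set hnorm_tuple (mx_act (map_mx (@mxop R d) F) x) |
     x in [set x : 'I_n -> euclid R d | (forall i, E (x i)) /\ hnorm_tuple x <= 1]].
Proof.
move=> E0; split.
  eexists; exists (fun _ => 0) => //; split=> // .
  rewrite /hnorm_tuple big1 ?sqrtr0 // => i _.
  by rewrite hnorm0 expr0n.
have [k k0 kP] := mx_act_bound F.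
exists k => _ [x [_ x1] <-]; apply: le_trans (kP x) _.
by rewrite -[leRHS]mulr1 ler_wpM2l.
Qed.

Lemma mx_opnorm_on_ub d n (F : 'M['M[C]_d]_n) (E : set (euclid R d)) x :
  E 0 -> (forall a x, E x -> E (a *: x)) -> (forall i, E (x i)) ->
  hnorm_tuple (mx_act (map_mx (@mxop R d) F) x) <=
    mx_opnorm_on E (map_mx (@mxop R d) F) * hnorm_tuple x.
Proof.
move=> E0 EZ Ex; have [k k0 kP] := mx_act_bound F.
have [x0|x0] := eqVneq (hnorm_tuple x) 0.
  by have := kP x; rewrite x0 !mulr0.
have xgt0 : 0 < hnorm_tuple x by rewrite lt_neqAle eq_sym x0 hnorm_tuple_ge0.
rewrite -ler_pdivrMr // mulrC.
have xV : 0 <= (hnorm_tuple x)^-1 by rewrite invr_ge0 ltW.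
rewrite -hnorm_tupleZ // -mx_act_mxopZ.
apply: (ub_le_sup (proj2 (mx_opnorm_has_sup F E0))).
eexists; last by reflexivity.
split=> [i|]; first exact: EZ.
by rewrite hnorm_tupleZ // mulVf.
Qed.

Definition sqn d n (x : 'I_n -> 'cV[C]_d) : C := \sum_i dotc (x i) (x i).

Lemma sqnE d n (x : 'I_n -> euclid R d) : ((hnorm_tuple x ^+ 2)%:C)%C = sqn x.
Proof. by rewrite hnorm_tuple_sqr; apply: eq_bigr => i _; rewrite inner_euclid. Qed.

Lemma dotc_amgm d (u v : 'cV[C]_d) :
  dotc u v + dotc v u <= dotc u u + dotc v v.
Proof.
rewrite -subr_ge0; have := dotc_ge0 (u - v).
rewrite dotcBr !dotcBl; congr (0 <= _); ring.
Qed.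

(** As $1=\sum_k K_k^*pK_k$, the map $W:x\mapsto(pK_kx)_k$ is isometric, and $F$ is $W^*$ after
    copies of $F$ applied to vectors from the range of $p$. Restricting to [E] therefore loses no
    norm, at any matrix level. *)
Lemma kraus_mx_opnorm d (S : {vspace 'M[C]_d}) (p : 'M[C]_d) (I : finType)
    (K : I -> 'M[C]_d) (E : set (euclid R d)) n (F : 'M['M[C]_d]_n) :
  1%:M \in S -> p^t* = p -> p *m p = p ->
  (forall s, s \in S -> s = \sum_k (K k)^t* *m (p *m s *m p) *m K k) ->
  (forall i j, F i j \in S) ->
  E 0 -> (forall a x, E x -> E (a *: x)) -> (forall x, E (p *m (x : 'cV_d))) ->
  mx_opnorm_on E (map_mx (@mxop R d) F) = mx_opnorm_on setT (map_mx (@mxop R d) F).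
Proof.
move=> S1 ph pp SK FS E0 EZ Ep; apply/eqP; rewrite eq_le; apply/andP; split.
  apply: ge_sup; first by case: (mx_opnorm_has_sup F E0).
  move=> _ [x [_ x1] <-].
  apply: (ub_le_sup (proj2 (mx_opnorm_has_sup F (Logic.I : [set: euclid R d] 0)))).
  by exists x.
apply: ge_sup; first by case: (mx_opnorm_has_sup F (Logic.I : [set: euclid R d] 0)).
move=> _ [x [_ x1] <-].
set c := mx_opnorm_on E _.
have c0 : 0 <= c.
  have [[r rE] ub] := mx_opnorm_has_sup F E0.
  by apply: le_trans (ub_le_sup ub rE); case: rE => y _ <-; exact: hnorm_tuple_ge0.
pose y k i : euclid R d := p *m (K k *m (x i : 'cV_d)).
pose Z := mx_act (map_mx (@mxop R d) F) x.
pose Y k := mx_act (map_mx (@mxop R d) F) (y k).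
have Yle k : sqn (Y k) <= ((c ^+ 2)%:C)%C * sqn (y k).
  rewrite -!sqnE -rmorphM lecR -exprMn ler_sqr ?nnegrE ?mulr_ge0 ?hnorm_tuple_ge0 //.
  by apply: mx_opnorm_on_ub => // i; exact: Ep.
have sumK (w : 'I_n -> 'cV[C]_d) :
    \sum_k sqn (fun i => p *m (K k *m w i)) = sqn w.
  rewrite exchange_big; apply: eq_bigr => i _ /=.
  transitivity (dotc (w i) (1%:M *m w i)); last by rewrite mul1mx.
  rewrite [in RHS](SK _ S1) mulmx_suml dotc_sumr.
  by apply: eq_bigr => k _; rewrite mulmx1 pp; exact: dotc_proj.
have ZE i : Z i = \sum_k (K k)^t* *m (p *m Y k i).
  rewrite /Z mx_act_mxop; under eq_bigr do rewrite (SK _ (FS _ _)) mulmx_suml.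
  rewrite exchange_big; apply: eq_bigr => k _ /=.
  rewrite /Y mx_act_mxop !mulmx_sumr; apply: eq_bigr => j _.
  by rewrite /y !mulmxA.
(* In place of Cauchy-Schwarz over $k$: $2\|Z\|^2\le\sum_k\|pK_kZ\|^2+\sum_k\|Y_k\|^2$, where the
   first sum is again $\|Z\|^2$. *)
have amgm i : dotc (Z i) (Z i) + dotc (Z i) (Z i) <=
    \sum_k (dotc (p *m (K k *m Z i)) (p *m (K k *m Z i)) + dotc (Y k i) (Y k i)).
  have e : dotc (Z i) (Z i) = \sum_k dotc (p *m (K k *m Z i)) (Y k i).
    rewrite {2}ZE dotc_sumr; apply: eq_bigr => k _.
    by rewrite dotc_adjr trmxCK dotc_adjr ph.
  have e' : dotc (Z i) (Z i) = \sum_k dotc (Y k i) (p *m (K k *m Z i)).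
    by rewrite -dotcC e rmorph_sum; apply: eq_bigr => k _; rewrite /= dotcC.
  rewrite {1}e e' -big_split; apply: ler_sum => k _; exact: dotc_amgm.
have key : sqn Z <= \sum_k sqn (Y k).
  rewrite -(lerD2l (sqn Z)).
  have <- : \sum_i \sum_k (dotc (p *m (K k *m Z i)) (p *m (K k *m Z i)) +
      dotc (Y k i) (Y k i)) = sqn Z + \sum_k sqn (Y k).
    rewrite exchange_big -(sumK Z) -big_split; apply: eq_bigr => k _ /=.
    exact: big_split.
  rewrite -[leLHS]big_split; apply: ler_sum => i _; exact: amgm.
have {key} : sqn Z <= ((c ^+ 2)%:C)%C * sqn x.
  apply: le_trans key _; rewrite -(sumK x) mulr_sumr; exact: ler_sum.
rewrite -!sqnE -rmorphM lecR -exprMn ler_sqr ?nnegrE ?mulr_ge0 ?hnorm_tuple_ge0 //.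
by move/le_trans; apply; rewrite -[leRHS]mulr1 ler_wpM2l.
Qed.

(** The range of [p] reduces [S] and, by [kraus_mx_opnorm], restriction to it is completely
    isometric, so it cannot be a nontrivial subspace. If $p=0$, rebuilding $1$ from the compression
    gives $1=0=p$. *)
Lemma irreducible_proj d (S : {vspace 'M[C]_d}) (p : 'M[C]_d) (I : finType)
    (K : I -> 'M[C]_d) :
  nc_graph S -> acts_irreducibly S -> p^t* = p -> p *m p = p ->
  (forall s, s \in S -> s *m p = p *m s) ->
  (forall s, s \in S -> s = \sum_k (K k)^t* *m (p *m s *m p) *m K k) ->
  p = 1%:M.
Proof.
move=> [S1 _] Sirr ph pp Sp SK; apply: contrapT => p1; apply: Sirr.
pose P : {linear euclid R d -> euclid R d} :=
  HB.pack (@mxop R d p) (GRing.isLinear.Build _ _ _ _ _ (mxfun_is_linear p)).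
pose L := limg (linfun P).
have LP (x : euclid R d) : reflect (p *m (x : 'cV_d) = x) (x \in L).
  apply: (iffP memv_imgP) => [[y _ ->]|px].
    by rewrite lfunE /= /mxop mulmxA pp.
  by exists x; rewrite ?memvf // lfunE /= /mxop px.
exists L; split.
- apply/eqP => L0; apply: p1.
  have p0 : p = 0.
    have px x : p *m x = 0 :> 'cV_d.
      have : (p *m x : euclid R d) \in L by apply/LP; rewrite mulmxA pp.
      by rewrite L0 memv0 => /eqP.
    by apply: mulmx_cV_inj => x; rewrite px mul0mx.
  by rewrite p0 (SK _ S1) big1 // => k _; rewrite p0 !(mul0mx, mulmx0).
- apply/eqP => Lf; apply: p1; apply: mulmx_cV_inj => x.
  by rewrite mul1mx; apply/LP; rewrite Lf memvf.
- move=> s sS; split=> x.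
    by move=> /LP px; apply/LP; rewrite /mxop mulmxA -Sp // -mulmxA px.
  move=> xL y /LP py; rewrite inner_euclid.
  have px : p *m (x : 'cV_d) = 0.
    apply: dotc_eq0; rewrite -dotcC -{1}ph -dotc_adjr mulmxA pp dotcC.
    have := xL (p *m (x : 'cV_d)); rewrite inner_euclid => /(_ _) h.
    by rewrite -dotcC h ?conjC0 //; apply/LP; rewrite mulmxA pp.
  rewrite -py dotc_adjr ph /mxop mulmxA -Sp // -mulmxA px mulmx0.
  by rewrite -dotcC dotc0r conjC0.
- move=> n F FS; apply: (@kraus_mx_opnorm _ S p I K) => //=.
  + exact: mem0v.
  + by move=> a x; exact: memvZ.
  + by move=> x; apply/LP; rewrite mulmxA pp.
Qed.

End Euclid.

(** * Bounded remainders and telescoping sums *)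

Section Archimedean.
Variable R : realType.
Local Notation C := R[i].

Lemma natmul_bounded_le0 (a b : R) : (forall n, a *+ n <= b) -> a <= 0.
Proof.
move=> ab; rewrite leNgt; apply/negP => a0.
have b0 : 0 <= b by have := ab 0%N; rewrite mulr0n.
have := archi_boundP (divr_ge0 b0 (ltW a0)).
by rewrite ltr_pdivrMr // mulr_natl ltNge ab.
Qed.

(** Here $q+r_n/n\ge0$ with $r_n$ bounded: an Archimedean substitute for the limit of Cesaro
    means. *)
Lemma natmul_bounded_ge0 (q : C) (r : nat -> C) (b : C) :
  (forall n, 0 <= q *+ n + r n) -> (forall n, `|r n| <= b) -> 0 <= q.
Proof.
case: q => q1 q2 qr rb.
have bE n : complex.Re b >= `|complex.Re (r n)| /\ complex.Re b >= `|complex.Im (r n)|.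
  have h := rb n; have br : b = ((complex.Re b)%:C)%C.
    by rewrite RRe_real // ger0_real // (le_trans _ h).
  move: h; rewrite br normc_def lecR => h; split; apply: le_trans h.
    by rewrite -sqrtr_sqr ler_wsqrtr // lerDl sqr_ge0.
  by rewrite -sqrtr_sqr ler_wsqrtr // lerDr sqr_ge0.
have qn n : (q1 +i* q2)%C *+ n = ((q1 *+ n) +i* (q2 *+ n))%C.
  by elim: n => [|n IH] //; rewrite !mulrS IH.
have h n : q2 *+ n + complex.Im (r n) = 0 /\ 0 <= q1 *+ n + complex.Re (r n).
  have := qr n; rewrite qn; case: (r n) => r1 r2; rewrite lecE /=.
  by case/andP => /eqP -> ->.
rewrite lecE /=; apply/andP; split.
  rewrite eq_le; apply/andP; split.
    apply: (natmul_bounded_le0 (b := complex.Re b)) => n.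
    have [/eqP h1 _] := h n; move: h1; rewrite addr_eq0 => /eqP ->.
    by have [_] := bE n; apply: le_trans; rewrite -normrN ler_norm.
  rewrite -oppr_le0.
  apply: (natmul_bounded_le0 (b := complex.Re b)) => n.
  have [/eqP h1 _] := h n; move: h1; rewrite addr_eq0 mulNrn => /eqP ->.
  by have [_] := bE n; apply: le_trans; rewrite opprK ler_norm.
rewrite -oppr_le0; apply: (natmul_bounded_le0 (b := complex.Re b)) => n.
have [_] := h n; rewrite mulNrn -lerBlDl sub0r => h1.
have [h2 _] := bE n; apply: (le_trans h1).
by apply: (le_trans _ h2); rewrite ler_norm.
Qed.

Lemma natmul_bounded_eq0 (q : C) (b : C) : (forall n, `|q *+ n| <= b) -> q = 0.
Proof.
move=> qb; have pos (z : C) : (forall n, `|z *+ n| <= b) -> 0 <= z.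
  move=> zb; apply: (natmul_bounded_ge0 (r := fun n => - (z *+ n)) (b := b)).
    by move=> n; rewrite subrr.
  by move=> n; rewrite normrN.
by apply/eqP; rewrite eq_le pos // -oppr_ge0 pos // => n; rewrite mulNrn normrN.
Qed.

End Archimedean.

(** Telescoping: the orbit sum of a fixed point plus a coboundary grows as $np$, up to a remainder
    $z-f^n(z)$. *)
Lemma sum_iter_cobound (V : zmodType) (f : {additive V -> V}) (x p z : V) n :
  f p = p -> x = p + (z - f z) ->
  \sum_(m < n) iter m f x = p *+ n + (z - iter n f z).
Proof.
move=> fp xE; elim: n => [|n IH]; first by rewrite big_ord0 mulr0n subrr addr0.
rewrite big_ord_recr /= IH.
have -> : iter n f x = p + (iter n f z - iter n.+1 f z).
  by elim: (n) => [//|m IHm]; rewrite iterS IHm raddfD raddfB fp.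
by rewrite addrACA -mulrSr [X in _ + X]addrA subrK.
Qed.

(** * Ergodic projections and rigidity *)

Section Ergodic.
Variable R : realType.
Local Notation C := R[i].
Variables (d : nat) (I : finType) (B : I -> 'M[C]_d).
Hypothesis B1 : \sum_k (B k)^t* *m B k = 1%:M.

Definition kraus (x : 'M[C]_d) := \sum_k (B k)^t* *m x *m B k.

Lemma kraus_is_linear : linear kraus.
Proof.
move=> a x y; rewrite /kraus scaler_sumr -big_split; apply: eq_bigr => k _ /=.
by rewrite mulmxDr mulmxDl -scalemxAr -scalemxAl.
Qed.

HB.instance Definition _ := GRing.isLinear.Build _ _ _ _ kraus kraus_is_linear.

Definition form_le (b : C) (x : 'M[C]_d) :=
  forall u v, `|dotc u (x *m v)| <= b * (dotc u u + dotc v v).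

Lemma dotc_kraus u x v :
  dotc u (kraus x *m v) = \sum_k dotc (B k *m u) (x *m (B k *m v)).
Proof.
rewrite mulmx_suml dotc_sumr; apply: eq_bigr => k _.
by rewrite -!mulmxA dotc_adjr trmxCK.
Qed.

Lemma dotc_kraus1 u : \sum_k dotc (B k *m u) (B k *m u) = dotc u u.
Proof.
have := dotc_kraus u 1%:M u; rewrite /kraus.
under eq_bigr do rewrite mulmx1.
by rewrite B1 mul1mx => ->; apply: eq_bigr => k _; rewrite mul1mx.
Qed.

Lemma form_le_kraus b x : form_le b x -> form_le b (kraus x).
Proof.
move=> xb u v; rewrite dotc_kraus; apply: le_trans (ler_norm_sum _ _ _) _.
rewrite -(dotc_kraus1 u) -(dotc_kraus1 v) -big_split mulr_sumr /=.
by apply: ler_sum => k _; exact: xb.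
Qed.

Lemma form_le_iter b x n : form_le b x -> form_le b (iter n kraus x).
Proof. by move=> xb; elim: n => [|n]; [exact: xb|exact: form_le_kraus]. Qed.

Definition kraus_cobound : 'End('M[C]_d) := \1%VF - linfun kraus.

Lemma kraus_coboundE x : kraus_cobound x = x - kraus x.
Proof. by rewrite /kraus_cobound add_lfunE opp_lfunE id_lfunE lfunE. Qed.

(** The iterates of $z$ are $z-nx$ and remain bounded, which forces $x=0$. *)
Lemma kraus_fixed_cobound x z : kraus x = x -> x = z - kraus z -> x = 0.
Proof.
move=> xfix xz; apply: form_eq0 => u.
have [b b0 zb] := form_bounded z.
have itz n : iter n kraus z = z - x *+ n.
  elim: n => [|n IH]; first by rewrite mulr0n subr0.
  rewrite iterS IH linearB linearMn /= xfix mulrS opprD addrA.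
  by have -> : kraus z = z - x by rewrite [in RHS]xz subKr.
apply: (natmul_bounded_eq0 (b := b * (dotc u u + dotc u u) *+ 2)) => n.
have -> : dotc u (x *m u) *+ n = dotc u (z *m u) - dotc u (iter n kraus z *m u).
  by rewrite -dotcBr -mulmxBl itz subKr -[in RHS]scaler_nat -scalemxAl dotcZr mulr_natl.
apply: le_trans (ler_normB _ _) _; rewrite mulr2n lerD ?zb //.
exact: form_le_iter.
Qed.

Lemma kraus_cap0 : (lker kraus_cobound :&: limg kraus_cobound = 0)%VS.
Proof.
apply/eqP; rewrite -subv0; apply/subvP => x; rewrite memv_cap memv0.
case/andP => /[!memv_ker] /eqP kx /memv_imgP[z _ xz].
apply/eqP/(kraus_fixed_cobound (z := z)); last by rewrite xz kraus_coboundE.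
by apply/eqP; rewrite eq_sym -subr_eq0 -kraus_coboundE kx.
Qed.

Lemma kraus_split : (lker kraus_cobound + limg kraus_cobound)%VS = fullv.
Proof.
apply/eqP; rewrite eqEdim subvf dimv_disjoint_sum ?kraus_cap0 //.
have := limg_ker_dim kraus_cobound fullv.
by rewrite capfv => e; exact: eq_leq (esym e).
Qed.

Lemma kraus_blk_psd (J : finType) (F : J -> J -> 'M[C]_d) :
  (forall x : J -> 'cV[C]_d, 0 <= \sum_j \sum_k dotc (x j) (F j k *m x k)) ->
  forall x : J -> 'cV[C]_d, 0 <= \sum_j \sum_k dotc (x j) (kraus (F j k) *m x k).
Proof.
move=> F0 x; rewrite (_ : (\sum_j _) =
    \sum_l \sum_j \sum_k dotc (B l *m x j) (F j k *m (B l *m x k))).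
  by apply: sumr_ge0 => l _; exact: F0.
rewrite [RHS]exchange_big; apply: eq_bigr => j _ /=; rewrite [RHS]exchange_big.
by apply: eq_bigr => k _ /=; rewrite dotc_kraus.
Qed.

(* The mean ergodic projection of a unital completely positive map: it is the
   projection onto the fixed points along the coboundaries, and it is completely
   positive as a limit of Cesaro means. *)
Lemma ergodic_kraus : exists (r : nat) (A : 'I_r -> 'M[C]_d),
  let Phi x := \sum_l (A l)^t* *m x *m A l in
  [/\ forall x, Phi (kraus x) = Phi x, forall x, Phi (Phi x) = Phi x &
      forall x, kraus x = x -> Phi x = x].
Proof.
pose U := lker kraus_cobound; pose W := limg kraus_cobound.
have UW0 : (U :&: W = 0)%VS by exact: kraus_cap0.
pose P := daddv_pi U W.
have Pfix x : kraus (P x) = P x.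
  have : P x \in U by exact: memv_pi.
  by rewrite memv_ker kraus_coboundE subr_eq0 => /eqP.
have Pcob x : exists z, x = P x + (z - kraus z).
  have : daddv_pi W U x \in W by exact: memv_pi.
  case/memv_imgP => z _ zE; exists z; rewrite -kraus_coboundE -zE.
  by rewrite daddv_pi_add // kraus_split memvf.
have Pid x : kraus x = x -> P x = x.
  move=> xfix; apply: daddv_pi_id => //.
  by rewrite memv_ker kraus_coboundE xfix subrr.
have PN z : P (z - kraus z) = 0.
  have zW : z - kraus z \in W by rewrite -kraus_coboundE memv_img ?memvf.
  have := daddv_pi_add UW0 (_ : z - kraus z \in U + W)%VS.
  have WU0 : (W :&: U = 0)%VS by rewrite capvC.
  rewrite kraus_split memvf => /(_ isT); rewrite (daddv_pi_id WU0 zW).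
  by move=> h; rewrite -(addrK (z - kraus z) (P _)) h subrr.
have [A AP] : exists A : 'I_#|{: 'I_d * 'I_d}| -> 'I_d -> 'cV[C]_d,
    forall j k s, s \in fullv -> P s j k = \sum_l dotc (A l j) (s *m A l k).
  apply: (@arveson _ d 'I_d fullv (fun j k x => P x j k)).
  - exact: memvf.
  - by move=> x _; exact: memvf.
  - by move=> j k a x y _ _; rewrite linearP !mxE.
  move=> F _ F0.
  have /choice [z zE] : forall jk : 'I_d * 'I_d, exists z,
      F jk.1 jk.2 = P (F jk.1 jk.2) + (z - kraus z) by move=> jk; exact: Pcob.
  have /choice [b bE] : forall jk : 'I_d * 'I_d, exists b, form_le b (z jk).
    by move=> jk; have [b _ zb] := form_bounded (z jk); exists b.
  pose r n := \sum_j \sum_k (z (j, k) - iter n kraus (z (j, k))) j k.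
  pose e j : 'cV[C]_d := delta_mx j 0.
  (* The sum over $j,k$ of the $(j,k)$ entries of $P(F_{jk})$, times $n$, plus [r n], is the sum of
     the first $n$ iterates tested on the basis vectors. Each iterate is block positive by
     [kraus_blk_psd], and [form_le_iter] bounds [r n] uniformly. *)
  apply: (natmul_bounded_ge0 (r := r) (b := \sum_j \sum_k
    (b (j, k) * (dotc (e j) (e j) + dotc (e k) (e k))) *+ 2)) => n.
    rewrite /r -sumrMnl -big_split /=.
    rewrite (_ : \sum_j _ = \sum_(m < n) \sum_j \sum_k iter m kraus (F j k) j k).
      apply: sumr_ge0 => m _.
      have : forall x : 'I_d -> 'cV[C]_d,
          0 <= \sum_j \sum_k dotc (x j) (iter m kraus (F j k) *m x k).
        by elim: (m : nat) => // m' IH; exact: kraus_blk_psd IH.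
      move/(_ e); under eq_bigr do under eq_bigr do rewrite dotc_delta.
      by [].
    rewrite [RHS]exchange_big; apply: eq_bigr => j _ /=.
    rewrite [RHS]exchange_big -sumrMnl -big_split; apply: eq_bigr => k _ /=.
    rewrite -summxE (sum_iter_cobound _ (Pfix _) (zE (j, k))) !mxE.
    by rewrite -[in RHS]scaler_nat mxE mulr_natl.
  rewrite /r; apply: le_trans (ler_norm_sum _ _ _) _; apply: ler_sum => j _.
  apply: le_trans (ler_norm_sum _ _ _) _; apply: ler_sum => k _.
  rewrite !mxE mulr2n; apply: le_trans (ler_normB _ _) _.
  by rewrite -!dotc_delta lerD //; [|apply: form_le_iter]; exact: bE.
exists #|{: 'I_d * 'I_d}|, (fun l => \matrix_(a, k) A l k a 0) => Phi.
have PhiE x : Phi x = P x.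
  apply/matrixP => j k; rewrite AP ?memvf // /Phi summxE; apply: eq_bigr => l _.
  rewrite -dotc_delta -!mulmxA dotc_adjr trmxCK.
  have e i : (\matrix_(a, k) A l k a 0) *m delta_mx i 0 = A l i.
    by rewrite -colE; apply/matrixP => a b; rewrite !mxE ord1.
  by rewrite !e.
split=> x; rewrite !PhiE.
- by apply/eqP; rewrite eq_sym -subr_eq0 -linearB /= PN.
- by rewrite Pid.
- exact: Pid.
Qed.

End Ergodic.

(** * Spectral projections and the Schwarz defect *)

Section SpectralProjections.
Variable C : numClosedFieldType.

Lemma psd_anti n (X : 'M[C]_n) : psd X -> psd (- X) -> X = 0.
Proof.
move=> [X0] [X1]; apply: form_eq0 => u; apply/eqP; rewrite eq_le X0 andbT.
by have := X1 u; rewrite mulNmx dotcNr oppr_ge0.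
Qed.

Lemma sum_gram_eq0 m n (I : finType) (X : I -> 'M[C]_(m, n)) :
  \sum_i (X i)^t* *m X i = 0 -> forall i, X i = 0.
Proof.
move=> X0 i; apply: gram_eq0; apply: psd_anti; first exact: psd_gram.
move: X0; rewrite (bigD1 i) //= => /eqP; rewrite addrC addr_eq0 => /eqP <-.
by apply: psd_sum => j _; exact: psd_gram.
Qed.

Lemma diag_mx_mul n (D E : 'rV[C]_n) (P : 'M[C]_n) : P *m P^t* = 1%:M ->
  (P^t* *m diag_mx D *m P) *m (P^t* *m diag_mx E *m P) =
  P^t* *m diag_mx (\row_i (D 0 i * E 0 i)) *m P.
Proof.
move=> PP; rewrite !mulmxA -(mulmxA _ P) PP mulmx1 -(mulmxA _ (diag_mx D)).
by rewrite mulmx_diag.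
Qed.

Lemma diag_mx_adj n (D : 'rV[C]_n) (P : 'M[C]_n) :
  (P^t* *m diag_mx D *m P)^t* = P^t* *m diag_mx (\row_i (D 0 i)^*) *m P.
Proof.
rewrite !adjmxM trmxCK -mulmxA; congr (_ *m (_ *m _)).
rewrite tr_diag_mx map_diag_mx; congr diag_mx.
by apply/rowP => i; rewrite !mxE.
Qed.

Lemma support_proj n (Q : 'M[C]_n) : Q^t* = Q -> exists p Q' : 'M[C]_n,
  [/\ p^t* = p, p *m p = p, p *m Q = Q & Q *m Q' = p].
Proof.
move=> Qh; have [P [D [PP [_ QE]]]] := spectral_decomp Qh.
exists (P^t* *m diag_mx (\row_i (D 0 i != 0)%:R) *m P).
(* Since the inverse of $0$ is $0$, this is the pseudo-inverse of [Q]. *)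
exists (P^t* *m diag_mx (\row_i (D 0 i)^-1) *m P).
rewrite diag_mx_adj QE !diag_mx_mul //; split;
  congr (_ *m diag_mx _ *m _); apply/rowP => i; rewrite !mxE.
- by rewrite conjC_nat.
- by case: eqP; rewrite ?mulr0 ?mulr1.
- by case: eqVneq => [->|_]; rewrite ?mulr0 ?mul1r.
- by case: eqVneq => [->|h]; rewrite ?mul0r ?mulfV.
Qed.

Lemma comm_diag_fun n (D : 'rV[C]_n) (f : C -> C) (Z : 'M[C]_n) :
  Z *m diag_mx D = diag_mx D *m Z ->
  Z *m diag_mx (\row_i f (D 0 i)) = diag_mx (\row_i f (D 0 i)) *m Z.
Proof.
move=> /matrixP ZD; apply/matrixP => i j; have := ZD i j.
rewrite !mul_mx_diag !mul_diag_mx !mxE.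
move: (Z i j) => z h; have [->|z0] := eqVneq z 0; first by rewrite mulr0 mul0r.
have -> : D 0 i = D 0 j by apply: (mulIf z0); rewrite -h mulrC.
exact: mulrC.
Qed.

(** [g] is the indicator function of one positive eigenvalue applied to [Q], so it commutes with
    whatever commutes with [Q]. As [Q] is the scalar [l] on its range, dividing by $\sqrt l$ turns a
    factor of [Q] into a partial isometry without leaving the commutant. *)
Lemma eigen_proj n (I : finType) (X : I -> 'M[C]_n) (Q : 'M[C]_n) :
  Q = \sum_i (X i) *m (X i)^t* -> Q != 0 ->
  exists (l : C) (g : 'M[C]_n), [/\ 0 < l, g != 0, g^t* = g, g *m g = g &
   Q *m g = l *: g /\ forall Y, Y *m Q = Q *m Y -> Y *m g = g *m Y].
Proof.
move=> QX Q0.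
have Qpsd : psd Q.
  by rewrite QX; apply: psd_sum => i _; rewrite -{1}[X i]trmxCK; exact: psd_gram.
have Qh := psd_herm Qpsd.
have [P [D [PP [PP' QE]]]] := spectral_decomp Qh.
have D0 i : 0 <= D 0 i by rewrite (spectral_psd_ge0 _ PP) // -QE.
have [i0 Di0] : exists i0, D 0 i0 != 0.
  apply: contrapT => H; move/negP: Q0; apply; rewrite QE.
  have -> : D = 0.
    apply/rowP => i; rewrite mxE; apply: contrapT => /eqP Di.
    by apply: H; exists i.
  by rewrite linear0 mulmx0 mul0mx.
pose E : 'rV[C]_n := \row_i (D 0 i == D 0 i0)%:R.
exists (D 0 i0), (P^t* *m diag_mx E *m P); split.
- by rewrite lt_neqAle eq_sym Di0 D0.
- apply/eqP => g0.
  have : P *m (P^t* *m diag_mx E *m P) *m P^t* = diag_mx E.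
    by rewrite !mulmxA PP mul1mx -mulmxA PP mulmx1.
  rewrite g0 mulmx0 mul0mx => /matrixP /(_ i0 i0) /eqP.
  by rewrite !mxE !eqxx mulr1n eq_sym oner_eq0.
- rewrite diag_mx_adj; congr (_ *m diag_mx _ *m _); apply/rowP => i.
  by rewrite !mxE conjC_nat.
- rewrite diag_mx_mul //; congr (_ *m diag_mx _ *m _); apply/rowP => i.
  by rewrite !mxE; case: eqP; rewrite ?mulr0 ?mulr1.
split.
  rewrite QE diag_mx_mul // scalemxAl scalemxAr -linearZ.
  congr (_ *m _ *m _); congr diag_mx; apply/rowP => i.
  by rewrite !mxE; case: eqP => [->|]; rewrite ?mulr0 ?mulr1.
move=> Y YQ; pose Z := P *m Y *m P^t*.
have ZD : Z *m diag_mx D = diag_mx D *m Z.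
  have QD : diag_mx D = P *m Q *m P^t*.
    by rewrite QE !mulmxA PP mul1mx -mulmxA PP mulmx1.
  rewrite QD /Z !mulmxA -[P *m Y *m _ *m P]mulmxA PP' mulmx1.
  by rewrite -[P *m Q *m _ *m P]mulmxA PP' mulmx1 -(mulmxA P Y) YQ mulmxA.
have ZE : Z *m diag_mx E = diag_mx E *m Z by exact: (comm_diag_fun (fun x => (x == D 0 i0)%:R)).
have YZ : Y = P^t* *m Z *m P.
  by rewrite /Z !mulmxA PP' mul1mx -mulmxA PP' mulmx1.
transitivity (P^t* *m (Z *m diag_mx E) *m P).
  by rewrite YZ !mulmxA -(mulmxA _ P (P^t*)) PP mulmx1.
by rewrite ZE YZ !mulmxA -(mulmxA _ P (P^t*)) PP mulmx1.
Qed.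

End SpectralProjections.

(** The Kadison-Schwarz inequality with its defect written exactly as a sum of squares. With $p$ the
    support it shows that the system is reduced; with $p=1$ the squares are those of the commutators
    $[s,A_l]$. *)
Lemma schwarz_defect (C : numClosedFieldType) d (I : finType)
    (A : I -> 'M[C]_d) (p s : 'M[C]_d) :
  p^t* = p -> p *m p = p -> (forall l, p *m A l = A l) ->
  \sum_l (A l)^t* *m A l = 1%:M -> \sum_l (A l)^t* *m s *m A l = s ->
  \sum_l (A l)^t* *m s^t* *m A l = s^t* ->
  \sum_l (p *m s *m A l - A l *m s)^t* *m (p *m s *m A l - A l *m s) =
  \sum_l (A l)^t* *m (s^t* *m p *m s) *m A l - s^t* *m s.
Proof.
move=> ph pp pA A1 As As'.
have Ap l : (A l)^t* *m p = (A l)^t* by rewrite -{2}(pA l) adjmxM ph.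
pose b l := (A l)^t* *m s^t* *m A l *m s.
pose c l := s^t* *m ((A l)^t* *m s *m A l).
pose e l := s^t* *m ((A l)^t* *m A l) *m s.
have bE : \sum_l b l = s^t* *m s by rewrite -mulmx_suml As'.
have cE : \sum_l c l = s^t* *m s by rewrite -mulmx_sumr As.
have eE : \sum_l e l = s^t* *m s by rewrite -mulmx_suml -mulmx_sumr A1 mulmx1.
transitivity (\sum_l ((A l)^t* *m (s^t* *m p *m s) *m A l - b l - (c l - e l))).
  apply: eq_bigr => l _; rewrite adjmxB !adjmxM ph mulmxBr !mulmxBl.
  rewrite /b /c /e !mulmxA -(mulmxA _ p p) pp -(mulmxA _ p (A l)) pA.
  rewrite -(mulmxA _ ((A l)^t*) p) Ap !opprB [LHS]addrACA [RHS]addrACA.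
  by congr (_ + _); exact: addrC.
by rewrite !sumrB bE cE eE subrr subr0.
Qed.

Section Rigidity.
Variable R : realType.
Local Notation C := R[i].

(* If a completely positive map sum_k B_k^* x B_k fixes S, then its mean ergodic
   projection Phi has a support projection p reducing S, from which S is
   recovered by Phi. Hence p = 1, so Phi is faithful, and
   sum_k [s, B_k]^* [s, B_k] is a coboundary, hence killed by Phi. *)
Lemma kraus_fixed_comm d (S : {vspace 'M[C]_d}) (I : finType)
    (B : I -> 'M[C]_d) :
  nc_graph S -> acts_irreducibly S ->
  (forall s, s \in S -> \sum_k (B k)^t* *m s *m B k = s) ->
  forall s k, s \in S -> B k *m s = s *m B k.
Proof.
move=> Sg Sirr SB; have [S1 Sa] := Sg.
have B1 : \sum_k (B k)^t* *m B k = 1%:M.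
  by rewrite -[RHS](SB _ S1); apply: eq_bigr => k _; rewrite mulmx1.
have [r [A [PhiPsi PhiPhi Phifix]]] := ergodic_kraus B1.
pose Phi (x : 'M[C]_d) := \sum_l (A l)^t* *m x *m A l.
have PhiPhi' x : Phi (Phi x) = Phi x by exact: PhiPhi.
have PhiS s : s \in S -> Phi s = s by move=> sS; apply: Phifix; exact: SB.
have Phi1 : \sum_l (A l)^t* *m A l = 1%:M.
  by rewrite -[RHS](PhiS _ S1); apply: eq_bigr => k _; rewrite mulmx1.
have PhiB x y : Phi (x - y) = Phi x - Phi y.
  rewrite /Phi -sumrB; apply: eq_bigr => l _.
  by rewrite mulmxBr mulmxBl.
(* The range of [rho] is the support of [Phi]: $X\rho=0$ forces every $XA_l=0$, that is
   $\Phi(X^*X)=0$. *)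
pose rho := \sum_l A l *m (A l)^t*.
have rhoh : rho^t* = rho.
  by rewrite adjmx_sum; apply: eq_bigr => l _; rewrite adjmxM trmxCK.
have [p [rho' [ph pp prho rhop]]] := support_proj rhoh.
have qA (X : 'M[C]_d) : X *m rho = 0 -> forall l, X *m A l = 0.
  move=> X0 l; rewrite -[LHS]trmxCK.
  suff -> : (X *m A l)^t* = 0 by rewrite adjmx0.
  apply: (sum_gram_eq0 (X := fun l => (X *m A l)^t*)).
  transitivity (X *m rho *m X^t*); last by rewrite X0 mul0mx.
  rewrite mulmx_sumr mulmx_suml; apply: eq_bigr => m _.
  by rewrite trmxCK adjmxM !mulmxA.
have pA l : p *m A l = A l.
  have := @qA (1%:M - p) _ l; rewrite !mulmxBl !mul1mx prho subrr.
  by move=> /(_ erefl)/eqP; rewrite subr_eq0 => /eqP.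
have Ap l : (A l)^t* *m p = (A l)^t* by rewrite -{2}(pA l) adjmxM ph.
have red s : s \in S -> (1%:M - p) *m s *m p = 0.
  move=> sS.
  pose q := 1%:M - p.
  have qh : q^t* = q by rewrite adjmxB adjmx1 ph.
  have qq : q *m q = q by rewrite /q mulmxBr mulmx1 mulmxBl mul1mx pp subrr subr0.
  have sqA l : q *m s *m A l = 0.
    move: l; apply: sum_gram_eq0.
    have -> : \sum_l (q *m s *m A l)^t* *m (q *m s *m A l) =
        Phi (s^t* *m q *m s).
      apply: eq_bigr => l _.
      by rewrite !adjmxM qh !mulmxA -(mulmxA _ q q) qq.
    (* The matrix is positive; by idempotence its negative is $\Phi(\Phi(s^*ps)-s^*s)$, which is
       positive because the Schwarz defect is. *)
    apply: psd_anti.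
      apply: psd_sum => l _; apply: psd_conj.
      by rewrite -qq -{1}qh mulmxA -adjmxM -mulmxA; exact: psd_gram.
    have -> : - Phi (s^t* *m q *m s) = Phi (Phi (s^t* *m p *m s) - s^t* *m s).
      by rewrite PhiB PhiPhi' /q mulmxBr mulmx1 mulmxBl PhiB opprB.
    apply: psd_sum => l _; apply: psd_conj.
    rewrite -(schwarz_defect ph pp pA Phi1 (PhiS _ sS) (PhiS _ (Sa _ sS))).
    by apply: psd_sum => m _; exact: psd_gram.
  rewrite -/q -rhop mulmxA /rho mulmx_sumr big1 ?mul0mx // => l _.
  by rewrite mulmxA (sqA l) mul0mx.
have comm s : s \in S -> s *m p = p *m s.
  move=> sS; have := red s sS; rewrite !mulmxBl mul1mx => /eqP.
  rewrite subr_eq0 => /eqP ->.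
  have /(congr1 (fun X => X^t*)) := red _ (Sa _ sS).
  rewrite !adjmxM adjmxB adjmx1 ph trmxCK adjmx0 mulmxA mulmxBr mulmx1.
  by move/eqP; rewrite subr_eq0 => /eqP.
have p1 : p = 1%:M.
  apply: (irreducible_proj (K := A) Sg Sirr ph pp comm) => s sS.
  rewrite -{1}(PhiS _ sS); apply: eq_bigr => l _.
  by rewrite !mulmxA Ap -!mulmxA pA.
move=> s k sS; apply/esym/eqP; rewrite -subr_eq0; apply/eqP.
pose X k := s *m B k - B k *m s.
pose Psi (x : 'M[C]_d) := \sum_k (B k)^t* *m x *m B k.
have PhiPsi' x : Phi (Psi x) = Phi x by exact: PhiPsi.
have XX : \sum_k (X k)^t* *m X k = Psi (s^t* *m s) - s^t* *m s.
  have := schwarz_defect (@adjmx1 _ d) (mulmx1 _) (fun k => mul1mx (B k)) B1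
    (SB _ sS) (SB _ (Sa _ sS)).
  by rewrite mul1mx mulmx1.
have XA k' l : X k' *m A l = 0.
  apply: (sum_gram_eq0 (X := fun kl : I * 'I_r => X kl.1 *m A kl.2) _ (k', l)).
  transitivity (Phi (\sum_k (X k)^t* *m X k)); last by rewrite XX PhiB PhiPsi' subrr.
  rewrite /Phi; under [RHS]eq_bigr do rewrite mulmx_sumr mulmx_suml.
  rewrite exchange_big pair_bigA; apply: eq_bigr => kl _ /=.
  by rewrite adjmxM !mulmxA.
rewrite -/(X k) -[X k]mulmx1 -p1 -rhop mulmxA /rho mulmx_sumr big1 ?mul0mx // => l _.
by rewrite mulmxA XA mul0mx.
Qed.

End Rigidity.

(** * The commutant of an irreducible action *)

Section Commutant.
Variables (R : realType) (d : nat) (S : {vspace 'M[R[i]]_d}).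
Local Notation C := R[i].

Definition comm (x : 'M[C]_d) := forall s, s \in S -> s *m x = x *m s.

Lemma comm1 : comm 1%:M.
Proof. by move=> s _; rewrite mulmx1 mul1mx. Qed.

Lemma commD x y : comm x -> comm y -> comm (x + y).
Proof. by move=> cx cy s sS; rewrite mulmxDr mulmxDl cx ?cy. Qed.

Lemma commN x : comm x -> comm (- x).
Proof. by move=> cx s sS; rewrite mulmxN mulNmx cx. Qed.

Lemma commZ a x : comm x -> comm (a *: x).
Proof. by move=> cx s sS; rewrite -scalemxAr -scalemxAl cx. Qed.

Lemma commM x y : comm x -> comm y -> comm (x *m y).
Proof. by move=> cx cy s sS; rewrite mulmxA cx // -!mulmxA cy. Qed.

Lemma comm_adj x : (forall s, s \in S -> s^t* \in S) -> comm x -> comm (x^t*).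
Proof.
move=> Sa cx s sS; rewrite -[s]trmxCK -!adjmxM; congr (_ ^t*).
by rewrite cx ?Sa.
Qed.

End Commutant.

Section MultiplicityFree.
Variables (R : realType) (d : nat) (S : {vspace 'M[R[i]]_d}).
Local Notation C := R[i].
Hypotheses (Sg : nc_graph S) (Sirr : acts_irreducibly S).

(* Projections in the commutant are central: a partial isometry v of the
   commutant with v v^* = g and v g = 0 would recover S from its restriction to
   the range of 1 - g. *)
Lemma commutant_proj_central (f z : 'M[C]_d) : f^t* = f -> f *m f = f ->
  comm S f -> comm S z -> (1%:M - f) *m z *m f = 0.
Proof.
move=> fh ff cf cz; have [_ Sa] := Sg.
pose w := (1%:M - f) *m z *m f.
have cw : comm S w.
  apply: commM => //; apply: commM => //; apply: commD; first exact: comm1.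
  exact: commN.
have fw : f *m w = 0.
  by rewrite /w !mulmxA mulmxBr mulmx1 ff subrr !mul0mx.
have wf : w *m f = w by rewrite /w -mulmxA ff.
rewrite -/w; clearbody w; apply: contrapT => /eqP w0.
have Q0 : w *m w^t* != 0.
  apply: contra w0 => /eqP Q0; apply/eqP.
  rewrite -[w]trmxCK (@gram_eq0 _ _ _ (w^t*)) ?adjmx0 //.
  by rewrite trmxCK.
have QE : w *m w^t* = \sum_(i < 1) w *m w^t* by rewrite big_ord1.
have [l [g [l0 g0 gh gg [Qg gcomm]]]] := eigen_proj QE Q0.
have cg : comm S g.
  move=> s sS; apply: gcomm; rewrite mulmxA cw // -[LHS]mulmxA -[RHS]mulmxA.
  by rewrite (comm_adj Sa cw).
(* Since $gww^*g=lg$, dividing by $\sqrt l$ gives $vv^*=g$. *)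
pose c := (sqrtC l)^-1.
have creal : c^* = c by rewrite conj_Creal // realV ger0_real // sqrtC_ge0 ltW.
have c2 : c * c = l^-1 by rewrite /c -invfM -expr2 sqrtCK.
pose v := c *: (g *m w).
have cv : comm S v by apply/commZ/commM.
have fg : f *m g = 0.
  have : l *: (f *m g) = 0 by rewrite scalemxAr -Qg !mulmxA fw !mul0mx.
  by move/eqP; rewrite scaler_eq0 gt_eqF //= => /eqP.
have vg : v *m g = 0.
  by rewrite -scalemxAl -wf -!mulmxA fg !mulmx0 scaler0.
have vv : v *m v^t* = g.
  rewrite /v adjmxZ creal adjmxM gh -scalemxAl -scalemxAr scalerA c2.
  rewrite mulmxA -(mulmxA g) -mulmxA Qg -scalemxAr gg scalerA mulVf ?scale1r //.
  by rewrite gt_eqF.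
pose p := 1%:M - g.
have ph : p^t* = p by rewrite adjmxB adjmx1 gh.
have pp : p *m p = p by rewrite /p mulmxBr mulmx1 mulmxBl mul1mx gg subrr subr0.
have cp : comm S p by apply: commD; [exact: comm1|exact: commN].
have p1 : p = 1%:M.
  (* The Kraus operator $1$ keeps $sp=psp$, and $v^*$ recovers $sg=v(psp)v^*$. *)
  apply: (irreducible_proj (K := fun b : bool => if b then 1%:M else v^t*)
    Sg Sirr ph pp cp) => s sS.
  have sp : p *m s *m p = s *m p by rewrite -cp // -mulmxA pp.
  rewrite sp big_bool /= adjmx1 mul1mx mulmx1 trmxCK.
  have vp : v *m p = v by rewrite mulmxBr mulmx1 vg subr0.
  have -> : v *m (s *m p) *m v^t* = s *m g.
    rewrite cp // mulmxA vp -cv // -mulmxA vv //.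
  by rewrite mulmxBr mulmx1 subrK.
move: g0; rewrite -(subKr 1%:M g) -/p p1 subrr eqxx //.
Qed.

End MultiplicityFree.

(** In $\sum_i(X_i-Y_i)^*(X_i-Y_i)$ all four sums equal $P$ and cancel. This turns identities
    between pairings into identities between single Kraus operators. *)
Lemma gram_eq (C : numClosedFieldType) p q (I : finType)
    (X Y : I -> 'M[C]_(p, q)) (P : 'M[C]_q) :
  \sum_i (X i)^t* *m X i = P -> \sum_i (X i)^t* *m Y i = P ->
  \sum_i (Y i)^t* *m Y i = P -> forall i, X i = Y i.
Proof.
move=> XX XY YY i; apply/eqP; rewrite -subr_eq0; apply/eqP.
apply: (sum_gram_eq0 (X := fun i => X i - Y i)).
have YX : \sum_i (Y i)^t* *m X i = P.
  have Ph : P^t* = P.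
    rewrite -XX adjmx_sum; apply: eq_bigr => j _.
    by rewrite adjmxM trmxCK.
  rewrite -Ph -XY adjmx_sum; apply: eq_bigr => j _.
  by rewrite adjmxM trmxCK.
under eq_bigr do rewrite adjmxB mulmxBr !mulmxBl.
by rewrite !sumrB XX XY YX YY !subrr.
Qed.

(** * Pairings *)

Section Pairing.
Variables (R : realType) (d d' : nat).
Local Notation C := R[i].
Variables (V : Type) (I L : finType).
Variables (mu : I -> V -> 'M[C]_(d', d)) (nu : L -> V -> 'M[C]_(d', d)).

Definition pairS u (t : 'M[C]_d') v : 'M[C]_d :=
  \sum_i (mu i u)^t* *m t *m mu i v.
Definition pairT u (s : 'M[C]_d) v : 'M[C]_d' :=
  \sum_l nu l u *m s *m (nu l v)^t*.

Local Notation A := pairS.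
Local Notation B := pairT.

Lemma pairS_adj u t v : (A u t v)^t* = A v (t^t*) u.
Proof.
rewrite adjmx_sum; apply: eq_bigr => i _.
by rewrite !adjmxM trmxCK mulmxA.
Qed.

Lemma pairT_adj u s v : (B u s v)^t* = B v (s^t*) u.
Proof.
rewrite adjmx_sum; apply: eq_bigr => i _.
by rewrite !adjmxM trmxCK mulmxA.
Qed.

Lemma pairS_gram u v (x y : 'M[C]_d) :
  \sum_i (mu i u *m x)^t* *m (mu i v *m y) = x^t* *m A u 1%:M v *m y.
Proof.
rewrite mulmx_sumr mulmx_suml; apply: eq_bigr => i _.
by rewrite adjmxM mulmx1 !mulmxA.
Qed.

Lemma pairS_gramr u v (y : 'M[C]_d) : \sum_i (mu i u)^t* *m (mu i v *m y) = A u 1%:M v *m y.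
Proof.
by rewrite mulmx_suml; apply: eq_bigr => i _; rewrite mulmx1 mulmxA.
Qed.

Lemma pairS_graml u v (t : 'M[C]_d') : \sum_i (mu i u)^t* *m (t *m mu i v) = A u t v.
Proof. by apply: eq_bigr => i _; rewrite mulmxA. Qed.

Lemma pairT_gram u v (x y : 'M[C]_d') :
  \sum_l (x *m nu l u) *m (y *m nu l v)^t* = x *m B u 1%:M v *m y^t*.
Proof.
rewrite mulmx_sumr mulmx_suml; apply: eq_bigr => l _.
by rewrite adjmxM mulmx1 !mulmxA.
Qed.

Lemma pairT_gramr u v (y : 'M[C]_d') : \sum_l nu l u *m (y *m nu l v)^t* = B u 1%:M v *m y^t*.
Proof.
by rewrite mulmx_suml; apply: eq_bigr => l _; rewrite adjmxM mulmx1 mulmxA.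
Qed.

Lemma pairT_graml u v (s : 'M[C]_d) : \sum_l nu l u *m (nu l v *m s)^t* = B u (s^t*) v.
Proof. by apply: eq_bigr => l _; rewrite adjmxM mulmxA. Qed.

(** For fixed $(i,l)$ the sums over $j$ and $k$ factor. Hence, when [a] is [e] and [b] is [c], the
    composite of the two pairings is again in Kraus form. *)
Lemma pairST_sum (J : finType) (a b c e : J -> V) s :
  \sum_j \sum_k A (a j) (B (b j) s (c k)) (e k) =
  \sum_(il : I * L) (\sum_j (nu il.2 (b j))^t* *m mu il.1 (a j))^t* *m s *m
     (\sum_k (nu il.2 (c k))^t* *m mu il.1 (e k)).
Proof.
transitivity (\sum_j \sum_k \sum_(il : I * L)
    ((nu il.2 (b j))^t* *m mu il.1 (a j))^t* *m s *m
     ((nu il.2 (c k))^t* *m mu il.1 (e k))).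
  apply: eq_bigr => j _; apply: eq_bigr => k _.
  rewrite -(pair_bigA _ (fun i l => ((nu l (b j))^t* *m mu i (a j))^t* *m s *m
     ((nu l (c k))^t* *m mu i (e k)))) /=.
  apply: eq_bigr => i _; rewrite mulmx_sumr mulmx_suml.
  by apply: eq_bigr => l _; rewrite adjmxM trmxCK !mulmxA.
under eq_bigr do rewrite exchange_big.
rewrite exchange_big; apply: eq_bigr => il _ /=.
rewrite adjmx_sum mulmx_suml mulmx_suml; apply: eq_bigr => j _.
by rewrite mulmx_sumr.
Qed.

Lemma pairTS_sum (J : finType) (a b c e : J -> V) t :
  \sum_j \sum_k B (a j) (A (b j) t (c k)) (e k) =
  \sum_(il : I * L) (\sum_j mu il.1 (b j) *m (nu il.2 (a j))^t*)^t* *m t *m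
     (\sum_k mu il.1 (c k) *m (nu il.2 (e k))^t*).
Proof.
transitivity (\sum_j \sum_k \sum_(il : I * L)
    (mu il.1 (b j) *m (nu il.2 (a j))^t*)^t* *m t *m
     (mu il.1 (c k) *m (nu il.2 (e k))^t*)).
  apply: eq_bigr => j _; apply: eq_bigr => k _.
  rewrite -(pair_bigA _ (fun i l => (mu i (b j) *m (nu l (a j))^t*)^t* *m t *m
     (mu i (c k) *m (nu l (e k))^t*))) exchange_big /=.
  apply: eq_bigr => l _; rewrite mulmx_sumr mulmx_suml.
  by apply: eq_bigr => i _; rewrite adjmxM trmxCK !mulmxA.
under eq_bigr do rewrite exchange_big.
rewrite exchange_big; apply: eq_bigr => il _ /=.
rewrite adjmx_sum mulmx_suml mulmx_suml; apply: eq_bigr => j _.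
by rewrite mulmx_sumr.
Qed.

End Pairing.

(* Here V stands for a TRO M with product tp a b c = a b^* c; pairS u t v and
   pairT u s v stand for u^* t v and u s v^*, transported to S and T, and
   1 = sum_j m'_j^* n'_j = sum_j m_j n_j^*. *)
Section Equivalence.
Variables (R : realType) (d d' : nat).
Local Notation C := R[i].
Variables (S : {vspace 'M[C]_d}) (T : {vspace 'M[C]_d'}).
Hypotheses (Sg : nc_graph S) (Tg : nc_graph T).
Hypotheses (Sirr : acts_irreducibly S) (Tirr : acts_irreducibly T).
Variables (V : Type) (tp : V -> V -> V -> V) (I L J K : finType).
Variables (mu : I -> V -> 'M[C]_(d', d)) (nu : L -> V -> 'M[C]_(d', d)).
Variables (m n : J -> V) (m' n' : K -> V).

Local Notation A := (pairS mu).
Local Notation B := (pairT nu).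

Hypothesis AS : forall u t v, t \in T -> A u t v \in S.
Hypothesis BT : forall u s v, s \in S -> B u s v \in T.
Hypothesis idS : forall s, s \in S ->
  \sum_j \sum_k A (n' j) (B (m' j) s (m' k)) (n' k) = s.
Hypothesis idT : forall t, t \in T ->
  \sum_j \sum_k B (m j) (A (n j) t (n k)) (m k) = t.
Hypothesis unitS : \sum_j A (m' j) 1%:M (n' j) = 1%:M.
Hypothesis unitT : \sum_j B (m j) 1%:M (n j) = 1%:M.
(** The product $(x^*ta)(b^*c)$ cannot be taken in [S], as the embedding is not multiplicative.
    Inserting the expansion of $1$ rewrites it as an iterated pairing, which stays in [S]; likewise
    for the next three hypotheses. *)
Hypothesis tpS : forall x t a b c, t \in T -> A x t (tp a b c) =
  \sum_j \sum_k A (n' j) (B (m' j) (A x t a) (m' k)) (tp (n' k) b c).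
Hypothesis tpS1 : forall b c, A b 1%:M c =
  \sum_j \sum_k A (n' j) (B (m' j) 1%:M (m' k)) (tp (n' k) b c).
Hypothesis tpT : forall a b c s x, s \in S -> B (tp a b c) s x =
  \sum_j \sum_k B (tp a b (m j)) (A (n j) (B c s x) (n k)) (m k).
Hypothesis tpT1 : forall a b, B a 1%:M b =
  \sum_j \sum_k B (tp a b (m j)) (A (n j) 1%:M (n k)) (m k).
Hypothesis AB : forall x a b c, A x (B a 1%:M b) c = A x 1%:M (tp a b c).
Hypothesis BA : forall a b c x, B a (A b 1%:M c) x = B (tp a b c) 1%:M x.

Let S1 : 1%:M \in S := proj1 Sg.
Let Sa : forall s, s \in S -> s^t* \in S := proj2 Sg.
Let T1 : 1%:M \in T := proj1 Tg.
Let Ta : forall s, s \in T -> s^t* \in T := proj2 Tg.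

(** [X] and [Z] are the Kraus operators of the composites through the other system, as read off from
    [pairST_sum] and [pairTS_sum]. *)
Let X (il : I * L) : 'M[C]_d := \sum_j (nu il.2 (m' j))^t* *m mu il.1 (n' j).
Let Z (il : I * L) : 'M[C]_d' := \sum_j mu il.1 (n j) *m (nu il.2 (m j))^t*.

Let XS s : s \in S -> \sum_il (X il)^t* *m s *m X il = s.
Proof. by move=> sS; rewrite -[RHS](idS sS) pairST_sum. Qed.

Let ZT t : t \in T -> \sum_il (Z il)^t* *m t *m Z il = t.
Proof. by move=> tT; rewrite -[RHS](idT tT) pairTS_sum. Qed.

Let X_comm il : comm S (X il).
Proof. by move=> s sS; rewrite (kraus_fixed_comm Sg Sirr XS). Qed.

Let Z_comm il : comm T (Z il).
Proof. by move=> s sS; rewrite (kraus_fixed_comm Tg Tirr ZT). Qed.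

(** [tpS] and [tpS1] write both pairings through the [X il]. As $X^*$ commutes with
    $A(x,t,a)\in\mathcal S$, that factor can be pulled out, which recovers the missing product in
    matrices. *)
Let tpA x t a b c : t \in T -> A x t (tp a b c) = A x t a *m A b 1%:M c.
Proof.
move=> tT; rewrite tpS // (tpS1 b c) !pairST_sum mulmx_sumr.
apply: eq_bigr => il _; rewrite mulmx1 !mulmxA; congr (_ *m _).
by rewrite (comm_adj Sa (X_comm il)) // AS.
Qed.

Let tpA' x t a b c : t \in T -> A (tp a b c) t x = A c 1%:M b *m A a t x.
Proof.
move=> tT; rewrite -[LHS]trmxCK pairS_adj tpA ?Ta // adjmxM !pairS_adj.
by rewrite trmxCK adjmx1.
Qed.

Let tpB x s a b c : s \in S -> B (tp a b c) s x = B a 1%:M b *m B c s x.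
Proof.
move=> sS; rewrite tpT // (tpT1 a b) !pairTS_sum mulmx_suml.
apply: eq_bigr => il _; rewrite mulmx1 -!mulmxA; congr (_ *m _).
by rewrite Z_comm // BT.
Qed.

Let tpB' x s a b c : s \in S -> B x s (tp a b c) = B x s c *m B b 1%:M a.
Proof.
move=> sS; rewrite -[LHS]trmxCK pairT_adj tpB ?Sa // adjmxM !pairT_adj.
by rewrite trmxCK adjmx1.
Qed.

Let BA' a b c x : B x (A c 1%:M b) a = B x 1%:M (tp a b c).
Proof. by rewrite -[LHS]trmxCK pairT_adj pairS_adj adjmx1 BA pairT_adj adjmx1. Qed.

(** Multiplicativity of the pairing makes the three sums of [gram_eq] equal, so it passes to each
    [mu i]. The next three product rules rest on the same comparison. *)
Let mu_tpr i a b c : mu i (tp a b c) = mu i a *m A b 1%:M c.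
Proof.
move: i; apply: (@gram_eq _ _ _ _ _ _ (A (tp a b c) 1%:M (tp a b c))).
- by apply: eq_bigr => i _; rewrite mulmx1.
- by rewrite pairS_gramr -tpA.
- by rewrite pairS_gram -mulmxA -tpA // pairS_adj adjmx1 -tpA'.
Qed.

Let mu_tpl i a b c : mu i (tp a b c) = B a 1%:M b *m mu i c.
Proof.
move: i; apply: (@gram_eq _ _ _ _ _ _ (A (tp a b c) 1%:M (tp a b c))).
- by apply: eq_bigr => i _; rewrite mulmx1.
- by rewrite pairS_graml AB.
- transitivity (A c (B (tp b a a) 1%:M b) c).
    apply: eq_bigr => i _; rewrite tpB // adjmxM pairT_adj adjmx1.
    by rewrite !mulmxA.
  by rewrite AB !tpA // !tpA'.
Qed.

Let nu_tpl l a b c : nu l (tp a b c) = B a 1%:M b *m nu l c.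
Proof.
rewrite -[LHS]trmxCK -[RHS]trmxCK; congr (_ ^t*); move: l.
apply: (@gram_eq _ _ _ _ _ _ (B (tp a b c) 1%:M (tp a b c))).
- by apply: eq_bigr => l _; rewrite trmxCK mulmx1.
- under eq_bigr do rewrite trmxCK.
  by rewrite pairT_gramr pairT_adj adjmx1 -tpB'.
- under eq_bigr do rewrite trmxCK.
  by rewrite pairT_gram pairT_adj adjmx1 -mulmxA -tpB' // -tpB.
Qed.

Let nu_tpr l a b c : nu l (tp a b c) = nu l a *m A b 1%:M c.
Proof.
rewrite -[LHS]trmxCK -[RHS]trmxCK; congr (_ ^t*); move: l.
apply: (@gram_eq _ _ _ _ _ _ (B (tp a b c) 1%:M (tp a b c))).
- by apply: eq_bigr => l _; rewrite trmxCK mulmx1.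
- under eq_bigr do rewrite trmxCK.
  by rewrite pairT_graml pairS_adj adjmx1 BA'.
- under eq_bigr do rewrite trmxCK adjmxM -mulmxA (mulmxA (A b _ c)).
  rewrite pairS_adj adjmx1 -tpA //.
  transitivity (B a (A b 1%:M (tp c c b)) a).
    by apply: eq_bigr => l _; rewrite mulmxA.
  by rewrite BA !tpB // !tpB'.
Qed.

(** Insert [unitS] to the right of [mu i c] and shift factors by the four product rules; what
    remains beside the pairing is [X (i, l)], free of $b$ and $c$. *)
Let nu_mu l i b c : (nu l b)^t* *m mu i c = A b 1%:M c *m X (i, l).
Proof.
rewrite /X mulmx_sumr -[in LHS](mulmx1 (mu i c)) -unitS !mulmx_sumr.
apply: eq_bigr => j _ /=; rewrite [RHS]mulmxA.
transitivity ((nu l (tp (m' j) c b))^t* *m mu i (n' j)); last first.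
  by rewrite nu_tpr adjmxM pairS_adj adjmx1.
by rewrite nu_tpl adjmxM pairT_adj adjmx1 -mulmxA -mu_tpl mu_tpr.
Qed.

Definition intertwiner (xi : V -> 'M[C]_(d', d)) :=
  forall a b c s, s \in S -> B a s b *m xi c = xi a *m s *m A b 1%:M c.

(** After [nu_mu], the factor $X_{il}$ commutes past $s$ and $A(b,1,c)$, and
    $\sum_l\nu_l(a)X_{il}=\mu_i(a)$. *)
Lemma intertwiner_mu i : intertwiner (mu i).
Proof.
move=> a b c s sS; rewrite mulmx_suml.
transitivity (\sum_l nu l a *m X (i, l) *m (s *m A b 1%:M c)).
  apply: eq_bigr => l _; rewrite -!mulmxA nu_mu; congr (_ *m _).
  by rewrite X_comm ?AS // !mulmxA X_comm.
rewrite -mulmx_suml -mulmxA; congr (_ *m _).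
rewrite -[RHS]mulmx1 -unitS mulmx_sumr.
under [LHS]eq_bigr do rewrite /X mulmx_sumr.
rewrite exchange_big; apply: eq_bigr => j _ /=.
rewrite -mu_tpr mu_tpl mulmx_suml; apply: eq_bigr => l _.
by rewrite mulmx1 mulmxA.
Qed.

Lemma intertwinerD xi zeta :
  intertwiner xi -> intertwiner zeta -> intertwiner (fun v => xi v + zeta v).
Proof.
by move=> hx hz a b c s sS; rewrite mulmxDr hx // hz // !mulmxDl.
Qed.

Lemma intertwinerM x xi :
  comm T x -> intertwiner xi -> intertwiner (fun v => x *m xi v).
Proof.
move=> cx hx a b c s sS.
by rewrite mulmxA cx ?BT // -mulmxA hx // !mulmxA.
Qed.

(** A coupling of intertwiners with values in the commutant of [T]. By [cplE] and [unitT], the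
    coupling of [xi] with itself is $1$ exactly when $B(a,s,b)=\xi(a)s\xi(b)^*$. *)
Definition cpl (xi zeta : V -> 'M[C]_(d', d)) :=
  \sum_j xi (m j) *m (zeta (n j))^t*.

Let unitT' : \sum_j B (n j) 1%:M (m j) = 1%:M.
Proof.
rewrite -[RHS]adjmx1 -unitT adjmx_sum; apply: eq_bigr => j _.
by rewrite pairT_adj adjmx1.
Qed.

Lemma cplE xi zeta a b s : intertwiner xi -> intertwiner zeta -> s \in S ->
  B a s b *m cpl xi zeta = xi a *m s *m (zeta b)^t*.
Proof.
move=> hx hz sS; rewrite mulmx_sumr.
transitivity (\sum_j xi a *m s *m (zeta b)^t* *m B (m j) 1%:M (n j)).
  apply: eq_bigr => j _; rewrite mulmxA hx // -!mulmxA.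
  do 2!congr (_ *m _); rewrite -[LHS]trmxCK -[RHS]trmxCK; congr (_ ^t*).
  by rewrite !adjmxM !trmxCK pairS_adj pairT_adj !adjmx1 hz // mulmx1.
by rewrite -mulmx_sumr unitT mulmx1.
Qed.

Lemma cpl_adj xi zeta : intertwiner xi -> intertwiner zeta ->
  (cpl xi zeta)^t* = cpl zeta xi.
Proof.
move=> hx hz; rewrite -[RHS]mul1mx -unitT' mulmx_suml adjmx_sum.
apply: eq_bigr => j _; rewrite cplE // mulmx1 adjmxM trmxCK //.
Qed.

Lemma cpl_comm xi zeta : intertwiner xi -> intertwiner zeta ->
  comm T (cpl xi zeta).
Proof.
move=> hx hz t tT; rewrite -(idT tT) mulmx_suml mulmx_sumr.
apply: eq_bigr => j _; rewrite mulmx_suml mulmx_sumr; apply: eq_bigr => k _.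
have AtS := AS (n j) (n k) tT.
rewrite cplE // -[RHS]trmxCK adjmxM cpl_adj // pairT_adj cplE // ?Sa //.
by rewrite !adjmxM !trmxCK mulmxA.
Qed.

Lemma cpl_eq0 xi : intertwiner xi -> cpl xi xi = 0 -> forall a, xi a = 0.
Proof.
move=> hx c0 a; rewrite -[LHS]trmxCK (@gram_eq0 _ _ _ ((xi a)^t*)) ?adjmx0 //.
have := cplE a a hx hx S1; rewrite c0 mulmx0 mulmx1 trmxCK => <- //.
Qed.

(** Inserting [idT] at $t=1$ exhibits the coupling as a sum of squares, the form that [eigen_proj]
    takes. *)
Lemma cpl_gram xi : intertwiner xi ->
  cpl xi xi = \sum_i (\sum_j xi (m j) *m (mu i (n j))^t*) *m
     (\sum_j xi (m j) *m (mu i (n j))^t*)^t*.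
Proof.
move=> hx; rewrite -[LHS]mul1mx -[1%:M](idT T1) mulmx_suml.
under [RHS]eq_bigr do rewrite mulmx_suml.
rewrite [RHS]exchange_big; apply: eq_bigr => j _ /=.
rewrite mulmx_suml; under [RHS]eq_bigr do rewrite adjmx_sum mulmx_sumr.
rewrite [RHS]exchange_big; apply: eq_bigr => k _ /=.
rewrite cplE ?AS // mulmx_sumr mulmx_suml; apply: eq_bigr => i _.
by rewrite adjmxM trmxCK mulmx1 !mulmxA.
Qed.

Lemma cplDl xi1 xi2 zeta :
  cpl (fun v => xi1 v + xi2 v) zeta = cpl xi1 zeta + cpl xi2 zeta.
Proof. by rewrite -big_split; apply: eq_bigr => j _; rewrite mulmxDl. Qed.

Lemma cplDr xi zeta1 zeta2 :
  cpl xi (fun v => zeta1 v + zeta2 v) = cpl xi zeta1 + cpl xi zeta2.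
Proof.
by rewrite -big_split; apply: eq_bigr => j _; rewrite adjmxD mulmxDr.
Qed.

Lemma cplM x y xi zeta :
  cpl (fun v => x *m xi v) (fun v => y *m zeta v) = x *m cpl xi zeta *m y^t*.
Proof.
rewrite mulmx_sumr mulmx_suml; apply: eq_bigr => j _.
by rewrite adjmxM !mulmxA.
Qed.

(** The zero map is an intertwiner and ranks are at most $d'$, so a maximum exists. *)
Lemma cpl_max : exists xi, [/\ intertwiner xi, cpl xi xi *m cpl xi xi = cpl xi xi &
  forall zeta, intertwiner zeta -> cpl zeta zeta *m cpl zeta zeta = cpl zeta zeta ->
    (\rank (cpl zeta zeta) <= \rank (cpl xi xi))%N].
Proof.
pose P k := `[< exists xi, [/\ intertwiner xi,
  cpl xi xi *m cpl xi xi = cpl xi xi & \rank (cpl xi xi) = k] >].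
have P0 : exists k, P k.
  exists (\rank (0 : 'M[C]_d')); apply/asboolP; exists (fun _ => 0).
  have -> : cpl (fun _ => 0) (fun _ => 0) = 0.
    by apply: big1 => j _; rewrite mul0mx.
  by split=> //; [move=> a b c s sS; rewrite mulmx0 !mul0mx|rewrite mulmx0].
have Pmax k : P k -> (k <= d')%N.
  by move=> /asboolP[xi [_ _ <-]]; exact: rank_leq_row.
case: (ex_maxnP P0 Pmax) => k /asboolP[xi [hx xx <-]] kmax.
exists xi; split=> // zeta hz zz; apply: kmax; apply/asboolP.
by exists zeta.
Qed.

(** If $(1-f)\zeta\neq0$ for some intertwiner, an eigenprojection $g$ of its coupling yields, after
    rescaling, an intertwiner with coupling $g\perp f$; adding it to [xi] gives the projection $f+g$
    of larger rank. Hence every [mu i], and so every [Z il], lies under $f$, and [T] is rebuilt from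
    its compression by $f$. *)
Lemma cpl_eq1 : exists2 xi, intertwiner xi & cpl xi xi = 1%:M.
Proof.
have [xi0 [hx0 ff fmax]] := cpl_max.
set f := cpl xi0 xi0 in ff fmax.
have fh : f^t* = f by exact: cpl_adj.
have cf : comm T f by exact: cpl_comm.
pose xi v := f *m xi0 v.
have hx : intertwiner xi by exact: intertwinerM.
have xif : cpl xi xi = f by rewrite cplM -/f fh !ff.
pose f' := 1%:M - f.
have f'h : f'^t* = f' by rewrite adjmxB adjmx1 fh.
have ff' : f *m f' = 0 by rewrite mulmxBr mulmx1 ff subrr.
have cf' : comm T f' by apply: commD; [exact: comm1|exact: commN].
have kill zeta a : intertwiner zeta -> f' *m zeta a = 0.
  move=> hz; pose zeta' v := f' *m zeta v.
  have hz' : intertwiner zeta' by exact: intertwinerM.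
  apply: (cpl_eq0 hz'); apply: contrapT => /eqP Q0.
  have [l [g [l0 g0 gh gg [Qg gcomm]]]] := eigen_proj (cpl_gram hz') Q0.
  have cQ := cpl_comm hz' hz'.
  have cg : comm T g by move=> t tT; apply: gcomm; exact: cQ.
  have fQ : f *m cpl zeta' zeta' = 0 by rewrite cplM !mulmxA ff' !mul0mx.
  have fg : f *m g = 0.
    have : l *: (f *m g) = 0 by rewrite scalemxAr -Qg mulmxA fQ mul0mx.
    by move/eqP; rewrite scaler_eq0 gt_eqF //= => /eqP.
  have gf : g *m f = 0 by rewrite -gh -fh -adjmxM fg adjmx0.
  pose e := (sqrtC l)^-1.
  have ereal : e^* = e by rewrite conj_Creal // realV ger0_real // sqrtC_ge0 ltW.
  have e2 : e * e = l^-1 by rewrite /e -invfM -expr2 sqrtCK.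
  pose zeta'' v := (e *: g) *m zeta' v.
  have hz'' : intertwiner zeta'' by apply: intertwinerM => //; exact: commZ.
  have c22 : cpl zeta'' zeta'' = g.
    rewrite cplM adjmxZ ereal gh -scalemxAl -scalemxAl -scalemxAr scalerA e2.
    rewrite -mulmxA Qg -scalemxAr gg scalerA mulVf ?scale1r //.
    by rewrite gt_eqF.
  (* The cross term contains $(1-f)\,z\,f$ with $z$ in the commutant of [T], which vanishes because
     $f$ is central there. *)
  have c21 : cpl zeta'' xi = 0.
    have c0 : cpl zeta' xi0 = f' *m cpl zeta xi0.
      by rewrite mulmx_sumr; apply: eq_bigr => j _; rewrite mulmxA.
    rewrite cplM fh c0 -mulmxA.
    rewrite (commutant_proj_central Tg Tirr fh ff cf (cpl_comm hz hx0)).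
    by rewrite mulmx0.
  have c12 : cpl xi zeta'' = 0 by rewrite -(cpl_adj hz'' hx) c21 adjmx0.
  pose th v := xi v + zeta'' v.
  have hth : intertwiner th by exact: intertwinerD.
  have cth : cpl th th = f + g.
    by rewrite cplDl !cplDr xif c12 c21 c22 addr0 add0r.
  have thth : cpl th th *m cpl th th = cpl th th.
    by rewrite cth mulmxDr !mulmxDl ff gg fg gf addr0 add0r.
  have rk := fmax _ hth thth; rewrite cth in rk.
  have sub_f : (f <= (f + g)%R)%MS.
    by apply/submxP; exists f; rewrite mulmxDr ff fg addr0.
  have : ((f + g)%R <= f)%MS by rewrite -(geq_leqif (mxrank_leqif_sup sub_f)).
  have sub_g : (g <= (f + g)%R)%MS.
    by apply/submxP; exists g; rewrite mulmxDr gg gf add0r.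
  move/(submx_trans sub_g)/submxP => [D gD].
  by move: g0; rewrite -gf [in X in X *m _]gD -mulmxA ff -gD eqxx.
have fmu i a : f *m mu i a = mu i a.
  have := kill _ a (@intertwiner_mu i); rewrite mulmxBl mul1mx => /eqP.
  by rewrite subr_eq0 => /eqP.
exists xi => //; rewrite xif.
apply: (irreducible_proj (K := Z) Tg Tirr fh ff cf) => t tT.
have fZ il : f *m Z il = Z il.
  by rewrite mulmx_sumr; apply: eq_bigr => j _; rewrite mulmxA fmu.
rewrite -{1}(ZT tT); apply: eq_bigr => il _.
have Zf : (Z il)^t* *m f = (Z il)^t* by rewrite -[f in LHS]fh -adjmxM fZ.
by rewrite -!mulmxA fZ !mulmxA Zf.
Qed.

(* Compressing S to the initial space q of xi loses nothing, so q = 1 by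
   irreducibility of S. *)
Lemma tro_representation : exists xi : V -> 'M[C]_(d', d),
  [/\ forall a b c, xi a *m (xi b)^t* *m xi c = xi (tp a b c),
      forall a s b, s \in S -> xi a *m s *m (xi b)^t* \in T,
      forall a t b, t \in T -> (xi a)^t* *m t *m xi b \in S,
      \sum_k (xi (m' k))^t* *m xi (n' k) = 1%:M &
      \sum_j xi (m j) *m (xi (n j))^t* = 1%:M].
Proof.
have [xi hx c1] := cpl_eq1; exists xi.
have BE a s b : s \in S -> B a s b = xi a *m s *m (xi b)^t*.
  by move=> sS; rewrite -cplE // c1 mulmx1.
have [q qdef] : exists q, q = \sum_k (xi (m' k))^t* *m xi (n' k) by eexists.
have xsq a s : s \in S -> xi a *m s *m q = xi a *m s.
  move=> sS; rewrite qdef -[RHS]mulmx1 -unitS !mulmx_sumr; apply: eq_bigr => k _.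
  by rewrite mulmxA -BE // hx.
have xq a : xi a *m q = xi a by have := xsq a _ S1; rewrite mulmx1.
have qx b : q^t* *m (xi b)^t* = (xi b)^t* by rewrite -adjmxM xq.
have qaE : q^t* = \sum_k (xi (n' k))^t* *m xi (m' k).
  by rewrite qdef adjmx_sum; apply: eq_bigr => k _; rewrite adjmxM trmxCK.
have qaq : q^t* *m q = q^t*.
  rewrite [RHS]qaE {1}qaE mulmx_suml; apply: eq_bigr => k _.
  by rewrite -mulmxA xq.
have qh : q^t* = q by rewrite -[RHS]trmxCK -[in RHS]qaq adjmxM trmxCK qaq.
have qE : q = \sum_k (xi (n' k))^t* *m xi (m' k) by rewrite -{1}qh.
have qq : q *m q = q by rewrite -{1}qh qaq.
have qsq s : s \in S -> q *m s *m q = q *m s.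
  move=> sS; rewrite [in RHS]qE {1}qE !mulmx_suml; apply: eq_bigr => k _.
  by rewrite -!mulmxA (mulmxA (xi _)) xsq.
have cq : comm S q.
  move=> s sS; rewrite -(qsq _ sS) -[LHS]trmxCK adjmxM qh -(qsq _ (Sa sS)).
  by rewrite !adjmxM qh trmxCK mulmxA.
have q1 : q = 1%:M.
  (* These Kraus operators come from [idS] with the inner pairing replaced by
     $\xi(m'_j)s\xi(m'_k)^*$. *)
  apply: (irreducible_proj (K := fun i => \sum_k (xi (m' k))^t* *m mu i (n' k))
    Sg Sirr qh qq cq) => s sS.
  rewrite -[LHS](idS sS); under [RHS]eq_bigr do rewrite adjmx_sum !mulmx_suml.
  rewrite [RHS]exchange_big; apply: eq_bigr => j _ /=.
  under [RHS]eq_bigr do rewrite mulmx_sumr.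
  rewrite [RHS]exchange_big; apply: eq_bigr => k _ /=.
  apply: eq_bigr => i _; rewrite BE // adjmxM trmxCK.
  rewrite -[xi (m' j) in LHS]xq -[(xi (m' k))^t* in LHS]qx qh.
  by rewrite !mulmxA.
have Seq (Y : 'M[C]_d) : (forall a, xi a *m Y = 0) -> Y = 0.
  move=> Y0; rewrite -[Y]mul1mx -q1 qdef mulmx_suml big1 // => k _.
  by rewrite -mulmxA Y0 mulmx0.
have AE b c : A b 1%:M c = (xi b)^t* *m xi c.
  apply/eqP; rewrite -subr_eq0; apply/eqP/Seq => a.
  have := hx a b c _ S1; rewrite BE // !mulmx1 => e.
  by rewrite mulmxBr -e mulmxA subrr.
split; last exact: c1.
- move=> a b c; apply/eqP; rewrite -subr_eq0; apply/eqP.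
  rewrite -[LHS]mul1mx -c1 mulmx_suml big1 // => j _.
  rewrite -(mulmxA (xi (m j))).
  by rewrite mulmxBr -(AE _ (tp a b c)) tpA // !AE !mulmxA subrr mulmx0.
- by move=> a s b sS; rewrite -BE // BT.
- move=> a t b tT; rewrite -(idT tT) mulmx_sumr mulmx_suml.
  apply: rpred_sum => j _; rewrite mulmx_sumr mulmx_suml.
  apply: rpred_sum => k _; rewrite BE ?AS // !mulmxA -AE -!mulmxA -AE.
  by rewrite mulmxA -tpA' // -tpA // AS.
- by rewrite -qdef.
Qed.

End Equivalence.

(** * Hilbert space operators *)

Section InnerProduct.
Variables (R : realType) (H : hilbertType R).
Implicit Types (x y z : H) (a : R[i]).

Lemma innerDl x y z : inner (x + y) z = inner x z + inner y z.
Proof. exact: linearDl. Qed.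

Lemma innerDr x y z : inner z (x + y) = inner z x + inner z y.
Proof. exact: linearDr. Qed.

Lemma innerZl a x y : inner (a *: x) y = a * inner x y.
Proof. exact: linearZl_LR. Qed.

Lemma innerZr a x y : inner x (a *: y) = a^* * inner x y.
Proof. exact: linearZr_LR. Qed.

Lemma innerNl x y : inner (- x) y = - inner x y.
Proof. by rewrite -scaleN1r innerZl mulN1r. Qed.

Lemma inner0l y : inner 0 y = 0.
Proof. exact: linear0l. Qed.

Lemma inner_suml I r (P : pred I) (F : I -> H) y :
  inner (\sum_(i <- r | P i) F i) y = \sum_(i <- r | P i) inner (F i) y.
Proof. exact: linear_sumlz. Qed.

Lemma inner_sumr I r (P : pred I) (F : I -> H) y :
  inner y (\sum_(i <- r | P i) F i) = \sum_(i <- r | P i) inner y (F i).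
Proof. exact: linear_sumr. Qed.

Lemma innerC x y : (inner x y)^* = inner y x.
Proof. by rewrite [RHS]hermC expr0 mul1r. Qed.

Lemma inner_ge0 x : 0 <= inner x x.
Proof. exact: dnorm_ge0. Qed.

Lemma inner_eq0 x : inner x x = 0 -> x = 0.
Proof. by move/eqP; rewrite dnorm_eq0 => /eqP. Qed.

Lemma inner_extl x y : (forall z, inner x z = inner y z) -> x = y.
Proof.
move=> xy; apply/eqP; rewrite -subr_eq0; apply/eqP/inner_eq0.
by rewrite innerDl innerNl xy subrr.
Qed.

Lemma inner_norm_le x y : `|inner x y| <= `|x| * `|y|.
Proof.
have [->|y0] := eqVneq y 0.
  by rewrite -innerC inner0l conjC0 !normr0 mulr0.
rewrite -ler_sqr ?nnegrE ?mulr_ge0 // exprMn -!inner_normE normCK.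
have n0 : 0 < inner y y.
  rewrite lt_neqAle inner_ge0 andbT eq_sym.
  by apply: contra y0 => /eqP /inner_eq0 ->.
set n := inner y y in n0 *; set a := inner x y.
have nr : n^* = n by rewrite innerC.
rewrite -subr_ge0 -(pmulr_rge0 _ n0).
have := inner_ge0 (n *: x + (- a) *: y); congr (0 <= _).
rewrite !innerDl !innerDr !innerZl !innerZr -/n -[inner y x]innerC -/a.
by rewrite nr rmorphN /=; ring.
Qed.

End InnerProduct.

Section BoundedOperators.
Variable R : realType.
Implicit Types H K L : hilbertType R.

Lemma bounded_opP H K (f : H -> K) : bounded_op f <->
  linear f /\ exists2 k : R, 0 <= k & forall x, hnorm (f x) <= k * hnorm x.
Proof.
split=> [[fl fc]|[fl [k k0 fk]]]; split=> //.
  pose F : {linear H -> K} := HB.pack f (GRing.isLinear.Build _ _ _ _ _ fl).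
  have /linear_bounded_continuous/linear_boundedP : continuous F by [].
  move=> /pinfty_ex_gt0[r r0 Fr]; exists (complex.Re r).
    by rewrite -lecR RRe_real ?ltW // gtr0_real.
  move=> x; have := Fr x; rewrite /= !normE_hnorm.
  have {1}-> : r = ((complex.Re r)%:C)%C by rewrite RRe_real // gtr0_real.
  by rewrite -rmorphM lecR.
pose F : {linear H -> K} := HB.pack f (GRing.isLinear.Build _ _ _ _ _ fl).
apply: (@linear_bounded_continuous _ _ _ F).1; apply/linear_boundedP.
exists ((k%:C)%C); split; first by rewrite ger0_real // lecR.
move=> r kr x; rewrite /= !normE_hnorm.
apply: le_trans (_ : ((k * hnorm x)%:C)%C <= _); first by rewrite lecR.
by rewrite rmorphM; apply: ler_wpM2r; [rewrite lecR hnorm_ge0|exact: ltW].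
Qed.

Section Linear.
Context H K (f : H -> K) (fb : bounded_op f).

Lemma bopP a x y : f (a *: x + y) = a *: f x + f y.
Proof. by case: fb => fl _; exact: fl. Qed.

Lemma bop0 : f 0 = 0.
Proof. by have := bopP (-1) 0 0; rewrite scaler0 addr0 scaleN1r addNr. Qed.

Lemma bopD x y : f (x + y) = f x + f y.
Proof. by have := bopP 1 x y; rewrite !scale1r. Qed.

Lemma bopZ a x : f (a *: x) = a *: f x.
Proof. by have := bopP a x 0; rewrite bop0 !addr0. Qed.

Lemma bop_sum I r (P : pred I) (F : I -> H) :
  f (\sum_(i <- r | P i) F i) = \sum_(i <- r | P i) f (F i).
Proof. exact: (big_morph f bopD bop0). Qed.

Lemma opnorm_has_sup :
  has_sup [set hnorm (f x) | x in [set x | hnorm x <= 1]].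
Proof.
split; first by exists (hnorm (f 0)), 0 => //=; rewrite hnorm0.
have [_ [k k0 fk]] := (bounded_opP f).1 fb.
exists k => _ [x /= x1 <-]; apply: le_trans (fk x) _.
by rewrite -[leRHS]mulr1 ler_wpM2l.
Qed.

Lemma opnorm_ub x : hnorm (f x) <= opnorm f * hnorm x.
Proof.
have [x0|x0] := eqVneq (hnorm x) 0.
  by rewrite x0 mulr0 (hnorm_eq0 x0) bop0 hnorm0.
have xgt0 : 0 < hnorm x by rewrite lt_neqAle eq_sym x0 hnorm_ge0.
rewrite -ler_pdivrMr // mulrC.
have aE : complex.Re `|(((hnorm x)^-1)%:C)%C : R[i]| = (hnorm x)^-1.
  by rewrite normc_def /= expr0n addr0 sqrtr_sqr ger0_norm // invr_ge0 ltW.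
rewrite -aE -hnormZ -bopZ; apply: (ub_le_sup (proj2 opnorm_has_sup)).
by exists ((((hnorm x)^-1)%:C)%C *: x) => //=; rewrite hnormZ aE mulVf.
Qed.

End Linear.

Lemma bounded_op_comp H K L (f : K -> L) (g : H -> K) :
  bounded_op f -> bounded_op g -> bounded_op (f \o g).
Proof.
move=> [fl fc] [gl gc]; split; first by move=> a x y; rewrite /= gl fl.
by move=> x; apply: continuous_comp; [exact: gc|exact: fc].
Qed.

Lemma bounded_opZD H K (f g : H -> K) a :
  bounded_op f -> bounded_op g -> bounded_op (a *: f + g).
Proof.
move=> fb gb; apply/bounded_opP; split.
  move=> b x y; rewrite !fctE (bopP fb) (bopP gb) scalerDr scalerDr.
  by rewrite addrACA scalerA mulrC -scalerA.
have [_ [k k0 fk]] := (bounded_opP f).1 fb.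
have [_ [l l0 gl]] := (bounded_opP g).1 gb.
have a0 : 0 <= complex.Re `|a|.
  by rewrite -lecR RRe_real ?normr_real //; exact: normr_ge0.
exists (complex.Re `|a| * k + l); first by rewrite addr_ge0 // mulr_ge0.
move=> x; rewrite !fctE; apply: le_trans (hnormD _ _) _.
by rewrite hnormZ mulrDl lerD // -mulrA ler_wpM2l.
Qed.

Lemma bounded_op0 H K : bounded_op (0 : H -> K).
Proof.
have z x : (0 : H -> K) x = 0 by [].
apply/bounded_opP; split; first by move=> a x y; rewrite !z scaler0 addr0.
by exists 0 => // x; rewrite z mul0r hnorm0.
Qed.

Lemma bounded_op_id H : bounded_op (idfun : H -> H).
Proof. by split=> // x; exact: cvg_id. Qed.

Lemma bounded_opZ H K (f : H -> K) a : bounded_op f -> bounded_op (a *: f).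
Proof.
by move=> fb; have := bounded_opZD a fb (@bounded_op0 H K); rewrite addr0.
Qed.

Lemma bounded_op_sum H K I r (P : pred I) (F : I -> H -> K) :
  (forall i, P i -> bounded_op (F i)) -> bounded_op (\sum_(i <- r | P i) F i).
Proof.
move=> Fb; elim/big_rec: _ => [|i f Pi fb]; first exact: bounded_op0.
by have := bounded_opZD 1 (Fb i Pi) fb; rewrite scale1r.
Qed.

Lemma bounded_opB H K (f g : H -> K) :
  bounded_op f -> bounded_op g -> bounded_op (f \- g).
Proof.
move=> fb gb; have := bounded_opZD (-1) gb fb; rewrite scaleN1r addrC.
by congr bounded_op.
Qed.

Lemma is_adjoint_uniq H K (f : H -> K) g h : is_adjoint f g -> is_adjoint f h -> g = h.
Proof.
move=> fg fh; apply/funext => y; apply: inner_extl => z.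
by rewrite -[LHS]innerC -[RHS]innerC -fg -fh.
Qed.

Lemma is_adjoint_sym H K (f : H -> K) g : is_adjoint f g -> is_adjoint g f.
Proof. by move=> fg x y; rewrite -innerC -fg innerC. Qed.

Lemma is_adjoint_comp H K L (f : H -> K) f' (g : K -> L) g' :
  is_adjoint f f' -> is_adjoint g g' -> is_adjoint (g \o f) (f' \o g').
Proof. by move=> ff gg x y; rewrite /= gg ff. Qed.

End BoundedOperators.

(** * Closedness of finite-dimensional spaces of operators *)

Section FiniteDimensionalClosure.
Variable R : realType.
Local Notation C := R[i].

Lemma norm_le_eps_eq0 (z w : C) : 0 <= w ->
  (forall e : R, 0 < e -> `|z| <= (e%:C)%C * w) -> z = 0.
Proof.
move=> w0 zw; apply: (natmul_bounded_eq0 (b := w)) => -[|n].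
  by rewrite mulr0n normr0.
have n0 : (0 : R) < n.+1%:R^-1 by rewrite invr_gt0.
have := zw _ n0; rewrite fmorphV rmorph_nat ler_pdivlMl ?ltr0n //.
by rewrite normrMn mulr_natl.
Qed.

(* Finite-dimensional spaces of functions are closed under weighted uniform
   convergence: eliminate one spanning function by evaluating at a point where
   it does not vanish. *)
Lemma fin_span_closed (X : Type) n (e : 'I_n -> X -> C) (f w : X -> C) :
  (forall x, 0 <= w x) ->
  (forall eps : R, 0 < eps -> exists c : 'I_n -> C,
     forall x, `|f x - \sum_i c i * e i x| <= (eps%:C)%C * w x) ->
  exists c : 'I_n -> C, forall x, f x = \sum_i c i * e i x.
Proof.
elim: n => [|n IH] in e f w *.
  move=> w0 fe; exists (fun _ => 0) => x; rewrite big_ord0.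
  apply: (norm_le_eps_eq0 (w0 x)) => eps eps0.
  by have [c /(_ x)] := fe _ eps0; rewrite big_ord0 subr0.
move=> w0 fe; pose e0 i := e (widen_ord (leqnSn n) i).
have lw (i : 'I_n) : lift ord_max i = widen_ord (leqnSn n) i.
  by apply: val_inj; rewrite /= /bump leqNgt ltn_ord.
have [[x0 ex0]|en0] := pselect (exists x0, e ord_max x0 != 0); last first.
  have {}en0 x : e ord_max x = 0.
    by apply: contrapT => /eqP ex; apply: en0; exists x.
  have [|c cE] := IH e0 f w w0.
    move=> eps eps0; have [c cP] := fe _ eps0.
    exists (fun i => c (widen_ord (leqnSn n) i)) => x.
    by have := cP x; rewrite big_ord_recr /= en0 mulr0 addr0.
  exists (fun i => if unlift ord_max i is Some j then c j else 0) => x.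
  rewrite cE big_ord_recr /= en0 mulr0 addr0; apply: eq_bigr => i _.
  by rewrite /e0 -lw liftK.
pose q x := e ord_max x / e ord_max x0.
have qx0 : q x0 = 1 by rewrite /q mulfV.
have sumq c x : \sum_i c i * (e0 i x - e0 i x0 * q x) =
    \sum_i c i * e0 i x - (\sum_i c i * e0 i x0) * q x.
  by rewrite mulr_suml -sumrB; apply: eq_bigr => i _; ring.
(* Subtracting the multiple of [q] that matches the value at [x0] eliminates the last spanning
   function; the error made at [x0] is added to the weight. *)
have [||c cE] := IH (fun i x => e0 i x - e0 i x0 * q x)
    (fun x => f x - f x0 * q x) (fun x => w x + w x0 * `|q x|).
- by move=> x; rewrite addr_ge0 ?mulr_ge0.
- move=> eps eps0; have [c cP] := fe _ eps0.
  exists (fun i => c (widen_ord (leqnSn n) i)) => x.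
  have := cP x; have := cP x0; rewrite !big_ord_recr /= -/(e0 _ _).
  have -> : e ord_max x = e ord_max x0 * q x by rewrite /q mulrCA mulfV ?mulr1.
  rewrite sumq; set s := \sum_(i < n) _; set s0 := \sum_(i < n) _.
  set k := c ord_max; set ee := e ord_max x0 => h0 h.
  have -> : f x - f x0 * q x - (s0 - s * q x) =
      (f x - (s0 + k * (ee * q x))) - (f x0 - (s + k * ee)) * q x by ring.
  apply: le_trans (ler_normB _ _) _; rewrite mulrDr lerD //.
  by rewrite normrM mulrA ler_wpM2r.
exists (fun i => if unlift ord_max i is Some j then c j else
   (f x0 - \sum_j c j * e0 j x0) / e ord_max x0) => x.
rewrite big_ord_recr /= unlift_none.
under eq_bigr do rewrite -lw liftK.
have -> : \sum_(i < n) c i * e (lift ord_max i) x = \sum_i c i * e0 i x.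
  by apply: eq_bigr => i _; rewrite lw.
have := cE x; rewrite sumq => /(canRL (subrK _)) ->.
by rewrite /q; ring.
Qed.

(** An operator is read as the function $(x,y)\mapsto\langle fx,y\rangle$; closeness in operator
    norm becomes uniform closeness with weight $\|x\|\|y\|$. *)
Lemma norm_closure_fin_span (H K : hilbertType R) n (E : 'I_n -> H -> K)
    (A : set (H -> K)) (f : H -> K) :
  (forall i, bounded_op (E i)) ->
  (forall g, A g -> exists c : 'I_n -> C, g = \sum_i c i *: E i) ->
  norm_closure A f -> exists c : 'I_n -> C, f = \sum_i c i *: E i.
Proof.
move=> Eb AE [fb fA].
have comb (c : 'I_n -> C) (x : H) : (\sum_i c i *: E i) x = \sum_i c i *: E i x.
  by rewrite fct_sumE.
have [||c cE] := @fin_span_closed (H * K)%type n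
    (fun i xy => inner (E i xy.1) xy.2) (fun xy => inner (f xy.1) xy.2)
    (fun xy => `|xy.1| * `|xy.2|).
- by move=> xy; rewrite mulr_ge0.
- move=> eps eps0; have [g Ag fg] := fA _ eps0.
  have [c gE] := AE _ Ag; exists c => -[x y] /=.
  have gb : bounded_op g.
    by rewrite gE; apply: bounded_op_sum => i _; exact: bounded_opZ.
  have -> : inner (f x) y - \sum_i c i * inner (E i x) y = inner ((f \- g) x) y.
    rewrite /= innerDl innerNl; congr (_ - _).
    by rewrite gE comb inner_suml; apply: eq_bigr => i _; rewrite innerZl.
  apply: le_trans (inner_norm_le _ _) _; rewrite mulrA ler_wpM2r //.
  rewrite !normE_hnorm -rmorphM lecR.
  apply: le_trans (opnorm_ub (bounded_opB fb gb) x) _.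
  by rewrite ler_wpM2r ?hnorm_ge0 // ltW.
exists c; apply/funext => x; apply: inner_extl => y.
rewrite (cE (x, y)) /= comb inner_suml; apply: eq_bigr => i _.
by rewrite innerZl.
Qed.

End FiniteDimensionalClosure.

(** In a polynomial relation, injectivity of [b] cancels the lowest powers until the constant
    coefficient is nonzero; the relation is then solved for the identity. *)
Lemma iter_unit (C : fieldType) (H : lmodType C) (b : {linear H -> H})
    (N : nat) (c : nat -> C) :
  (forall x, b x = 0 -> x = 0) ->
  (exists2 k, (k < N)%N & c k != 0) ->
  (forall x, \sum_(k < N) c k *: iter k.+1 b x = 0) ->
  exists M (e : nat -> C), forall x, x = \sum_(k < M) e k *: iter k.+1 b x.
Proof.
move=> binj; elim: N => [|N IH] in c *; first by case.
case=> k kN ck cb.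
have {}cb x : c 0%N *: x + \sum_(i < N) c i.+1 *: iter i.+1 b x = 0.
  apply: binj; rewrite linearD linearZ linear_sum /= -[RHS](cb x) big_ord_recl.
  by congr (_ + _); apply: eq_bigr => i _; rewrite linearZ.
have [c0|c0] := eqVneq (c 0%N) 0.
  case: k => [|k] in kN ck *; first by rewrite c0 eqxx in ck.
  apply: (IH (fun i => c i.+1)); first by exists k.
  by move=> x; have := cb x; rewrite c0 scale0r add0r.
exists N, (fun i => - (c 0%N)^-1 * c i.+1) => x.
have /eqP := cb x; rewrite addr_eq0 => /eqP h.
rewrite -[LHS]scale1r -(mulVf c0) -scalerA h scalerN -scaleNr scaler_sumr.
by apply: eq_bigr => i _; rewrite scalerA.
Qed.

(** * Complete order embeddings of matrix systems *)

Section Representation.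
Variable R : realType.
Local Notation C := R[i].

(* A unital complete order embedding, seen as a map on matrices; positivity is
   stated for block matrices over an arbitrary finite index type. *)
Record op_rep d (S : {vspace 'M[C]_d}) (H : hilbertType R)
    (Phi : 'M[C]_d -> H -> H) : Prop := OpRep {
  rep_bounded : forall s, s \in S -> bounded_op (Phi s);
  rep_linear : forall a s t, s \in S -> t \in S ->
    Phi (a *: s + t) = a *: Phi s + Phi t;
  rep1 : Phi 1%:M = idfun;
  rep_pos : forall (J : finType) (F : J -> J -> 'M[C]_d),
    (forall j k, F j k \in S) ->
    (forall x : J -> 'cV[C]_d, 0 <= \sum_j \sum_k dotc (x j) (F j k *m x k)) <->
    (forall x : J -> H, 0 <= \sum_j \sum_k inner (Phi (F j k) (x k)) (x j)) }.

Lemma mxopP d a (s t : 'M[C]_d) : mxop (a *: s + t) = a *: mxop s + mxop t.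
Proof. by apply/funext => x; rewrite /mxop mulmxDl -scalemxAl. Qed.

Lemma ucoe_rep d (S : {vspace 'M[C]_d}) (H : hilbertType R)
    (phi : (euclid R d -> euclid R d) -> H -> H) :
  unital_complete_order_embedding (ops S) phi ->
  op_rep S (fun s => phi (mxop s)).
Proof.
case=> phib phil phi1 phipos.
have Sops s : s \in S -> ops S (mxop s) by exists s.
split.
- by move=> s /Sops; exact: phib.
- by move=> a s t /Sops sS /Sops tS; rewrite mxopP phil.
- by rewrite -[RHS]phi1; congr phi; apply/funext => x; rewrite /mxop mul1mx.
move=> J F FS; pose ev (p : 'I_#|J|) : J := enum_val p.
pose F' := \matrix_(p < #|J|, q < #|J|) mxop (F (ev p) (ev q)).
have F'S i j : ops S (F' i j) by rewrite mxE; exact: Sops.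
have sumJ (G : J -> C) : \sum_j G j = \sum_p G (ev p).
  by rewrite (reindex ev) //; exact/onW_bij/enum_val_bij.
have := phipos _ F' F'S; rewrite /mx_positive => -[h1 h2]; split=> Fpos x.
- have /h1 /(_ (x \o ev)) : forall y : 'I_#|J| -> euclid R d,
      0 <= \sum_i inner (mx_act F' y i) (y i).
    move=> y; have := Fpos (fun j => y (enum_rank j)).
    rewrite sumJ; congr (0 <= _); apply: eq_bigr => p _; rewrite sumJ.
    rewrite /mx_act inner_euclid -dotc_sumr; congr (dotc _ _).
      by rewrite enum_valK.
    by apply: eq_bigr => q _; rewrite mxE enum_valK.
  rewrite sumJ; congr (0 <= _); apply: eq_bigr => p _; rewrite sumJ.
  rewrite /mx_act inner_suml; apply: eq_bigr => q _.
  by rewrite !mxE.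
- have /h2 /(_ (x \o ev)) : forall y : 'I_#|J| -> H,
      0 <= \sum_i inner (mx_act (map_mx phi F') y i) (y i).
    move=> y; have := Fpos (fun j => y (enum_rank j)).
    rewrite sumJ; congr (0 <= _); apply: eq_bigr => p _; rewrite sumJ.
    rewrite /mx_act inner_suml; apply: eq_bigr => q _.
    by rewrite !mxE !enum_valK.
  rewrite sumJ; congr (0 <= _); apply: eq_bigr => p _; rewrite sumJ.
  rewrite /mx_act inner_euclid dotc_sumr; apply: eq_bigr => q _.
  by rewrite mxE.
Qed.

Section Facts.
Context d (S : {vspace 'M[C]_d}) (H : hilbertType R) (Phi : 'M[C]_d -> H -> H).
Hypothesis SPhi : op_rep S Phi.

Lemma repZD a s t x : s \in S -> t \in S ->
  Phi (a *: s + t) x = a *: Phi s x + Phi t x.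
Proof. by move=> sS tS; rewrite (rep_linear SPhi). Qed.

Lemma rep0 x : Phi 0 x = 0.
Proof.
have := repZD (-1) x (mem0v S) (mem0v S).
by rewrite scaler0 addr0 scaleN1r addNr.
Qed.

Lemma repZ a s x : s \in S -> Phi (a *: s) x = a *: Phi s x.
Proof. by move=> sS; have := repZD a x sS (mem0v S); rewrite rep0 !addr0. Qed.

Lemma repD s t x : s \in S -> t \in S -> Phi (s + t) x = Phi s x + Phi t x.
Proof. by move=> sS tS; have := repZD 1 x sS tS; rewrite !scale1r. Qed.

Lemma rep_sum (I : Type) (r : seq I) (s : I -> 'M[C]_d) x :
  (forall i, s i \in S) -> Phi (\sum_(i <- r) s i) x = \sum_(i <- r) Phi (s i) x.
Proof.
move=> sS; suff [] : (\sum_(i <- r) s i \in S) /\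
  (Phi (\sum_(i <- r) s i) x = \sum_(i <- r) Phi (s i) x) by [].
elim: r => [|i r [IH1 IH2]]; first by rewrite !big_nil rep0 mem0v.
by rewrite !big_cons repD // IH2 memvD.
Qed.

Lemma rep_psd s : s \in S -> (forall x, 0 <= inner (Phi s x) x) -> psd s.
Proof.
move=> sS s0; split=> u.
have := (rep_pos SPhi (F := fun _ _ : 'I_1 => s) _).2.
move=> /(_ (fun _ _ => sS)) h.
have : forall x : 'I_1 -> H, 0 <= \sum_(j < 1) \sum_(k < 1) inner (Phi s (x k)) (x j).
  by move=> x; rewrite !big_ord1.
by move=> /h /(_ (fun _ => u)); rewrite !big_ord1.
Qed.

(** If [Phi] kills $s-t$, it maps both $s-t$ and $t-s$ to positive operators, so both are positive.
    Operator identities descend to matrices in this way. *)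
Lemma rep_inj s t : s \in S -> t \in S -> (forall x, Phi s x = Phi t x) -> s = t.
Proof.
move=> sS tS st; have dS : s - t \in S by rewrite memvB.
have d0 x : Phi (s - t) x = 0.
  by rewrite addrC -scaleN1r repZD // st scaleN1r addNr.
apply/eqP; rewrite -subr_eq0; apply/eqP/psd_anti.
  by apply: rep_psd => // x; rewrite d0 inner0l.
apply: rep_psd => [|x]; first by rewrite memvN.
by rewrite -scaleN1r repZ // d0 scaler0 inner0l.
Qed.

(** The image of [S] is finite dimensional, so the norm closures in the definition of
    TRO-equivalence add nothing to it. *)
Lemma rep_range_closed f :
  norm_closure [set Phi s | s in [set` S]] f -> exists2 s, s \in S & Phi s = f.
Proof.
pose b i := (vbasis S)`_i.
have bS (i : 'I_(\dim S)) : b i \in S by rewrite vbasis_mem // mem_nth // size_tuple.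
have comb (c : 'I_(\dim S) -> C) :
    Phi (\sum_i c i *: b i) = \sum_i c i *: Phi (b i).
  apply/funext => x; rewrite rep_sum => [|i]; last by rewrite memvZ.
  by rewrite fct_sumE; apply: eq_bigr => i _; rewrite repZ.
move=> fcl.
have [||c ->] := norm_closure_fin_span (E := fun i : 'I_(\dim S) => Phi (b i)) _ _ fcl.
- by move=> i; exact: (rep_bounded SPhi).
- move=> g [s sS <-]; exists (fun i => coord (vbasis S) i s); rewrite -comb.
  by rewrite -coord_vbasis.
exists (\sum_i c i *: b i) => //.
by apply: rpred_sum => i _; rewrite memvZ.
Qed.

End Facts.
End Representation.

(** * Finite expansions of the identity in a TRO *)

Section Unit.
Variable R : realType.
Local Notation C := R[i].

Lemma rep_iter_unit d (S : {vspace 'M[C]_d}) (H : hilbertType R) Phi (b : H -> H) :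
  op_rep S Phi -> bounded_op b ->
  (forall k, exists2 s, s \in S & forall x, Phi s x = iter k.+1 b x) ->
  (forall x, b x = 0 -> x = 0) ->
  exists M (e : nat -> C), forall x, x = \sum_(k < M) e k *: iter k.+1 b x.
Proof.
move=> SPhi bb bS binj.
have /choice [s sP] : forall k, exists s, s \in S /\ forall x, Phi s x = iter k.+1 b x.
  by move=> k; have [s sS sb] := bS k; exists s.
pose N := (\dim {:'M[C]_d}).+1; pose X := [tuple s i | i < N].
have [c [cs [i0 ci0]]] : exists c : 'I_N -> C,
    \sum_i c i *: s i = 0 /\ exists i, c i != 0.
  apply: contrapT => H0; have : free X.
    apply/freeP => k k0 i; apply: contrapT => /eqP ki; apply: H0.
    exists k; split; last by exists i.
    by rewrite -[RHS]k0; apply: eq_bigr => j _; rewrite -tnth_nth tnth_mktuple.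
  rewrite /free => /eqP dX; have := dimvS (subvf <<X>>%VS).
  by rewrite dX size_tuple ltnn.
pose B : {linear H -> H} := HB.pack b (GRing.isLinear.Build _ _ _ _ _ bb.1).
apply: (@iter_unit _ _ B N (fun k => c (inord k))) => //.
  by exists i0 => //; rewrite inord_val.
move=> x; rewrite -[RHS](rep0 SPhi x) -cs (rep_sum SPhi) => [|i].
  apply: eq_bigr => i _; rewrite inord_val (repZ SPhi) ?(sP i).1 //.
  by rewrite (sP i).2.
by apply: memvZ; exact: (sP i).1.
Qed.

(** One $g$ in the span within $1/2$ of the identity is enough: if all $\langle w_ix,x\rangle$
    vanish, then $\|x\|^2=\langle(1-g)x,x\rangle\le\|x\|^2/2$. *)
Lemma closed_span_id_sep (H : hilbertType R) (X : set (H -> H)) :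
  X `<=` bounded_op (K := H) -> closed_span X idfun ->
  exists n (w : 'I_n -> H -> H), (forall i, X (w i)) /\
    forall x, (forall i, inner (w i x) x = 0) -> x = 0.
Proof.
move=> Xb [_ /(_ 2^-1)]; rewrite invr_gt0 ltr0n => /(_ isT).
case=> g [n [a [w [wX ->]]]] gid; exists n, w; split=> // x wx.
set g' := \sum_i _ in gid.
have gb : bounded_op g'.
  by apply: bounded_op_sum => i _; apply: bounded_opZ; exact: Xb.
have gx : inner (g' x) x = 0.
  rewrite /g' fct_sumE inner_suml big1 // => i _.
  by rewrite [inner _ _](innerZl (a i)) wx mulr0.
apply: hnorm_eq0; have h := opnorm_ub (bounded_opB (@bounded_op_id _ H) gb) x.
have : `|inner ((idfun \- g') x) x| <= ((2^-1 * hnorm x)%:C)%C * `|x|.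
  apply: le_trans (inner_norm_le _ _) _; rewrite ler_wpM2r // normE_hnorm lecR.
  by apply: le_trans h _; rewrite ler_wpM2r ?hnorm_ge0 // ltW.
rewrite /= innerDl innerNl gx subr0 ger0_norm ?inner_ge0 // inner_normE.
rewrite !normE_hnorm -rmorphXn -rmorphM lecR expr2 -mulrA.
move=> yle; have y0 : 0 <= hnorm x * hnorm x by rewrite mulr_ge0 ?hnorm_ge0.
have /eqP : hnorm x * hnorm x = 0 by lra.
by rewrite mulf_eq0 orbb => /eqP.
Qed.

Section TroUnit.
Context (H K : hilbertType R) (V : Type) (op : V -> H -> K) (ad : V -> K -> H).
Context (tp : V -> V -> V -> V).
Context d (S : {vspace 'M[C]_d}) (Phi : 'M[C]_d -> H -> H) (SPhi : op_rep S Phi).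
Hypothesis opb : forall v, bounded_op (op v).
Hypothesis adb : forall v, bounded_op (ad v).
Hypothesis op_ad : forall v, is_adjoint (op v) (ad v).
Hypothesis op_tp : forall a b c, op (tp a b c) = op a \o ad b \o op c.
Hypothesis op_comb : forall n (c : 'I_n -> C) (u : 'I_n -> V),
  exists v, op v = \sum_i c i *: op (u i).
Hypothesis ad_op : forall u v, exists2 s, s \in S & Phi s = ad u \o op v.

Lemma op_sumP n (c : 'I_n -> C) (u : 'I_n -> V) :
  exists v, forall x, op v x = \sum_i c i *: op (u i) x.
Proof.
have [v vE] := op_comb c u; exists v => x.
by rewrite vE fct_sumE.
Qed.

(* b = sum_i u_i^* u_i is injective and its powers lie in the range of Phi,
   which is finite dimensional, so 1 is a combination of b, b^2, ... *)
Lemma tro_unit n (u : 'I_n -> V) :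
  (forall x, (forall i, op (u i) x = 0) -> x = 0) ->
  exists v : 'I_n -> V, forall x, \sum_i ad (u i) (op (v i) x) = x.
Proof.
move=> u0; pose b x := \sum_i ad (u i) (op (u i) x).
have bb : bounded_op b.
  have -> : b = \sum_i (ad (u i) \o op (u i)).
    by apply/funext => x; rewrite fct_sumE.
  by apply: bounded_op_sum => i _; exact: bounded_op_comp.
have binj x : b x = 0 -> x = 0.
  move=> bx; apply: u0 => i; apply: inner_eq0.
  have : \sum_i inner (op (u i) x) (op (u i) x) = 0.
    rewrite -[RHS](inner0l x) -bx inner_suml; apply: eq_bigr => j _.
    by rewrite (is_adjoint_sym (op_ad _)).
  move/eqP; rewrite psumr_eq0 => [/allP h|j _]; last exact: inner_ge0.
  exact/eqP/(h i (mem_index_enum i)).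
(* $u_ib^k$ stays in the TRO: each $b=\sum_ju_j^*u_j$ is absorbed by the ternary product. *)
have pw k i : exists v, forall x, op v x = op (u i) (iter k b x).
  elim: k => [|k [v vE]]; first by exists (u i).
  have [w wE] := op_sumP (fun _ => 1) (fun j => tp v (u j) (u j)).
  exists w => x; rewrite wE iterSr -vE /b (bop_sum (opb v)).
  by apply: eq_bigr => j _; rewrite scale1r op_tp.
have [N [e eE]] : exists M (e : nat -> C),
    forall x, x = \sum_(k < M) e k *: iter k.+1 b x.
  apply: (rep_iter_unit SPhi bb) => // k.
  have /choice [s sP] : forall i, exists s, s \in S /\
      forall x, Phi s x = ad (u i) (op (u i) (iter k b x)).
    move=> i; have [v vE] := pw k i; have [s sS sE] := ad_op (u i) v.
    by exists s; split=> // x; rewrite sE /= vE.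
  exists (\sum_i s i); first by apply: rpred_sum => i _; have [] := sP i.
  move=> x; rewrite (rep_sum SPhi) => [|i]; last by have [] := sP i.
  by apply: eq_bigr => i _; have [_ ->] := sP i.
(* With $1=\sum_ke_kb^{k+1}$, the choice $v_i=\sum_ke_ku_ib^k$ gives $\sum_iu_i^*v_i=1$. *)
have /choice [v vE] : forall i, exists v, forall x,
    op v x = \sum_(k < N) e k *: op (u i) (iter k b x).
  move=> i; have /choice [w wE] := fun k : 'I_N => pw k i.
  have [v vE] := op_sumP (fun k => e k) w; exists v => x.
  by rewrite vE; apply: eq_bigr => k _; rewrite wE.
exists v => x; rewrite [RHS]eE.
under eq_bigr do rewrite vE (bop_sum (adb _)).
rewrite exchange_big; apply: eq_bigr => k _ /=.
rewrite /b scaler_sumr; apply: eq_bigr => i _.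
by rewrite (bopZ (adb _)).
Qed.

End TroUnit.
End Unit.

(** * Kraus form of the pairings of a TRO *)

Section KrausPairing.
Variable R : realType.
Local Notation C := R[i].
Context (H K : hilbertType R) (V : Type) (op : V -> H -> K) (ad : V -> K -> H).
Context (d d' : nat) (S : {vspace 'M[C]_d}) (T : {vspace 'M[C]_d'}).
Context (Phi : 'M[C]_d -> H -> H) (Psi : 'M[C]_d' -> K -> K).
Hypotheses (SPhi : op_rep S Phi) (TPsi : op_rep T Psi).
Hypotheses (T1 : 1%:M \in T) (Ta : adj_closed T).
Hypothesis adb : forall v, bounded_op (ad v).
Hypothesis op_ad : forall v, is_adjoint (op v) (ad v).
Context (n : nat) (e : 'I_n -> V) (cf : V -> 'I_n -> C).
Hypothesis op_cf : forall v, op v = \sum_i cf v i *: op (e i).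
Context (A : V -> 'M[C]_d' -> V -> 'M[C]_d).
Hypothesis AS : forall u t v, t \in T -> A u t v \in S.
Hypothesis PhiA : forall u t v, t \in T -> Phi (A u t v) = ad u \o Psi t \o op v.

Lemma op_cfE v x : op v x = \sum_i cf v i *: op (e i) x.
Proof. by rewrite {1}op_cf fct_sumE. Qed.

Lemma ad_cfE v y : ad v y = \sum_i (cf v i)^* *: ad (e i) y.
Proof.
apply: inner_extl => z; rewrite -[LHS]innerC -op_ad op_cfE inner_suml rmorph_sum.
rewrite inner_suml; apply: eq_bigr => i _.
rewrite /= !innerZl rmorphM (is_adjoint_sym (op_ad _)).
by congr (_ * _); exact: innerC.
Qed.

Lemma pairing_cf u t v : t \in T ->
  A u t v = \sum_i \sum_j ((cf u i)^* * cf v j) *: A (e i) t (e j).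
Proof.
move=> tT; have mem i j : ((cf u i)^* * cf v j) *: A (e i) t (e j) \in S.
  by rewrite memvZ ?AS.
have mem2 i : \sum_j ((cf u i)^* * cf v j) *: A (e i) t (e j) \in S.
  by apply: rpred_sum => j _; exact: mem.
apply: (rep_inj SPhi); [exact: AS|by apply: rpred_sum => i _; exact: mem2|].
move=> x; rewrite (rep_sum SPhi) //.
rewrite PhiA //= ad_cfE; apply: eq_bigr => i _.
rewrite (rep_sum SPhi) // op_cfE (bop_sum (rep_bounded TPsi tT)).
rewrite (bop_sum (adb _)) scaler_sumr; apply: eq_bigr => j _.
rewrite (repZ SPhi) ?AS // PhiA //= (bopZ (rep_bounded TPsi tT)) (bopZ (adb _)).
by rewrite scalerA.
Qed.

(** The blocks $A(e_i,F,e_j)$ represent $e_i^*\Psi(F)e_j$; as [Psi] preserves and [Phi] reflects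
    block positivity, their entries satisfy the hypothesis of [arveson]. The coefficients [cf]
    extend the result from the spanning family to all of [V]. *)
Lemma kraus_pairing : exists N (mu : 'I_N -> V -> 'M[C]_(d', d)),
  forall u t v, t \in T -> \sum_l (mu l u)^t* *m t *m mu l v = A u t v.
Proof.
pose J := ('I_n * 'I_d)%type.
pose g (j k : J) t := A (e j.1) t (e k.1) j.2 k.2.
have [|F FT Fpos|B BE] := @arveson _ d' J T g T1 Ta.
- move=> j k a s t sT tT; rewrite /g.
  suff -> : A (e j.1) (a *: s + t) (e k.1) =
    a *: A (e j.1) s (e k.1) + A (e j.1) t (e k.1) by rewrite !mxE.
  have stT : a *: s + t \in T by rewrite memvD ?memvZ.
  apply: (rep_inj SPhi); rewrite ?AS //; first by rewrite memvD ?memvZ ?AS.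
  move=> x; rewrite (repZD SPhi) ?AS // !PhiA //= (repZD TPsi) //.
  by rewrite (bopP (adb _)).
- pose G (j k : J) := A (e j.1) (F j k) (e k.1).
  have GS j k : G j k \in S by rewrite AS ?FT.
  have := (rep_pos SPhi GS).2 _ (fun j : J => delta_mx j.2 0).
  under eq_bigr do under eq_bigr do rewrite dotc_delta.
  apply => x; have := (rep_pos TPsi FT).1 Fpos (fun j => op (e j.1) (x j)).
  congr (0 <= _); apply: eq_bigr => j _; apply: eq_bigr => k _.
  by rewrite /G PhiA ?FT //= (is_adjoint_sym (op_ad _)).
pose m l i : 'M[C]_(d', d) := \matrix_(p, b) B l (i, b) p 0.
exists #|{: J * 'I_d'}|, (fun l v => \sum_i cf v i *: m l i) => u t v tT.
have mcol l i b : m l i *m delta_mx b 0 = B l (i, b).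
  by rewrite -colE; apply/matrixP => p q; rewrite !mxE ord1.
have mE l i j : ((m l i)^t* *m t *m m l j) =
    \matrix_(a, b) dotc (B l (i, a)) (t *m B l (j, b)).
  apply/matrixP => a b; rewrite -[LHS]dotc_delta mxE -!mulmxA dotc_adjr trmxCK.
  by rewrite !mcol.
rewrite pairing_cf //.
transitivity (\sum_l \sum_i \sum_j
    ((cf u i)^* * cf v j) *: ((m l i)^t* *m t *m m l j)).
  apply: eq_bigr => l _; rewrite adjmx_sum !mulmx_suml; apply: eq_bigr => i _.
  rewrite mulmx_sumr; apply: eq_bigr => j _.
  by rewrite adjmxZ -!scalemxAl -scalemxAr scalerA.
rewrite exchange_big; apply: eq_bigr => i _ /=.
rewrite exchange_big; apply: eq_bigr => j _ /=.
rewrite -scaler_sumr; congr (_ *: _); apply/matrixP => a b.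
rewrite summxE; have := BE (i, a) (j, b) t tT; rewrite /g /= => ->.
by apply: eq_bigr => l _; rewrite mE mxE.
Qed.

End KrausPairing.

(** * TROs of matrices *)

Section MatrixTro.
Variable R : realType.
Local Notation C := R[i].

Lemma mxfun_bounded d d' (A : 'M[C]_(d', d)) : bounded_op (mxfun A).
Proof. by apply/bounded_opP; split; [exact: mxfun_is_linear|exact: mxfun_bound]. Qed.

Lemma mxfun_adjoint d d' (A : 'M[C]_(d', d)) :
  is_adjoint (mxfun A) (mxfun (A^t*)).
Proof. by move=> x y; rewrite !inner_euclid /mxfun dotc_adjr. Qed.

Lemma mxfunM d d' d'' (A : 'M[C]_(d'', d')) (B : 'M[C]_(d', d)) :
  mxfun A \o mxfun B = mxfun (A *m B).
Proof. by apply/funext => x; rewrite /mxfun /= mulmxA. Qed.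

Lemma opnorm_subrr (H K : hilbertType R) (f : H -> K) : opnorm (f \- f) = 0.
Proof.
rewrite /opnorm; have -> : [set hnorm ((f \- f) x) | x in
    [set x : H | hnorm x <= 1]] = [set 0]; last by rewrite sup1.
apply/seteqP; split => [_ [x _ <-]|_ ->] /=; first by rewrite subrr hnorm0.
by exists 0; rewrite /= ?subrr ?hnorm0.
Qed.

Lemma sub_norm_closure (H K : hilbertType R) (A : set (H -> K)) :
  A `<=` bounded_op (K := K) -> A `<=` norm_closure A.
Proof.
move=> Ab f Af; split; first exact: Ab.
by move=> e e0; exists f; rewrite ?opnorm_subrr.
Qed.

Lemma ops_bounded d (S : {vspace 'M[C]_d}) : ops S `<=` bounded_op (K := euclid R d).
Proof. by move=> _ [s _ <-]; exact: mxfun_bounded. Qed.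

Lemma closed_span_id (H : hilbertType R) (X : set (H -> H)) n (w : 'I_n -> H -> H) :
  (forall i, X (w i)) -> (forall x, \sum_i w i x = x) ->
  closed_span X idfun.
Proof.
move=> wX wid; split; first exact: bounded_op_id.
move=> e e0; exists idfun.
  exists n, (fun _ => 1), w; split=> //; apply/funext => x.
  by rewrite fct_sumE -[LHS]wid; apply: eq_bigr => i _; rewrite scale1r.
by rewrite opnorm_subrr.
Qed.

(** The expansions of $1$ are exact finite sums, so nondegeneracy needs no approximation. *)
Lemma tro_of_matrices d d' (S : {vspace 'M[C]_d}) (T : {vspace 'M[C]_d'})
    (N : set 'M[C]_(d', d)) (I J : nat)
    (a b : 'I_I -> 'M[C]_(d', d)) (u v : 'I_J -> 'M[C]_(d', d)) :
  N 0 -> (forall c x y, N x -> N y -> N (c *: x + y)) ->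
  (forall x y z, N x -> N y -> N z -> N (x *m y^t* *m z)) ->
  (forall x s y, N x -> s \in S -> N y -> x *m s *m y^t* \in T) ->
  (forall x t y, N x -> t \in T -> N y -> x^t* *m t *m y \in S) ->
  (forall i, N (a i)) -> (forall i, N (b i)) -> \sum_i (a i)^t* *m b i = 1%:M ->
  (forall j, N (u j)) -> (forall j, N (v j)) -> \sum_j u j *m (v j)^t* = 1%:M ->
  TRO_equivalent (ops S) (ops T).
Proof.
move=> N0 Nlin Ntro NT NS Na Nb ab Nu Nv uv.
pose M := @mxfun R d d' @` N.
have adjM g : adj_set M g -> exists2 x, N x & g = mxfun (x^t*).
  case=> gb [_ [x Nx <-] xg]; exists x => //.
  exact: is_adjoint_uniq xg (mxfun_adjoint x).
have Madj x : N x -> adj_set M (mxfun (x^t*)).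
  move=> Nx; split; first exact: mxfun_bounded.
  by exists (mxfun x); [exists x|exact: mxfun_adjoint].
have MN x : N x -> M (mxfun x) by exists x.
exists M; split.
- split.
  + split.
    * by move=> _ [x _ <-]; exact: mxfun_bounded.
    * split.
        rewrite inE; exists 0 => //; apply/funext => x.
        by rewrite /mxfun mul0mx.
      move=> c f g; rewrite !inE => -[x Nx <-] [y Ny <-].
      exists (c *: x + y); first exact: Nlin.
      by apply/funext => w; rewrite /mxfun mulmxDl -scalemxAl.
    * move=> _ [_ [_ [x Nx <-] [_ /adjM[y Ny ->] <-]] [_ [z Nz <-] <-]].
      by rewrite !mxfunM; apply: MN; exact: Ntro.
  + apply: (closed_span_id (w := fun i => mxfun ((a i)^t*) \o mxfun (b i))).
      move=> i; exists (mxfun ((a i)^t*)); first exact: Madj.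
      by exists (mxfun (b i)) => //; exact: MN.
    move=> x; rewrite -[RHS]mul1mx -ab mulmx_suml; apply: eq_bigr => i _.
    by rewrite mxfunM.
  + apply: (closed_span_id (w := fun j => mxfun (u j) \o mxfun ((v j)^t*))).
      move=> j; exists (mxfun (u j)); first exact: MN.
      by exists (mxfun ((v j)^t*)) => //; exact: Madj.
    move=> x; rewrite -[RHS]mul1mx -uv mulmx_suml; apply: eq_bigr => j _.
    by rewrite mxfunM.
- move=> _ [_ [_ /adjM[x Nx ->] [_ [t tT <-] <-]] [_ [y Ny <-] <-]].
  apply: sub_norm_closure; first exact: ops_bounded.
  by exists (x^t* *m t *m y); [exact: NS|apply/funext => w; rewrite /mxop /mxfun /= !mulmxA].
- move=> _ [_ [_ [x Nx <-] [_ [s sS <-] <-]] [_ /adjM[y Ny ->] <-]].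
  apply: sub_norm_closure; first exact: ops_bounded.
  by exists (x *m s *m y^t*); [exact: NT|apply/funext => w; rewrite /mxop /mxfun /= !mulmxA].
Qed.

End MatrixTro.

(** * Elements of a TRO together with their adjoints *)

Section TroElements.
Variables (R : realType) (H K : hilbertType R) (M : set (H -> K)).
Local Notation C := R[i].

(* Elements of M with a bounded adjoint, which is carried along so that the
   Riesz representation theorem is not needed. *)
Record tro_elt := TroElt {
  eop : H -> K;
  ead : K -> H;
  eopM : M eop;
  eadb : bounded_op ead;
  eop_ad : is_adjoint eop ead }.

Hypothesis Mtro : TRO M.

Lemma eopb v : bounded_op (eop v).
Proof. by case: Mtro => Mb _ _; apply: Mb; exact: eopM. Qed.

Lemma ead_adj_set v : adj_set M (ead v).
Proof.
split; first exact: eadb.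
by exists (eop v); [exact: eopM|exact: eop_ad].
Qed.

Lemma adj_set_elt g : adj_set M g -> exists v, ead v = g.
Proof. by case=> gb [f Mf fg]; exists (TroElt Mf gb fg). Qed.

Lemma tro_tpM a b c : M (eop a \o ead b \o eop c).
Proof.
case: Mtro => _ _; apply; exists (eop a \o ead b).
  by exists (eop a); [exact: eopM|exists (ead b) => //; exact: ead_adj_set].
by exists (eop c) => //; exact: eopM.
Qed.

Definition elt_tp a b c : tro_elt :=
  TroElt (tro_tpM a b c)
    (bounded_op_comp (eadb c) (bounded_op_comp (eopb b) (eadb a)))
    (is_adjoint_comp (eop_ad c)
      (is_adjoint_comp (is_adjoint_sym (eop_ad b)) (eop_ad a))).

Lemma elt_comb n (c : 'I_n -> C) (u : 'I_n -> tro_elt) :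
  exists v, eop v = \sum_i c i *: eop (u i) /\
    ead v = \sum_i (c i)^* *: ead (u i).
Proof.
have [_ [M0 Mlin] _] := Mtro.
have Msum : M (\sum_i c i *: eop (u i)).
  elim/big_rec: _ => [|i f _ Mf]; first by have := M0; rewrite inE.
  have := Mlin (c i) (eop (u i)) f; rewrite !inE; apply=> //; exact: eopM.
have bsum : bounded_op (\sum_i (c i)^* *: ead (u i)).
  by apply: bounded_op_sum => i _; apply: bounded_opZ; exact: eadb.
have asum : is_adjoint (\sum_i c i *: eop (u i)) (\sum_i (c i)^* *: ead (u i)).
  move=> x y; rewrite !fct_sumE inner_suml inner_sumr; apply: eq_bigr => i _.
  have -> : (c i *: eop (u i)) x = c i *: eop (u i) x by [].
  have -> : ((c i)^* *: ead (u i)) y = (c i)^* *: ead (u i) y by [].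
  by rewrite innerZl innerZr conjCK eop_ad.
by exists (TroElt Msum bsum asum).
Qed.

End TroElements.

(** Finitely many values whose span has maximal dimension already span the whole image, with no
    linearity of [h] involved. *)
Lemma fin_span_image (F : fieldType) (W : vectType F) (V : Type) (h : V -> W) :
  exists r (e : 'I_r -> V), forall v, exists c : 'I_r -> F,
    h v = \sum_i c i *: h (e i).
Proof.
pose P k := `[< exists s : seq V, \dim <<map h s>> = k >].
have P0 : exists k, P k by exists (\dim <<map h [::]>>); apply/asboolP; exists [::].
have Pmax k : P k -> (k <= \dim {:W})%N.
  by move=> /asboolP[s <-]; exact: dimvS (subvf _).
case: (ex_maxnP P0 Pmax) => k /asboolP[s sk] kmax.
exists (size s), (tnth (in_tuple s)) => v.
have : h v \in <<map_tuple h (in_tuple s)>>%VS.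
  have sub : (<<map h s>> <= <<h v :: map h s>>)%VS.
    by rewrite span_cons addvSr.
  have -> : <<map_tuple h (in_tuple s)>>%VS = <<h v :: map h s>>%VS.
    apply/eqP; rewrite eqEdim sub /= sk kmax //; apply/asboolP.
    by exists (v :: s).
  by rewrite memv_span // mem_head.
move=> /coord_span hv; exists (fun i => coord (map_tuple h (in_tuple s)) i (h v)).
rewrite {1}hv; apply: eq_bigr => i _; congr (_ *: _).
by rewrite -tnth_nth tnth_map.
Qed.

(** The inductive form allows multilinear closure conditions to be checked on generators, one
    argument at a time. *)
Inductive lin_hull (F : pzRingType) (W : lmodType F) (G : set W) : set W :=
| hull0 : lin_hull G 0
| hull_lin c x y : lin_hull G x -> lin_hull G y -> lin_hull G (c *: x + y)
| hull_gen x : G x -> lin_hull G x.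

(** * From TROs of operators to TROs of matrices *)

Section Descent.
Variables (R : realType) (d d' : nat).
Local Notation C := R[i].
Variables (S : {vspace 'M[C]_d}) (T : {vspace 'M[C]_d'}).
Variables (H K : hilbertType R).
Variables (Phi : 'M[C]_d -> H -> H) (Psi : 'M[C]_d' -> K -> K).
Hypotheses (SPhi : op_rep S Phi) (TPsi : op_rep T Psi).
Hypotheses (Sg : nc_graph S) (Tg : nc_graph T).
Variable M : set (H -> K).
Hypothesis Mnd : nondegenerate_TRO M.
Hypothesis MTM : mul_set (mul_set (adj_set M) [set Psi t | t in [set` T]]) M `<=`
  norm_closure [set Phi s | s in [set` S]].
Hypothesis MSM : mul_set (mul_set M [set Phi s | s in [set` S]]) (adj_set M) `<=`
  norm_closure [set Psi t | t in [set` T]].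

Let Mtro : TRO M. Proof. by case: Mnd. Qed.
Let Mb f : M f -> bounded_op f. Proof. by case: Mtro => Mb _ _; exact: Mb. Qed.
Local Notation V := (tro_elt M).

Lemma ead_rep_eop (u v : V) t : t \in T ->
  exists2 s, s \in S & Phi s = ead u \o Psi t \o eop v.
Proof.
move=> tT; apply: (rep_range_closed SPhi); apply: MTM.
exists (ead u \o Psi t); last by exists (eop v) => //; exact: eopM.
exists (ead u); first exact: ead_adj_set.
by exists (Psi t) => //; exists t.
Qed.

Lemma eop_rep_ead (u v : V) s : s \in S ->
  exists2 t, t \in T & Psi t = eop u \o Phi s \o ead v.
Proof.
move=> sS; apply: (rep_range_closed TPsi); apply: MSM.
exists (eop u \o Phi s); last by exists (ead v) => //; exact: ead_adj_set.
exists (eop u); first exact: eopM.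
by exists (Phi s) => //; exists s.
Qed.

Lemma ead_eop (u v : V) : exists2 s, s \in S & Phi s = ead u \o eop v.
Proof.
have [s sS sE] := ead_rep_eop u v (proj1 Tg); exists s => //.
by rewrite sE (rep1 TPsi).
Qed.

Lemma eop_ead (u v : V) : exists2 t, t \in T & Psi t = eop u \o ead v.
Proof.
have [t tT tE] := eop_rep_ead u v (proj1 Sg); exists t => //.
by rewrite tE (rep1 SPhi).
Qed.

(** Nondegeneracy gives finitely many $u_i^*f_i$ as in [closed_span_id_sep]. If $u_ix=0$ for all
    $i$, then every $\langle u_i^*f_ix,x\rangle$ vanishes, so the $u_i$ are jointly injective. *)
Lemma unit_source : exists n (u v : 'I_n -> V),
  forall x, \sum_i ead (u i) (eop (v i) x) = x.
Proof.
have [_ id1 _] := Mnd.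
have [|n [w [wX w0]]] := closed_span_id_sep _ id1.
  move=> _ [g [gb _] [f Mf <-]]; apply: bounded_op_comp => //; exact: Mb.
have /choice [u uP] : forall i, exists u : V, exists f, w i = ead u \o f.
  move=> i; have [g /adj_set_elt[u <-] [f _ <-]] := wX i.
  by exists u, f.
exists n, u; apply: (tro_unit SPhi (tp := elt_tp Mtro)) => //.
- exact: eopb.
- exact: eadb.
- exact: eop_ad.
- by move=> m c z; have [v []] := elt_comb Mtro c z; exists v.
- exact: ead_eop.
move=> x ux; apply: w0 => i; have [f ->] := uP i.
by rewrite /= (is_adjoint_sym (eop_ad (u i))) ux -innerC inner0l conjC0.
Qed.

Lemma unit_target : exists n (u v : 'I_n -> V),
  forall y, \sum_i eop (u i) (ead (v i) y) = y.
Proof.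
have [_ _ id1] := Mnd.
have [|n [w [wX w0]]] := closed_span_id_sep _ id1.
  move=> _ [f Mf [g [gb _] <-]]; apply: bounded_op_comp => //; exact: Mb.
have /choice [u uP] : forall i, exists u : V, exists2 f, M f & w i = f \o ead u.
  move=> i; have [f Mf [g /adj_set_elt[u <-] <-]] := wX i.
  by exists u, f.
(* Applied to the adjoint TRO, in which the ternary product is reversed. *)
exists n, u; apply: (tro_unit TPsi (op := @ead _ _ _ _) (ad := @eop _ _ _ _)
  (tp := fun a b c => elt_tp Mtro c b a)) => //.
- exact: eadb.
- exact: eopb.
- by move=> v; apply: is_adjoint_sym; exact: eop_ad.
- move=> m c z; have [v [_ vE]] := elt_comb Mtro (fun i => (c i)^*) z.
  by exists v; rewrite vE; apply: eq_bigr => i _; rewrite conjCK.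
- exact: eop_ead.
move=> x ux; apply: w0 => i; have [f Mf ->] := uP i.
by rewrite /= ux (bop0 (Mb Mf)) inner0l.
Qed.

(* Via m |-> (n_j^* m)_j with 1 = sum_j m_j n_j^*, the elements of M embed
   linearly in a power of S, so they are spanned by finitely many. *)
Lemma tro_elt_span : exists n (e : 'I_n -> V), forall v : V,
  exists c : 'I_n -> C, eop v = \sum_i c i *: eop (e i).
Proof.
have [n [m [m' mm']]] := unit_target.
have /choice [th thP] : forall jv : 'I_n * V, exists s,
    s \in S /\ Phi s = ead (m' jv.1) \o eop jv.2.
  by move=> jv; have [s sS sE] := ead_eop (m' jv.1) jv.2; exists s.
pose h (v : V) : {ffun 'I_n -> 'M[C]_d} := [ffun j => th (j, v)].
have [r [e eP]] := fin_span_image h.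
exists r, e => v; have [c hv] := eP v; exists c; apply/funext => x.
rewrite fct_sumE -[LHS]mm'.
have thE j : th (j, v) = \sum_i c i *: th (j, e i).
  have := congr1 (fun f : {ffun _ -> _} => f j) hv; rewrite ffunE => ->.
  by rewrite sum_ffunE; apply: eq_bigr => i _; rewrite !ffunE.
transitivity (\sum_j \sum_i c i *: eop (m j) (ead (m' j) (eop (e i) x))).
  apply: eq_bigr => j _.
  have -> : ead (m' j) (eop v x) = Phi (th (j, v)) x by rewrite (thP (j, v)).2.
  rewrite thE (rep_sum SPhi) => [|i]; last by rewrite memvZ ?(thP (j, e i)).1.
  rewrite (bop_sum (eopb Mtro _)); apply: eq_bigr => i _.
  by rewrite (repZ SPhi) ?(thP (j, e i)).1 // (bopZ (eopb Mtro _)) (thP (j, e i)).2.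
rewrite exchange_big; apply: eq_bigr => i _ /=.
by rewrite -scaler_sumr mm'.
Qed.

Lemma tro_equivalent_descent : acts_irreducibly S -> acts_irreducibly T ->
  TRO_equivalent (ops S) (ops T).
Proof.
move=> Sirr Tirr.
have [S1 Sa] := Sg; have [T1 Ta] := Tg.
have [r [e /choice [cf cfP]]] := tro_elt_span.
have [K0 [m' [n' unitH]]] := unit_source.
have [J0 [m [n unitK]]] := unit_target.
have unitH' x : \sum_i ead (n' i) (eop (m' i) x) = x.
  apply: inner_extl => z; rewrite inner_suml -[z in RHS]unitH inner_sumr.
  apply: eq_bigr => i _.
  by rewrite (is_adjoint_sym (eop_ad _)) (eop_ad (m' i)).
have unitK' y : \sum_i eop (n i) (ead (m i) y) = y.
  apply: inner_extl => z; rewrite inner_suml -[z in RHS]unitK inner_sumr.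
  apply: eq_bigr => i _.
  by rewrite (eop_ad (n i)) (is_adjoint_sym (eop_ad (m i))).
have /choice [A0 A0P] : forall utv : V * 'M[C]_d' * V, exists s, utv.1.2 \in T ->
    s \in S /\ Phi s = ead utv.1.1 \o Psi utv.1.2 \o eop utv.2.
  case=> -[u t] v; have [tT|tT] := boolP (t \in T); last by exists 0.
  by have [s sS sE] := ead_rep_eop u v tT; exists s.
have /choice [B0 B0P] : forall usv : V * 'M[C]_d * V, exists t, usv.1.2 \in S ->
    t \in T /\ Psi t = eop usv.1.1 \o Phi usv.1.2 \o ead usv.2.
  case=> -[u s] v; have [sS|sS] := boolP (s \in S); last by exists 0.
  by have [t tT tE] := eop_rep_ead u v sS; exists t.
have [p [mu muE]] := @kraus_pairing _ _ _ V (@eop _ _ _ M) (@ead _ _ _ M) _ _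
  S T Phi Psi SPhi TPsi T1 Ta (@eadb _ _ _ M) (@eop_ad _ _ _ M)
  r e cf cfP (fun u t v => A0 (u, t, v)) (fun u t v tT => (A0P (u, t, v) tT).1)
  (fun u t v tT => (A0P (u, t, v) tT).2).
have cfP' v : ead v = \sum_i (cf v i)^* *: ead (e i).
  apply/funext => y; rewrite fct_sumE.
  exact: (ad_cfE (@eop_ad _ _ _ M) cfP).
(* The same with [H] and [K] exchanged: the adjoints act as the operators, so the coefficients are
   conjugated and [nu] is the adjoint of [nu']. *)
have [p' [nu' nu'E]] := @kraus_pairing _ _ _ V (@ead _ _ _ M) (@eop _ _ _ M) _ _
  T S Psi Phi TPsi SPhi S1 Sa (eopb Mtro)
  (fun v => is_adjoint_sym (eop_ad v))
  r e (fun v i => (cf v i)^*) cfP' (fun u s v => B0 (u, s, v))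
  (fun u s v sS => (B0P (u, s, v) sS).1) (fun u s v sS => (B0P (u, s, v) sS).2).
pose nu l v := (nu' l v)^t*.
have AE u t v : t \in T -> pairS mu u t v = A0 (u, t, v) by exact: muE.
have BE u s v : s \in S -> pairT nu u s v = B0 (u, s, v).
  move=> sS; rewrite -nu'E //; apply: eq_bigr => l _.
  by rewrite trmxCK.
have AS u t v : t \in T -> pairS mu u t v \in S.
  by move=> tT; rewrite AE // (A0P (u, t, v) tT).1.
have BT u s v : s \in S -> pairT nu u s v \in T.
  by move=> sS; rewrite BE // (B0P (u, s, v) sS).1.
have PhiA u t v x : t \in T ->
    Phi (pairS mu u t v) x = ead u (Psi t (eop v x)).
  by move=> tT; rewrite AE // (A0P (u, t, v) tT).2.
have PsiB u s v y : s \in S ->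
    Psi (pairT nu u s v) y = eop u (Phi s (ead v y)).
  by move=> sS; rewrite BE // (B0P (u, s, v) sS).2.
(* A general [y] serves several hypotheses at once: $y=n'$ gives [idS], and $y_k=n'_kb^*c$ gives
   [tpS] and [tpS1]. *)
have PhiAB (y : 'I_K0 -> V) s x : s \in S ->
    Phi (\sum_j \sum_k pairS mu (n' j) (pairT nu (m' j) s (m' k)) (y k)) x =
    Phi s (\sum_k ead (m' k) (eop (y k) x)).
  move=> sS; rewrite (rep_sum SPhi) => [|j]; last first.
    by apply: rpred_sum => k _; rewrite AS ?BT.
  rewrite -[RHS]unitH'; apply: eq_bigr => j _.
  rewrite (rep_sum SPhi) => [|k]; last by rewrite AS ?BT.
  rewrite (bop_sum (rep_bounded SPhi sS)) (bop_sum (eopb Mtro _)).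
  rewrite (bop_sum (eadb _)); apply: eq_bigr => k _.
  by rewrite PhiA ?BT // PsiB.
have PsiBA (y : 'I_J0 -> V) t x : t \in T ->
    Psi (\sum_j \sum_k pairT nu (y j) (pairS mu (n j) t (n k)) (m k)) x =
    \sum_j eop (y j) (ead (n j) (Psi t x)).
  move=> tT; rewrite (rep_sum TPsi) => [|j]; last first.
    by apply: rpred_sum => k _; rewrite BT ?AS.
  apply: eq_bigr => j _; rewrite -[x in RHS]unitK'.
  rewrite (rep_sum TPsi) => [|k]; last by rewrite BT ?AS.
  rewrite (bop_sum (rep_bounded TPsi tT)) (bop_sum (eadb _)).
  rewrite (bop_sum (eopb Mtro _)); apply: eq_bigr => k _.
  by rewrite PsiB ?AS // PhiA.
have memAB (y : 'I_K0 -> V) s : s \in S ->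
    \sum_j \sum_k pairS mu (n' j) (pairT nu (m' j) s (m' k)) (y k) \in S.
  by move=> sS; do 2!apply: rpred_sum => ? _; rewrite AS ?BT.
have memBA (y : 'I_J0 -> V) t : t \in T ->
    \sum_j \sum_k pairT nu (y j) (pairS mu (n j) t (n k)) (m k) \in T.
  by move=> tT; do 2!apply: rpred_sum => ? _; rewrite BT ?AS.
have Phi1 x : Phi 1%:M x = x by rewrite (rep1 SPhi).
have Psi1 x : Psi 1%:M x = x by rewrite (rep1 TPsi).
(* Each remaining hypothesis is an identity of operators on [H] or [K] that descends by
   [rep_inj]. *)
have [] := @tro_representation R d d' S T Sg Tg Sirr Tirr V (elt_tp Mtro)
  _ _ _ _ mu nu m n m' n' AS BT.
- move=> s sS; apply: (rep_inj SPhi); [exact: memAB|by []|].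
  by move=> x; rewrite PhiAB // unitH.
- move=> t tT; apply: (rep_inj TPsi); [exact: memBA|by []|].
  by move=> x; rewrite PsiBA // unitK.
- have mem1 : \sum_j pairS mu (m' j) 1%:M (n' j) \in S.
    by apply: rpred_sum => j _; rewrite AS.
  apply: (rep_inj SPhi) => // x; rewrite (rep_sum SPhi) => [|j]; last by rewrite AS.
  rewrite Phi1 -[RHS]unitH; apply: eq_bigr => j _.
  by rewrite PhiA // Psi1.
- have mem1 : \sum_j pairT nu (m j) 1%:M (n j) \in T.
    by apply: rpred_sum => j _; rewrite BT.
  apply: (rep_inj TPsi) => // x; rewrite (rep_sum TPsi) => [|j]; last by rewrite BT.
  rewrite Psi1 -[RHS]unitK; apply: eq_bigr => j _.
  by rewrite PsiB // Phi1.
- move=> x t a b c tT; apply: (rep_inj SPhi); [exact: AS|exact/memAB/AS|].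
  move=> z; rewrite PhiAB ?AS //.
  have -> : \sum_k ead (m' k) (eop (elt_tp Mtro (n' k) b c) z) = ead b (eop c z).
    exact: unitH.
  by rewrite !PhiA.
- move=> b c; apply: (rep_inj SPhi); [exact: AS|exact: memAB|].
  move=> z; rewrite PhiAB // Phi1 PhiA // Psi1.
  by rewrite -[LHS]unitH.
- move=> a b c s x sS; apply: (rep_inj TPsi); [exact: BT|exact/memBA/BT|].
  move=> z; rewrite PsiBA ?BT // !PsiB //.
  by rewrite -(bop_sum (eopb Mtro a)) -(bop_sum (eadb b)) unitK.
- move=> a b; apply: (rep_inj TPsi); [exact: BT|exact: memBA|].
  move=> z; rewrite PsiBA // Psi1 PsiB // Phi1.
  by rewrite -(bop_sum (eopb Mtro a)) -(bop_sum (eadb b)) unitK.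
- move=> x a b c; apply: (rep_inj SPhi); [by rewrite AS ?BT|exact: AS|].
  by move=> z; rewrite !PhiA ?BT // PsiB // Phi1 Psi1.
- move=> a b c x; apply: (rep_inj TPsi); [by rewrite BT ?AS|exact: BT|].
  by move=> z; rewrite !PsiB ?AS // PhiA // Phi1 Psi1.
move=> xi [xitp xiT xiS xi1 xi1'].
pose N := lin_hull (range xi).
have Nxi v : N (xi v) by apply: hull_gen; exists v.
apply: (tro_of_matrices (N := N) (a := fun k => xi (m' k)) (b := fun k => xi (n' k))
  (u := fun j => xi (m j)) (v := fun j => xi (n j))) => //.
- exact: hull0.
- by move=> c x y; exact: hull_lin.
- move=> x y z Nx Ny Nz.
  elim: Nx => [|c x1 x2 _ IH1 _ IH2|_ [a _ <-]].
  + by rewrite !mul0mx; exact: hull0.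
  + by rewrite !mulmxDl -!scalemxAl; exact: hull_lin.
  elim: Ny => [|c x1 x2 _ IH1 _ IH2|_ [b _ <-]].
  + by rewrite adjmx0 mulmx0 mul0mx; exact: hull0.
  + rewrite adjmxD adjmxZ mulmxDr mulmxDl -scalemxAr -scalemxAl.
    exact: hull_lin.
  elim: Nz => [|c x1 x2 _ IH1 _ IH2|_ [b' _ <-]].
  + by rewrite mulmx0; exact: hull0.
  + by rewrite mulmxDr -scalemxAr; exact: hull_lin.
  by rewrite xitp; exact: Nxi.
- move=> x s y Nx sS Ny.
  elim: Nx => [|c x1 x2 _ IH1 _ IH2|_ [a _ <-]].
  + by rewrite !mul0mx mem0v.
  + by rewrite !mulmxDl -!scalemxAl memvD ?memvZ.
  elim: Ny => [|c x1 x2 _ IH1 _ IH2|_ [b _ <-]].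
  + by rewrite adjmx0 mulmx0 mem0v.
  + by rewrite adjmxD adjmxZ mulmxDr -scalemxAr memvD ?memvZ.
  exact: xiT.
- move=> x t y Nx tT Ny.
  elim: Nx => [|c x1 x2 _ IH1 _ IH2|_ [a _ <-]].
  + by rewrite adjmx0 !mul0mx mem0v.
  + by rewrite adjmxD adjmxZ !mulmxDl -!scalemxAl memvD ?memvZ.
  elim: Ny => [|c x1 x2 _ IH1 _ IH2|_ [b _ <-]].
  + by rewrite mulmx0 mem0v.
  + by rewrite mulmxDr -scalemxAr memvD ?memvZ.
  exact: xiS.
Qed.

End Descent.

Theorem theorem7p5 (R : realType) (d d' : nat)
    (S : {vspace 'M[R[i]]_d}) (T : {vspace 'M[R[i]]_d'}) :
  nc_graph S -> nc_graph T -> acts_irreducibly S -> acts_irreducibly T ->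
  (Delta_equivalent (ops S) (ops T) <-> TRO_equivalent (ops S) (ops T)).
Proof.
move=> Sg Tg Sirr Tirr; split; last first.
  (* In this direction the given inclusions serve as the embeddings. *)
  have id_ucoe n (U : {vspace 'M[R[i]]_n}) :
      unital_complete_order_embedding (ops U) (@id (euclid R n -> euclid R n)).
    split=> // [|k F _]; first exact: ops_bounded.
    by rewrite (_ : map_mx id F = F) //; apply/matrixP => i j; rewrite mxE.
  move=> ST; exists (euclid R d), (euclid R d'), id, id.
  by rewrite !image_id.
case=> H [K [phi [psi [/ucoe_rep SPhi /ucoe_rep TPsi [M [Mnd MTM MSM]]]]]].
apply: (tro_equivalent_descent SPhi TPsi Sg Tg Mnd) => //.
  by move: MTM; rewrite /ops !image_comp.
by move: MSM; rewrite /ops !image_comp.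
Qed.
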